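(* Let $q$ be a prime power and suppose that $G\cong \mathrm{PSL}(2,q)$. Then for each prime $p$, the generalized character $\Psi_{1,p,G}$ is a character of $G$ which may be afforded by a projective $RG$-module, where $(\mathbb{K},R,\mathbb{F})$ is a splitting $p$-modular system for $G$.
   Context: A splitting $p$-modular system $(\mathbb{K},R,\mathbb{F})$ for $G$ consists of a complete discrete valuation ring $R$ with field of fractions $\mathbb{K}$ of characteristic $0$ and residue field $\mathbb{F}$ of characteristic $p$, such that $\mathbb{K}$ and $\mathbb{F}$ are splitting fields for $G$. An element of $G$ is $p$-regular if its order is prime to $p$ and $p$-singular otherwise; a $p$-element is an element whose order is a power of $p$ (including the identity). $\Psi_{1,p,G}$ is the class function of $G$ which is $0$ on all $p$-singular elements and whose value at a $p$-regular $y\in G$ is the number of $p$-elements of $C_G(y)$; it is a generalized character of $G$. The prime $p$ need not divide $q$. *)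

(* Defs.v *)
From HB Require Import structures.
From mathcomp Require Import all_boot all_order all_algebra.
From mathcomp Require Import all_fingroup all_solvable all_field all_character.

Set Implicit Arguments.
Unset Strict Implicit.
Unset Printing Implicit Defensive.

Import GroupScope GRing.Theory.
Local Open Scope ring_scope.

Definition SL2 (k : finFieldType) : {set {'GL_2[k]}} :=
  [set u : {'GL_2[k]} | \det (GLval u) == 1].

Lemma SL2_group_set (k : finFieldType) : group_set (SL2 k).
Proof.
apply/group_setP; split=> [|u v]; rewrite !inE; first by rewrite GL_1E det1.
by move=> /eqP du /eqP dv; rewrite GL_MxE det_mulmx du dv mulr1.
Qed.

Canonical SL2_group (k : finFieldType) : {group {'GL_2[k]}} :=
  Group (SL2_group_set k).

Definition PSL2 (k : finFieldType) := (SL2 k / 'Z(SL2 k))%g.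

Section Psi.

Variables (p : nat) (gT : finGroupType) (G : {group gT}).

(* p.-elt x says that #[x] is a power of p (so 1 is a p-element), and p^'.-elt
   y that #[y] is prime to p. *)
Definition Psi_val (y : gT) : nat :=
  if p^'.-elt y then #|[set x in 'C_G[y] | p.-elt x]| else 0%N.

Lemma Psi_class_fun :
  is_class_fun <<G>>
    [ffun y => if y \in G then (Psi_val y)%:R else 0 : algC].
Proof.
rewrite genGid; apply: intro_class_fun => [y z Gy Gz | y /negPf-> //].
rewrite groupJ // Gy /Psi_val p_eltJ; case: ifP => // _; congr _%:R.
rewrite -(cardJg [set x in 'C_G[y] | p.-elt x] z).
apply: eq_card => x.
rewrite mem_conjg [LHS]in_set [RHS]in_set !in_setI.
by rewrite p_eltJ groupJr ?groupV // -mem_conjg -normJ conjg_set1.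
Qed.

Definition Psi1 : 'CF(G) := Cfun 0 Psi_class_fun.

End Psi.

Section CompleteDVR.

Variable R : idomainType.

Definition rdivides (a b : R) : Prop := exists c, b = c * a.

Definition is_uniformizer (pi : R) : Prop :=
  [/\ pi != 0, pi \isn't a GRing.unit
    & forall a, a != 0 ->
        exists n : nat, exists2 u, u \is a GRing.unit & a = u * pi ^+ n].

(* The maximal ideal of R is generated by pi, so rdivides (pi ^+ n) a means
   that a lies in its n-th power. *)
Definition adic_cauchy (pi : R) (a : nat -> R) : Prop :=
  forall n, exists N, forall i j, (N <= i)%N -> (N <= j)%N ->
    rdivides (pi ^+ n) (a i - a j).

Definition adic_limit (pi : R) (a : nat -> R) (b : R) : Prop :=
  forall n, exists N, forall i, (N <= i)%N -> rdivides (pi ^+ n) (a i - b).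

Definition complete_dvr : Prop :=
  exists2 pi, is_uniformizer pi
    & forall a, adic_cauchy pi a -> exists b, adic_limit pi a b.

End CompleteDVR.

(* K is the field of fractions of R through iota, and F the residue field of R
   through rho: the maximal ideal of a local ring is its set of nonunits. *)
Record splitting_modular_system (p : nat) (gT : finGroupType) (G : {group gT})
    (R : idomainType) (K F : fieldType)
    (iota : {rmorphism R -> K}) (rho : {rmorphism R -> F}) : Prop :=
  SplittingModularSystem {
    sms_complete_dvr : complete_dvr R;
    sms_frac_inj : injective iota;
    sms_frac_surj : forall z : K, exists a, exists2 b, b != 0 & z = iota a / iota b;
    sms_residue_surj : forall z : F, exists a, z = rho a;
    sms_residue_ker : forall a, (rho a == 0) = (a \isn't a GRing.unit);
    sms_pchar_frac : [pchar K] =i pred0;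
    sms_pchar_residue : p \in [pchar F];
    sms_split_frac : group_splitting_field K G;
    sms_split_residue : group_splitting_field F G
  }.

Section GroupModules.

Variables (R : comUnitRingType) (gT : finGroupType) (G : {group gT}).

(* Right RG-modules, as R-modules with an R-linear right action of G; this
   agrees with the action of matrix representations on row vectors. *)
Definition is_Gmodule (V : lmodType R) (act : gT -> {linear V -> V}) : Prop :=
  (forall v, act 1%g v = v) /\
  {in G &, forall x y v, act (x * y)%g v = act y (act x v)}.

Definition is_Ghom (U V : lmodType R)
    (actU : gT -> {linear U -> U}) (actV : gT -> {linear V -> V})
    (f : {linear U -> V}) : Prop :=
  {in G, forall x u, f (actU x u) = actV x (f u)}.

Definition projective_Gmodule (P : lmodType R) (actP : gT -> {linear P -> P})
  : Prop :=
  is_Gmodule actP /\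
  forall (A B : lmodType R)
    (actA : gT -> {linear A -> A}) (actB : gT -> {linear B -> B}),
    is_Gmodule actA -> is_Gmodule actB ->
  forall (f : {linear A -> B}) (g : {linear P -> B}),
    is_Ghom actA actB f -> (forall b, exists a, f a = b) ->
    is_Ghom actP actB g ->
  exists2 h : {linear P -> A}, is_Ghom actP actA h & forall v, f (h v) = g v.

Definition repr_act n (rG : mx_representation R G n) (x : gT)
  : {linear 'rV[R]_n -> 'rV[R]_n} := mulmxr (rG x).

Definition projective_repr n (rG : mx_representation R G n) : Prop :=
  projective_Gmodule (repr_act rG).

End GroupModules.

(* R is local, so a finitely generated projective RG-module M is free of finite
   rank over R: it is the module of row vectors of a matrix representation rG.
   map_repr iota rG is then its extension of scalars from R to K. *)
Definition afforded_by_projective (gT : finGroupType) (G : {group gT})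
    (R : idomainType) (K : fieldType) (iota : {rmorphism R -> K})
    (psi : gT -> nat) : Prop :=
  exists n : nat, exists2 rG : mx_representation R G n,
    projective_repr rG &
    {in G, forall x, \tr (map_repr iota rG x) = (psi x)%:R}.

(* Main.v *)
(** Modules are cut out of permutation modules R[G / H] by idempotent matrices
commuting with G; over the local ring R such a summand is free, and Higman's
criterion shows that it is projective.

If nontrivial p-elements have abelian centralizers (p odd or q even), the Sylow
p-subgroups are trivial intersection sets. Let P be one and N = P : H its
normalizer. Then R[G / N] = R + X with X projective, the projective R[G / H]
maps onto X, and the kernel of this map has character Psi.

Let p = 2 and q be odd, U of order q, B = U T0 a Borel subgroup, X and X' the
cyclic tori of even and odd orders (q - s)/2 and (q + s)/2, M = O_2'(X), and
Gamma = Ind_T0 1 - Ind_B 1, which is q^2 - 1 at 1, -1 on unipotent elements and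
0 elsewhere. Up to sign, Ind_X theta - Gamma is irreducible for theta nontrivial
on M, and similarly for X'. Let Rest be the sum of these irreducibles; then
  Psi = Ind_(U O_2'(T0)) 1 + (|X : M|/2 - 1) Gamma + Rest.
The first two terms come from R[G / U O_2'(T0)] and from the kernel of
R[G / T0] -> R[G / B]. On that kernel the operator C given by the quadratic
character of U = (k, +) has C^2 = s0 q with s0 = (-1)^((q - 1)/2). A splitting
field contains c = sqrt(s0 q), since otherwise C would have trace 0 on all
modules, and (1 + c)/2 is integral, so (1 + C/c)/2 is a projection over R. Its
image is cut to Rest by the central idempotent of the characters in Rest, whose
coefficients have odd denominators. *)

Require Import Defs.
From HB Require Import structures.
From Stdlib Require Import Classical.
From mathcomp Require Import all_boot all_order all_algebra.
From mathcomp Require Import all_fingroup all_solvable all_field all_character.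
From mathcomp Require Import ring lra zify.
Set Implicit Arguments.
Unset Strict Implicit.
Unset Printing Implicit Defensive.
Import Order.TTheory GroupScope GRing.Theory Num.Theory.
Local Open Scope ring_scope.

(** * Projective summands *)

(** When $p = 2$ and $q$ is odd, an involution has a dihedral centralizer of order [2 |X|], in
    general not abelian, so Sylow 2-subgroups need not be TI and the argument by their normalizers
    breaks down. [Gamma] takes over: it is the sum of the two Gelfand-Graev characters, induced from
    the two orbits of [T0] on the nontrivial characters of [U]. Every irreducible constituent of
    Rest lies once in each of them, hence twice in [Gamma], and a central idempotent alone can only
    produce 2 Rest. The operator C separates the two halves, its eigenvalues c and -c being the two
    Gauss sums; this is why a square root is needed. Both halves have the same character on Rest
    because the products of C with group elements have trace zero there. Integrality of (1 + c)/2
    rests on s0 q = 1 mod 4. The characters in Rest fill a union of 2-blocks, which explains the odd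
    denominators; the proof checks these on explicit formulas in numbers of fixed cosets. Characters
    are therefore carried as integer-valued functions, doubled where 1/2 would occur, and cast into
    [R], [K] or [algC]. *)

Section Higman.

Variables (R : comUnitRingType) (gT : finGroupType) (G : {group gT}).

(** The relative trace from the trivial subgroup to [G] on [R]-linear endomorphisms; Higman's
    criterion asks for the identity among its values. *)
Definition mx_trace1 n (rG : mx_representation R G n) (t : 'M[R]_n) : 'M[R]_n :=
  \sum_(x in G) rG x^-1%g *m t *m rG x.

Lemma mx_trace1_cent n (rG : mx_representation R G n) t x :
  x \in G -> mx_trace1 rG t *m rG x = rG x *m mx_trace1 rG t.
Proof.
move=> Gx; rewrite /mx_trace1 mulmx_suml mulmx_sumr.
rewrite (reindex_inj (mulIg x^-1%g)) /=; apply: eq_big => [y|y Gy].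
  by rewrite groupMr // groupV.
have {}Gy : y \in G by rewrite groupMr ?groupV in Gy.
rewrite -!mulmxA -repr_mxM ?groupM ?groupV // mulgKV invMg invgK.
by rewrite repr_mxM ?groupV // !mulmxA.
Qed.

Lemma mx_trace1_mulr n (rG : mx_representation R G n) t A :
  {in G, forall x, A *m rG x = rG x *m A} ->
  mx_trace1 rG (t *m A) = mx_trace1 rG t *m A.
Proof.
move=> cA; rewrite /mx_trace1 mulmx_suml; apply: eq_bigr => x Gx.
by rewrite -!mulmxA cA.
Qed.

(** Row vectors form a free [R]-module, so [g] lifts to an [R]-linear [h0]. Averaging [h0] composed
    with [t] over [G] makes the lift equivariant, and the trace of [t] being the identity keeps it a
    lift of [g]. *)
Lemma higman_projective n (rG : mx_representation R G n) t :
  mx_trace1 rG t = 1%:M -> projective_repr rG.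
Proof.
move=> tr1; split.
  split=> [v|x y Gx Gy v] /=; first by rewrite /= repr_mx1 mulmx1.
  by rewrite /= repr_mxM // mulmxA.
move=> A B actA actB [A1 AM] [B1 BM] f g homf surjf homg.
have [a fa] : exists a : 'I_n -> A, forall i, f (a i) = g (delta_mx 0 i).
  by apply: (fin_all_exists (P := fun i x => f x = g (delta_mx 0 i))) => i.
pose h0 (v : 'rV[R]_n) := \sum_i v 0 i *: a i.
have h0D c u v : h0 (c *: u + v) = c *: h0 u + h0 v.
  rewrite /h0 scaler_sumr -big_split; apply: eq_bigr => i _ /=.
  by rewrite !mxE scalerDl scalerA.
have fh0 v : f (h0 v) = g v.
  rewrite [in RHS](row_sum_delta v) /h0 !linear_sum; apply: eq_bigr => i _.
  by rewrite !linearZ /= fa.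
pose h (v : 'rV[R]_n) := \sum_(x in G) actA x (h0 (v *m rG x^-1%g *m t)).
have h_lin : linear h.
  move=> c u v; rewrite /h scaler_sumr -big_split; apply: eq_bigr => x _ /=.
  by rewrite !mulmxDl -!scalemxAl h0D linearP.
pose hL : {linear 'rV[R]_n -> A} :=
  HB.pack h (GRing.isLinear.Build R 'rV[R]_n A *:%R h h_lin).
exists hL => [x Gx u|v] /=.
  rewrite /h linear_sum (reindex_inj (mulIg x)) /=; apply: eq_big => [y|y Gy].
    by rewrite groupMr.
  have {}Gy : y \in G by rewrite groupMr in Gy.
  rewrite AM //; congr (actA x (actA y (h0 (_ *m _)))).
  by rewrite invMg repr_mxM ?groupV // !mulmxA -(mulmxA u) -repr_mxM ?groupV //
             mulgV repr_mx1 mulmx1.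
rewrite /h linear_sum -[in RHS](mulmx1 v) -tr1 /mx_trace1 mulmx_sumr linear_sum.
apply: eq_bigr => x Gx; rewrite homf // fh0 -(homg _ Gx) /= !mulmxA //.
Qed.

End Higman.

Section Summands.

Variables (R : comUnitRingType) (F : fieldType) (rho : {rmorphism R -> F}).
Hypothesis rho_surj : forall z : F, exists a, z = rho a.
Hypothesis rho_ker : forall a, (rho a == 0) = (a \isn't a GRing.unit).

Lemma unit_residue a : (a \is a GRing.unit) = (rho a != 0).
Proof. by rewrite rho_ker negbK. Qed.

Lemma unitmx_residue n (A : 'M[R]_n) :
  (A \in unitmx) = (map_mx rho A \in unitmx).
Proof. by rewrite !unitmxE unit_residue unitfE det_map_mx. Qed.

Lemma lift_residue_mx m n (A : 'M[F]_(m, n)) :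
  exists A' : 'M[R]_(m, n), map_mx rho A' = A.
Proof.
have [a rho_a] : exists a : 'I_m * 'I_n -> R, forall ij, rho (a ij) = A ij.1 ij.2.
  apply: (fin_all_exists (P := fun ij x => rho x = A ij.1 ij.2)) => ij.
  by have [x ->] := rho_surj (A ij.1 ij.2); exists x.
exists (\matrix_(i, j) a (i, j)).
by apply/matrixP=> i j; rewrite !mxE rho_a.
Qed.

(** [N] is killed by [1 - N], whose residue is the identity and which is therefore invertible over
    the local ring. *)
Lemma idempotent_residue0 n (N : 'M[R]_n) :
  N *m N = N -> map_mx rho N = 0 -> N = 0.
Proof.
move=> idN N0; have uN : 1%:M - N \in unitmx.
  by rewrite unitmx_residue map_mxB N0 map_mx1 subr0 unitmx1.
apply: (can_inj (mulKmx uN)).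
by rewrite mulmx0 mulmxBl mul1mx idN subrr.
Qed.

(* [R] is local, so the image of [E] is free; [r] is its rank. *)
Lemma idempotent_mx_split n (E : 'M[R]_n) : E *m E = E ->
  exists r, exists A : 'M[R]_(n, r), exists2 B : 'M[R]_(r, n),
    A *m B = E & B *m A = 1%:M.
Proof.
move=> idE; set e := map_mx rho E.
have ide : e *m e = e by rewrite -map_mxM idE.
have [r [a [b [ab fa fb]]]] : exists r (a : 'M_(n, r)) (b : 'M_(r, n)),
    [/\ a *m b = e, row_full a & row_free b].
  exists (\rank e), (col_base e), (row_base e).
  by rewrite mulmx_base col_base_full row_base_free.
have ba : b *m a = 1%:M.
  apply: (row_full_inj fa); apply: (row_free_inj fb).
  by rewrite /= mulmx1 ab !mulmxA ab -mulmxA ab.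
have [a' ra] := lift_residue_mx a; have [b' rb] := lift_residue_mx b.
pose A := E *m a'; pose B := b' *m E.
have rA : map_mx rho A = a by rewrite map_mxM ra -/e -ab -mulmxA ba mulmx1.
have rB : map_mx rho B = b by rewrite map_mxM rb -/e -ab mulmxA ba mul1mx.
have uC : B *m A \in unitmx by rewrite unitmx_residue map_mxM rA rB ba unitmx1.
(* The lifts satisfy [B *m A = 1] only in the residue field; dividing by this unit makes the
   relation exact over [R]. *)
pose B' := invmx (B *m A) *m B.
have BA : B' *m A = 1%:M by rewrite -mulmxA mulVmx.
exists r, A, B' => //.
have EA : E *m A = A by rewrite mulmxA idE.
have BE0 : B *m E = B by rewrite -mulmxA idE.
have BE : B' *m E = B' by rewrite -mulmxA BE0.
have rB' : map_mx rho B' = b.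
  by rewrite -BE map_mxM -/e -ab mulmxA -rA -map_mxM BA map_mx1 mul1mx.
(* [E] fixes [A] on the left and [B'] on the right, so [E - A *m B'] is again idempotent, and its
   residue is zero. *)
apply/esym/eqP; rewrite -subr_eq0; apply/eqP/idempotent_residue0; last first.
  by rewrite map_mxB map_mxM rA rB' ab subrr.
rewrite mulmxBl !mulmxBr idE [E *m (A *m _)]mulmxA EA -[A *m B' *m E]mulmxA BE.
rewrite [A *m B' *m (A *m B')]mulmxA -[A *m B' *m A]mulmxA BA mulmx1.
by rewrite subrr subr0.
Qed.

Variables (gT : finGroupType) (G : {group gT}).

(** Higman's criterion is asked only on the image of [E]; conjugating [t] by the splitting of [E]
    turns the value [E] of the trace into the identity of the summand. *)
Lemma proj_summand n (rG : mx_representation R G n) (E t : 'M[R]_n) :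
    E *m E = E -> {in G, forall x, E *m rG x = rG x *m E} ->
    E *m mx_trace1 rG t = E ->
  exists m, exists2 rM : mx_representation R G m,
    exists s, mx_trace1 rM s = 1%:M
    & {in G, forall x, \tr (rM x) = \tr (E *m rG x)}.
Proof.
move=> idE cE tE; have [m [A [B AB BA]]] := idempotent_mx_split idE.
have BE : B *m E = B by rewrite -AB mulmxA BA mul1mx.
have EA : E *m A = A by rewrite -AB -mulmxA BA mulmx1.
pose f x := B *m rG x *m A.
have f_repr : mx_repr G f.
  split=> [|x y Gx Gy]; first by rewrite /f repr_mx1 mulmx1.
  rewrite /f repr_mxM // -{1}BE -![in RHS]mulmxA.
  rewrite [A *m (B *m _)]mulmxA AB [E *m (_ *m A)]mulmxA cE //.
  rewrite -!mulmxA EA !mulmxA BE //.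
exists m, (MxRepresentation f_repr); last first.
  by move=> x Gx; rewrite /= /f -mulmxA mxtrace_mulC -mulmxA AB cE.
exists (B *m t *m A).
transitivity (B *m (E *m mx_trace1 rG t) *m A); last by rewrite tE BE.
rewrite mulmxA BE /mx_trace1 mulmx_sumr mulmx_suml; apply: eq_bigr => x Gx /=.
rewrite /f -![in LHS]mulmxA [A *m (B *m (t *m _))]mulmxA AB.
rewrite [A *m (B *m _)]mulmxA AB [E *m (rG x *m A)]mulmxA cE // -[rG x *m E *m A]mulmxA EA.
rewrite [rG _ *m (E *m _)]mulmxA -cE ?groupV // -[E *m rG _ *m _]mulmxA [B *m (E *m _)]mulmxA BE.
by rewrite !mulmxA.
Qed.

End Summands.

Section Afforded.

Variables (gT : finGroupType) (G : {group gT}) (R : idomainType) (K : fieldType).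
Variable (iota : {rmorphism R -> K}).

(** The values lie in [K] because pieces such as [Gamma] are negative somewhere. The witness [t] is
    part of the data, so that a direct sum has the block sum of the witnesses. *)
Definition higman_afforded (psi : gT -> K) : Prop :=
  exists n, exists2 rG : mx_representation R G n,
    exists t, mx_trace1 rG t = 1%:M
    & {in G, forall x, iota (\tr (rG x)) = psi x}.

Lemma higman_afforded_projective (psi : gT -> nat) :
  higman_afforded (fun x => (psi x)%:R) -> afforded_by_projective G iota psi.
Proof.
move=> [n [rG [t tr1] trG]]; exists n, rG; first exact: higman_projective tr1.
by move=> x Gx; rewrite trace_map_mx trG.
Qed.

Lemma eq_higman_afforded psi phi : {in G, psi =1 phi} ->
  higman_afforded psi -> higman_afforded phi.
Proof.
move=> eq_psi [n [rG [t tr1] trG]]; exists n, rG; first by exists t.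
by move=> x Gx; rewrite trG ?eq_psi.
Qed.

Lemma higman_afforded0 : higman_afforded (fun=> 0).
Proof.
pose f (_ : gT) : 'M[R]_0 := 0.
have f_repr : mx_repr G f by split=> [|x y _ _]; rewrite [LHS]flatmx0 [RHS]flatmx0.
exists 0, (MxRepresentation f_repr) => [|x Gx].
  by exists 0; rewrite [LHS]flatmx0 [RHS]flatmx0.
by rewrite /= mxtrace0 rmorph0.
Qed.

Lemma higman_affordedD psi phi : higman_afforded psi -> higman_afforded phi ->
  higman_afforded (fun x => psi x + phi x).
Proof.
move=> [m [rM [s trs] trM]] [n [rN [t trt] trN]].
pose f x := block_mx (rM x) 0 0 (rN x).
have f_repr : mx_repr G f.
  split=> [|x y Gx Gy]; first by rewrite /f !repr_mx1 -scalar_mx_block.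
  by rewrite /f mulmx_block !mulmx0 !mul0mx !addr0 !add0r !repr_mxM.
exists (m + n), (MxRepresentation f_repr) => [|x Gx]; last first.
  by rewrite /= mxtrace_block rmorphD /= trM ?trN.
exists (block_mx s 0 0 t).
rewrite scalar_mx_block -trs -trt /mx_trace1.
have -> : block_mx (\sum_(x in G) rM x^-1%g *m s *m rM x) 0 0
           (\sum_(x in G) rN x^-1%g *m t *m rN x)
   = \sum_(x in G) block_mx (rM x^-1%g *m s *m rM x) 0 0 (rN x^-1%g *m t *m rN x).
  elim/big_rec3: _ => [|x a b c _ <-]; first by rewrite block_mx0.
  by rewrite add_block_mx !addr0.
apply: eq_bigr => x Gx /=.
by rewrite /f !mulmx_block !(mulmx0, mul0mx, addr0, add0r).
Qed.

Lemma higman_affordedMn psi k : higman_afforded psi ->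
  higman_afforded (fun x => psi x *+ k).
Proof.
move=> hpsi; elim: k => [|k IHk].
  by apply: eq_higman_afforded higman_afforded0 => x _; rewrite mulr0n.
apply: eq_higman_afforded (higman_affordedD hpsi IHk) => x _.
by rewrite mulrS.
Qed.

End Afforded.

(** * Permutation modules on cosets *)

Section KernelMatrices.

Variables (R : comUnitRingType) (X : finType).
Implicit Types (k : X -> X -> R).

Definition kmx k : 'M[R]_#|X| := \matrix_(i, j) k (enum_val i) (enum_val j).

Lemma kmx_mul k1 k2 :
  kmx k1 *m kmx k2 = kmx (fun x y => \sum_z k1 x z * k2 z y).
Proof.
apply/matrixP=> i j; rewrite !mxE [RHS](reindex (@enum_val X X)) /=; last first.
  by exists enum_rank => z _; rewrite ?enum_rankK ?enum_valK.
by apply: eq_bigr => z _; rewrite !mxE.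
Qed.

Lemma eq_kmx k1 k2 : k1 =2 k2 -> kmx k1 = kmx k2.
Proof. by move=> eq_k; apply/matrixP=> i j; rewrite !mxE eq_k. Qed.

Lemma mxtrace_kmx k : \tr (kmx k) = \sum_x k x x.
Proof.
rewrite /mxtrace [RHS](reindex (@enum_val X X)) /=; last first.
  by exists enum_rank => z _; rewrite ?enum_rankK ?enum_valK.
by apply: eq_bigr => i _; rewrite mxE.
Qed.

Lemma kmx1 : kmx (fun x y => (x == y)%:R) = 1%:M.
Proof. by apply/matrixP=> i j; rewrite !mxE (inj_eq enum_val_inj). Qed.

Lemma kmx_sum (I : finType) (P : pred I) (k : I -> X -> X -> R) :
  \sum_(i | P i) kmx (k i) = kmx (fun x y => \sum_(i | P i) k i x y).
Proof.
by apply/matrixP=> i j; rewrite summxE mxE; apply: eq_bigr => z _; rewrite mxE.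
Qed.

End KernelMatrices.

Section CosetKernels.

Variables (R : comUnitRingType) (gT : finGroupType) (G : {group gT}).
Implicit Types (A : {set gT}) (k : {set gT} -> {set gT} -> R).

(** Translation acts on all subsets of [gT], so that every R[G / H] sits in one and the same
    representation; coset spaces and their summands are then picked out by idempotent kernels. *)
Definition rset_mx (x : gT) : 'M[R]_#|{set gT}| :=
  kmx (fun A A' => (A :* x == A')%:R).

Lemma rset_mx_mull k x :
  rset_mx x *m kmx k = kmx (fun A A' => k (A :* x) A').
Proof.
rewrite kmx_mul; apply: eq_kmx => A A'.
rewrite (bigD1 (A :* x)) //= eqxx mul1r big1 ?addr0 // => B.
by rewrite eq_sym => /negPf->; rewrite mul0r.
Qed.

Lemma rset_mx_mulr k x :
  kmx k *m rset_mx x = kmx (fun A A' => k A (A' :* x^-1%g)).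
Proof.
rewrite kmx_mul; apply: eq_kmx => A A'.
rewrite (bigD1 (A' :* x^-1%g)) //= rcosetKV eqxx mulr1 big1 ?addr0 // => B neqB.
case: (B :* x =P A') neqB => [<-|_ _]; last by rewrite mulr0.
by rewrite rcosetK eqxx.
Qed.

Lemma rset_mx_repr : mx_repr G rset_mx.
Proof.
split=> [|x y _ _].
  by rewrite /rset_mx -kmx1; apply: eq_kmx => A A'; rewrite rcoset1.
by rewrite rset_mx_mull; apply: eq_kmx => A A'; rewrite rcosetM.
Qed.

Definition rset_repr := MxRepresentation rset_mx_repr.

Lemma rset_cent k x : (forall A A', k (A :* x) (A' :* x) = k A A') ->
  kmx k *m rset_mx x = rset_mx x *m kmx k.
Proof.
move=> kx; rewrite rset_mx_mull rset_mx_mulr; apply: eq_kmx => A A'.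
by rewrite -kx rcosetKV.
Qed.

Lemma rset_trace1 k : mx_trace1 rset_repr (kmx k) =
  kmx (fun A A' => \sum_(x in G) k (A :* x^-1%g) (A' :* x^-1%g)).
Proof.
rewrite /mx_trace1 -kmx_sum; apply: eq_bigr => x _ /=.
by rewrite rset_mx_mull rset_mx_mulr.
Qed.

Lemma rset_mxtrace k x : \tr (kmx k *m rset_mx x) = \sum_A k A (A :* x^-1%g).
Proof. by rewrite rset_mx_mulr mxtrace_kmx. Qed.

Lemma sum_rcosets (V : nmodType) (N : {group gT}) (F : {set gT} -> V) :
  N \subset G ->
  \sum_(x in G) F (N :* x) = (\sum_(A in rcosets N G) F A) *+ #|N|.
Proof.
move=> sNG; rewrite (partition_big (fun x => N :* x) [in rcosets N G]) /=.
  rewrite -sumrMnl; apply: eq_bigr => _ /rcosetsP[a Ga ->].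
  rewrite (eq_bigr (fun=> F (N :* a))) => [|x /andP[_ /eqP->] //].
  rewrite sumr_const -(card_rcoset N a); congr (_ *+ _); apply: eq_card => x.
  rewrite -topredE /=; apply/andP/idP => [[_ /eqP<-]|Nax]; first exact: rcoset_refl.
  split; last by rewrite (rcoset_eqP Nax).
  by case/rcosetP: Nax => y Ny ->; rewrite groupM // (subsetP sNG).
by move=> x Gx; rewrite mem_rcosets mulSGid // mem_mulg.
Qed.

Lemma eq_rcoset (N : {group gT}) (a b : gT) :
  (N :* a == N :* b) = ((a * b^-1)%g \in N).
Proof.
by rewrite -mem_rcoset; apply/eqP/idP => [<-|/rcoset_eqP//]; apply: rcoset_refl.
Qed.

Lemma mulg_rcoset (N B : {group gT}) (a : gT) :
  N \subset B -> (B * (N :* a) = B :* a)%g.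
Proof. by move=> sNB; rewrite mulgA mulGSid. Qed.

End CosetKernels.

(** * The kernel of R[G / N] -> R[G / B] and its Higman witness *)

Section RelativeAugmentation.

Variables (R : comUnitRingType) (gT : finGroupType) (G B N P : {group gT}).
Hypotheses (sPN : P \subset N) (sNB : N \subset B) (sBG : B \subset G).
Hypothesis semiregP : forall x b : gT, x \in P -> x != 1%g -> b \in B ->
  (x ^ b^-1)%g \in N -> b \in N.

Let X0 := rcosets N B :\ (N : {set gT}).

Let rcosetN (n : gT) : n \in N -> (N : {set gT}) :* n = N.
Proof. exact: rcoset_id. Qed.

Let X0_mulr (A : {set gT}) n : n \in N -> (A :* n \in X0) = (A \in X0).
Proof.
have sX n' A' : n' \in N -> A' \in X0 -> A' :* n' \in X0.
  move=> Nn; rewrite !inE => /andP[nA /rcosetsP[b Bb defA]]; apply/andP; split.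
    by apply: contra nA => /eqP An; rewrite -(rcosetK n' A') An rcosetN ?groupV.
  apply/rcosetsP; exists (b * n')%g; last by rewrite defA rcosetM.
  exact: groupM Bb (subsetP sNB _ Nn).
move=> Nn; apply/idP/idP => [/(sX n^-1%g)|]; last exact: sX.
by rewrite rcosetK groupV; apply.
Qed.

Let X0_rcoset b : b \in B -> (N :* b \in X0) = (b \notin N).
Proof.
move=> Bb; rewrite !inE mem_rcosets mulSGid // Bb andbT.
by congr (~~ _); rewrite -{2}[gval N]mulg1 eq_rcoset invg1 mulg1.
Qed.

(** [Z] is a transversal of the orbits of [P] on the nontrivial cosets. These orbits are regular by
    [semiregP], so exactly one [x] in [P] moves a given coset into [Z]: the indicator of [Z]
    replaces the constant weight [1 / #|P|] over a ring where [#|P|] may fail to be invertible. *)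
Lemma orbit_weight : exists2 Z : {set {set gT}}, Z \subset X0 &
  forall A, (\sum_(x in P) (A :* x \in Z))%N = (A \in X0).
Proof.
have actP : [acts P, on X0 | 'Rs].
  apply/actsP=> x Px A; rewrite /= rcosetE X0_mulr ?(subsetP sPN) //.
have /= := orbit_transversalP actP; set Z := orbit_transversal _ _ _.
case=> _ sZ Zinj Zex; exists Z => // A.
have [X0A|X0'A] := boolP (A \in X0); last first.
  apply: big1 => x Px; apply/eqP; rewrite eqb0; apply: contra X0'A.
  by move/(subsetP sZ); rewrite X0_mulr ?(subsetP sPN).
have [x0 Px0 /=] := Zex A X0A; rewrite rcosetE => Zx0.
rewrite (bigD1 x0) //= Zx0 big1 // => x /andP[Px neqx].
apply/eqP; rewrite eqb0; apply: contra neqx => Zx.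
have := Zinj _ _ Zx0 Zx.
have -> : (A :* x \in orbit 'Rs P (A :* x0)) = true.
  apply/orbitP; exists (x0^-1 * x)%g; first by rewrite groupM ?groupV.
  by rewrite /= rcosetE -rcosetM mulKVg.
(* Two translates of [A] in one orbit and in [Z] coincide, so [x0 * x^-1] fixes [A] and has a
   conjugate in [N]. *)
move=> /esym/eqP eqA; move: X0A; rewrite !inE => /andP[nA /rcosetsP[b Bb defA]].
move: eqA; rewrite defA -!rcosetM => /eqP; rewrite eq_rcoset invMg.
have -> : (b * x0 * (x^-1 * b^-1))%g = ((x0 * x^-1) ^ b^-1)%g.
  by rewrite conjgE invgK !mulgA.
rewrite eq_sym eq_mulgV1 => Nx; apply/idPn=> nx; case/negP: nA.
have/semiregP : (x0 * x^-1)%g \in P by rewrite groupM ?groupV.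
by move=> /(_ _ nx Bb Nx) Nb; rewrite defA rcosetN.
Qed.

Hypothesis uBP : (#|B : P|%:R : R) \is a GRing.unit.

(** The projection of R[G / N] onto the kernel of the map to R[G / B]: the identity minus averaging
    over the cosets of [N] inside a coset of [B]. *)
Definition aug_ker (A A' : {set gT}) : R :=
  if (A \in rcosets N G) && (A' \in rcosets N G)
  then (A == A')%:R - (B * A == B * A')%g%:R / #|B : N|%:R else 0.

Lemma unit_index_BN : (#|B : N|%:R : R) \is a GRing.unit.
Proof.
have := uBP; rewrite -(Lagrange_index sNB sPN) natrM unitrM.
by case/andP.
Qed.

Lemma orbit_weight_sums (Z : {set {set gT}}) : Z \subset X0 ->
    (forall A, (\sum_(x in P) (A :* x \in Z))%N = (A \in X0)) ->
  (forall b, b \in B ->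
     \sum_(n in N) (N :* b :* n \in Z)%:R = (b \notin N)%:R *+ #|N : P| :> R) /\
  \sum_(b in G) (N :* b \in Z)%:R = #|B : P|%:R - #|N : P|%:R :> R.
Proof.
move=> sZ wtZ.
(* Translating by all of [P] turns [Z] into the set of nontrivial cosets. The factor [#|P|] is
   cancelled among natural numbers, before the cast to [R]. *)
have swap (S : {group gT}) a : P \subset S ->
    (#|P| * \sum_(n in S) (N :* a :* n \in Z) = \sum_(n in S) (N :* a :* n \in X0))%N.
  move=> sPS; rewrite -sum_nat_const.
  have shift x : x \in P -> (\sum_(n in S) (N :* a :* n \in Z) =
      \sum_(n in S) (N :* a :* n :* x \in Z))%N.
    move=> Px; rewrite (reindex_inj (mulIg x)) /=; apply: eq_big => [n|n _].
      exact: groupMr (subsetP sPS _ Px).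
    by rewrite [in LHS]rcosetM.
  rewrite (eq_bigr _ shift) exchange_big.
  by apply: eq_bigr => n _; rewrite wtZ.
have cardP : (0 < #|P|)%N by apply: cardG_gt0.
split=> [b Bb|].
  rewrite -natr_sum -mulrnA; congr _%:R; apply/eqP.
  rewrite -(eqn_pmul2l cardP) swap // (eq_bigr (fun=> (b \notin N) : nat)).
    by rewrite sum_nat_const mulnCA Lagrange // mulnC.
  by move=> n Nn; rewrite X0_mulr // X0_rcoset.
apply/eqP; rewrite eq_sym subr_eq -natr_sum -natrD; apply/eqP; congr _%:R; apply/eqP.
rewrite -(eqn_pmul2l cardP) mulnDr !Lagrange // ?(subset_trans sPN) //.
have := swap G 1%g (subset_trans sPN (subset_trans sNB sBG)).
rewrite rcoset1 => ->; apply/eqP.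
rewrite -(cardsID N B) (setIidPr sNB) addnC; congr addn.
rewrite -sum1_card big_mkcond [RHS]big_mkcond /=; apply: eq_bigr => b _.
rewrite in_setD; case: (boolP (b \in B)) => [Bb|nBb].
  by rewrite (subsetP sBG) // X0_rcoset // andbT; case: (b \in N).
rewrite andbF; case: ifP => // _; apply/eqP; rewrite eq_sym eqb0.
apply: contra nBb => /setD1P[_ /rcosetsP[b' Bb' /eqP]].
by rewrite eq_rcoset => /(subsetP sNB); rewrite groupMr ?groupV.
Qed.

Lemma aug_kerE a a' : a \in G -> a' \in G -> aug_ker (N :* a) (N :* a') =
  ((a * a'^-1)%g \in N)%:R - ((a * a'^-1)%g \in B)%:R / #|B : N|%:R.
Proof.
move=> Ga Ga'; have sNG := subset_trans sNB sBG.
by rewrite /aug_ker !mem_rcosets mulSGid // Ga Ga' !mulg_rcoset // !eq_rcoset.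
Qed.

Lemma aug_ker_mulr x A A' : x \in G -> aug_ker (A :* x) (A' :* x) = aug_ker A A'.
Proof.
move=> Gx; have Rx A1 : (A1 :* x \in rcosets N G) = (A1 \in rcosets N G).
  have sx A2 y : y \in G -> A2 \in rcosets N G -> A2 :* y \in rcosets N G.
    move=> Gy /rcosetsP[a Ga ->]; rewrite -rcosetM; apply/rcosetsP.
    by exists (a * y)%g; rewrite ?groupM.
  by apply/idP/idP => [/(sx _ x^-1%g)|/sx->//]; rewrite rcosetK groupV; apply.
rewrite /aug_ker !Rx !mulgA !(can_eq (rcosetK x)) //.
Qed.

(* [u * wt A * ([A = A'] - [A' = N])] with [wt] the indicator function of a
   transversal of the regular [P]-orbits on the nontrivial cosets. *)
Lemma aug_ker_trace1 : exists k,
  mx_trace1 (rset_repr R G) (kmx k) = kmx aug_ker.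
Proof.
have [Z sZ wtZ] := orbit_weight; have [wtN wtG] := orbit_weight_sums sZ wtZ.
pose u := (#|B : P|%:R : R)^-1; have sNG := subset_trans sNB sBG.
have u_ind : u * #|N : P|%:R = (#|B : N|%:R)^-1.
  apply: (mulIr unit_index_BN); rewrite mulVr ?unit_index_BN // -mulrA -natrM.
  by rewrite mulnC Lagrange_index // mulVr.
exists (fun A A' => u * (A \in Z)%:R * ((A == A')%:R - (A' == N :> {set gT})%:R)).
rewrite rset_trace1; apply: eq_kmx => A A'.
have ZG x : x \in G -> A :* x^-1%g \in Z -> A \in rcosets N G.
  move=> Gx /(subsetP sZ)/setD1P[_ /rcosetsP[b Bb /(canRL (rcosetKV x)) ->]].
  apply/rcosetsP; exists (b * x)%g; first exact: groupM (subsetP sBG _ Bb) Gx.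
  by rewrite rcosetM.
have [GA|nGA] := boolP (A \in rcosets N G); last first.
  rewrite /aug_ker (negPf nGA) big1 // => x Gx.
  case: (boolP (_ \in Z)) => [/(ZG x Gx)|]; first by rewrite (negPf nGA).
  by rewrite mulr0 mul0r.
have [GA'|nGA'] := boolP (A' \in rcosets N G); last first.
  rewrite /aug_ker (negPf nGA') andbF big1 // => x Gx.
  rewrite (can_eq (rcosetK _)); case: eqP => [eqA|_]; first by rewrite -eqA GA in nGA'.
  case: eqP => [/(canRL (rcosetKV x)) eqN|]; last by rewrite subrr mulr0.
  by case/negP: nGA'; rewrite eqN; apply/rcosetsP; exists x.
case/rcosetsP: GA => a Ga defA; case/rcosetsP: GA' => a' Ga' defA'.
rewrite defA defA' aug_kerE //; clear A A' ZG defA defA'.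
under eq_bigr => x Gx.
  rewrite (can_eq (rcosetK _)) eq_rcoset mulrBr -!mulrA -!rcosetM.
  over.
(* With [b] the quotient of the two representatives, the term in [[A = A']] survives only for [b] in
   [N] and runs over all of [G]. The term in [[A' = N]] restricts the sum to a coset of [N] and is
   nonzero only for [b] in [B] outside [N]. *)
rewrite sumrB -!mulr_sumr; set b := (a * a'^-1)%g.
have Gb : b \in G by rewrite groupM ?groupV.
have -> : \sum_(x in G) ((N :* (a * x^-1) \in Z)%:R * (b \in N)%:R : R)
            = (#|B : P|%:R - #|N : P|%:R) * (b \in N)%:R.
  rewrite -wtG -mulr_suml; congr (_ * _).
  rewrite (reindex_inj (inj_comp (mulIg a) invg_inj)) /=.
  apply: eq_big => [x|x _]; first by rewrite groupMr // groupV.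
  by rewrite invMg invgK mulKVg.
have -> : \sum_(x in G) ((N :* (a * x^-1) \in Z)%:R *
              (N :* (a' * x^-1) == N :> {set gT})%:R : R)
            = ((b \in B) && (b \notin N))%:R *+ #|N : P|.
  rewrite (reindex_inj (inj_comp (mulIg a') invg_inj)) /=.
  transitivity (\sum_(x in N) ((N :* b :* x \in Z)%:R : R)).
    rewrite [LHS]big_mkcond [RHS]big_mkcond; apply: eq_bigr => x _ /=.
    rewrite invMg invgK mulKVg mulgA groupMr ?groupV // -rcosetM.
    rewrite -[X in _ == X]rcoset1 eq_rcoset invg1 mulg1.
    case: (boolP (x \in N)) => Nx; last by rewrite mulr0 if_same.
    by rewrite (subsetP sNG) // mulr1.
  case: (boolP (b \in B)) => [Bb|nBb]; first exact: wtN.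
  rewrite mul0rn big1 // => x Nx; case: (boolP (_ \in Z)) => // /(subsetP sZ).
  rewrite X0_mulr // => /setD1P[_ /rcosetsP[b' Bb' /eqP]].
  by rewrite eq_rcoset => /(subsetP sNB); rewrite groupMr ?groupV // (negPf nBb).
rewrite [u * (_ *+ #|N : P|)]mulrnAr -mulrnAl -[u *+ _]mulr_natr u_ind.
rewrite [u * (_ * _)]mulrA [u * (_ - _)]mulrBr mulVr // u_ind.
rewrite mulrBl mul1r [(b \in B)%:R / _]mulrC.
case: (boolP (b \in N)) => [Nb|_]; last first.
  by rewrite andbT /= !(mulr0n, mulr0, oppr0, sub0r).
by rewrite andbF /= !(mulr0n, mulr0, subr0) (subsetP sNB).
Qed.

Lemma count_rcosets_sub a : a \in G ->
  (\sum_(C in rcosets N G) (B :* a == (B * C)%g)%N = #|B : N|)%N.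
Proof.
move=> Ga; have sNG := subset_trans sNB sBG.
apply/eqP; rewrite -(eqn_pmul2r (cardG_gt0 N)) [(#|B : N| * _)%N]mulnC Lagrange //.
have /= := @sum_rcosets _ G nat N (fun C => (B :* a == (B * C)%g) : nat) sNG.
rewrite -mulr_natr natn => sumE; apply/eqP; apply: etrans (esym sumE) _.
rewrite -(card_rcoset B a) -sum1_card [RHS]big_mkcond [LHS]big_mkcond /=.
apply: eq_bigr => x _; rewrite mulg_rcoset // eq_sym eq_rcoset mem_rcoset.
case: (boolP (x \in G)) => [_|nGx]; first by case: (_ \in B).
by case: ifP => // /(subsetP sBG); rewrite groupMr ?groupV // (negPf nGx).
Qed.

(** On cosets the kernel is [1 - J / n], where [n] is the index of [N] in [B] and [J] relates cosets
    lying in the same coset of [B], so that [J] squares to [n J]. *)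
Lemma aug_ker_idem : kmx aug_ker *m kmx aug_ker = kmx aug_ker.
Proof.
rewrite kmx_mul; apply: eq_kmx => A A'.
have sNG := subset_trans sNB sBG.
have [GA|nGA] := boolP (A \in rcosets N G); last first.
  by rewrite /aug_ker (negPf nGA) big1 // => C _; rewrite mul0r.
have [GA'|nGA'] := boolP (A' \in rcosets N G); last first.
  by rewrite /aug_ker (negPf nGA') andbF big1 // => C _; rewrite andbF mulr0.
have [a Ga defA] := rcosetsP GA; have [a' Ga' defA'] := rcosetsP GA'.
pose v := (#|B : N|%:R : R)^-1.
pose I A1 A2 : R := (A1 == A2 :> {set gT})%:R.
pose J A1 A2 : R := (B * A1 == B * A2 :> {set gT})%g%:R.
transitivity (\sum_(C in rcosets N G) (I A C - J A C * v) * (I C A' - J C A' * v)).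
  rewrite [RHS]big_mkcond; apply: eq_bigr => C _.
  by rewrite /aug_ker GA GA' /= andbT; case: ifP => _; rewrite ?mul0r.
have uv : #|B : N|%:R * v = 1 by rewrite mulrV // unit_index_BN.
under eq_bigr do rewrite mulrBl !mulrBr.
rewrite !sumrB.
have sI (f : {set gT} -> R) : \sum_(C in rcosets N G) I A C * f C = f A.
  rewrite (bigD1 A) //= /I eqxx mul1r big1 ?addr0 // => C /andP[_ /negPf nC].
  by rewrite eq_sym nC mul0r.
rewrite !sI.
have -> : \sum_(C in rcosets N G) J A C * v * I C A' = J A A' * v.
  rewrite (bigD1 A') //= /I eqxx mulr1 big1 ?addr0 // => C /andP[_ /negPf nC].
  by rewrite nC mulr0.
have -> : \sum_(C in rcosets N G) J A C * v * (J C A' * v) = J A A' * v.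
  transitivity (\sum_(C in rcosets N G) (B :* a == (B * C)%g)%:R * (J A A' * v * v)).
    apply: eq_bigr => C _; rewrite /J defA mulg_rcoset //.
    have [->|_] := eqVneq (B :* a) _; last by rewrite !mul0r.
    by rewrite !mul1r mulrCA mulrA.
  by rewrite -mulr_suml -natr_sum count_rcosets_sub // mulrCA uv mulr1.
by rewrite subrr subr0 /aug_ker GA GA'.
Qed.

End RelativeAugmentation.

Section FixedCosets.

Variables (gT : finGroupType) (G : {group gT}).

(** The permutation character on the cosets of [H], kept in [nat] so that character identities
    become counting identities. *)
Definition fix_cosets (H : {set gT}) (x : gT) : nat :=
  #|[set A in rcosets H G | A :* x == A]|.

Lemma eq_rcosetV (A : {set gT}) x : (A == A :* x^-1%g) = (A :* x == A).
Proof.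
by apply/eqP/eqP => [{1}->|{2}<-]; [apply: rcosetKV | rewrite rcosetK].
Qed.

Lemma card_fix_cosets (H : {group gT}) x : H \subset G ->
  (fix_cosets H x * #|H| = #|[set y in G | (x ^ y)%g \in H]|)%N.
Proof.
move=> sHG; have /= := @sum_rcosets _ G nat H (fun A => (A :* x == A) : nat) sHG.
rewrite -mulr_natr natn /fix_cosets => /esym.
have -> : \sum_(A in rcosets H G) ((A :* x == A) : nat) = fix_cosets H x.
  rewrite /fix_cosets -sum1_card big_mkcond [RHS]big_mkcond /=.
  by apply: eq_bigr => A _; rewrite inE; case: (A \in _); case: eqP.
move=> fixE; apply: etrans fixE _.
rewrite -sum1_card (reindex_inj invg_inj) big_mkcond [RHS]big_mkcond /=.
apply: eq_bigr => y _; rewrite inE groupV -rcosetM eq_rcoset invgK -mulgA -conjgE.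
by case: (y \in G); case: (_ \in H).
Qed.

End FixedCosets.

Section CosetModules.

Variables (R : comUnitRingType) (gT : finGroupType) (G : {group gT}).

Lemma mxtrace_aug_ker (B N : {group gT}) x :
    N \subset B -> B \subset G -> x \in G ->
    (#|B : N|%:R : R) \is a GRing.unit ->
  \tr (kmx (aug_ker R G B N) *m rset_mx R x) =
    (fix_cosets G N x)%:R - (fix_cosets G B x)%:R.
Proof.
move=> sNB sBG Gx uBN; have sNG := subset_trans sNB sBG.
rewrite rset_mxtrace.
have fixV (H : {group gT}) : H \subset G ->
    (\sum_(A in rcosets H G) (A == A :* x^-1) = fix_cosets G H x)%N.
  move=> sHG; rewrite /fix_cosets -sum1_card big_mkcond [RHS]big_mkcond /=.
  apply: eq_bigr => A _; rewrite inE eq_rcosetV.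
  by case: (A \in _) => //=; case: eqP.
transitivity (\sum_(A in rcosets N G) ((A == A :* x^-1)%:R -
    (B * A == B * A :* x^-1)%g%:R / #|B : N|%:R : R)).
  rewrite [RHS]big_mkcond; apply: eq_bigr => A _; rewrite /aug_ker.
  have [NA|//] := boolP (A \in rcosets N G).
  have -> : A :* x^-1 \in rcosets N G.
    have [a Ga ->] := rcosetsP NA; rewrite -rcosetM; apply/rcosetsP.
    by exists (a * x^-1)%g; rewrite ?groupM ?groupV.
  by rewrite mulgA.
rewrite sumrB -natr_sum fixV // -mulr_suml -natr_sum; congr (_ - _).
have -> : (\sum_(A in rcosets N G) (B * A == B * A :* x^-1)%g
           = fix_cosets G B x * #|B : N|)%N.
  apply/eqP; rewrite -(eqn_pmul2r (cardG_gt0 N)).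
  have /= := @sum_rcosets _ G nat N (fun A => (B * A == B * A :* x^-1)%g : nat) sNG.
  rewrite -mulr_natr natn => /esym sumE; apply/eqP; apply: etrans sumE _.
  rewrite -mulnA [(#|B : N| * _)%N]mulnC Lagrange // -fixV //.
  have /= := @sum_rcosets _ G nat B (fun A => (A == A :* x^-1)%g : nat) sBG.
  rewrite -mulr_natr natn => sumE'; apply: etrans _ sumE'.
  by apply: eq_bigr => y _; rewrite mulg_rcoset.
by rewrite natrM mulrK.
Qed.

Definition coset_ker (H A A' : {set gT}) : R := ((A \in rcosets H G) && (A == A'))%:R.

Section CosetKer.

Variable (H : {group gT}).
Hypothesis (sHG : H \subset G).

Lemma mem_rcosetsM A x : x \in G -> (A :* x \in rcosets H G) = (A \in rcosets H G).
Proof.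
move=> Gx; have sx A2 y : y \in G -> A2 \in rcosets H G -> A2 :* y \in rcosets H G.
  move=> Gy /rcosetsP[a Ga ->]; rewrite -rcosetM; apply/rcosetsP.
  by exists (a * y)%g; rewrite ?groupM.
by apply/idP/idP => [/(sx _ x^-1%g)|/sx->//]; rewrite rcosetK groupV; apply.
Qed.

Lemma coset_ker_idem : kmx (coset_ker H) *m kmx (coset_ker H) = kmx (coset_ker H).
Proof.
rewrite kmx_mul; apply: eq_kmx => A A'; rewrite /coset_ker (bigD1 A) //= eqxx andbT.
rewrite big1 ?addr0 => [|C /negPf nCA]; last by rewrite eq_sym nCA andbF mul0r.
by case: (A \in _); rewrite ?mul1r ?mul0r.
Qed.

Lemma coset_ker_mulr x A A' : x \in G ->
  coset_ker H (A :* x) (A' :* x) = coset_ker H A A'.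
Proof. by move=> Gx; rewrite /coset_ker mem_rcosetsM // (can_eq (rcosetK x)). Qed.

Lemma mxtrace_coset_ker x : x \in G ->
  \tr (kmx (coset_ker H) *m rset_mx R x) = (fix_cosets G H x)%:R.
Proof.
move=> Gx; rewrite rset_mxtrace -natr_sum; congr _%:R.
rewrite /fix_cosets -sum1_card [RHS]big_mkcond /=; apply: eq_bigr => A _.
by rewrite inE eq_rcosetV; case: (_ && _).
Qed.

Hypothesis uH : (#|H|%:R : R) \is a GRing.unit.

Lemma coset_ker_trace1 : exists k,
  mx_trace1 (rset_repr R G) (kmx k) = kmx (coset_ker H).
Proof.
exists (fun A A' : {set gT} => #|H|%:R^-1 * ((A == H :> {set gT}) && (A == A'))%:R).
rewrite rset_trace1; apply: eq_kmx => A A'; rewrite /coset_ker.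
under eq_bigr do rewrite (can_eq (rcosetK _)).
have [_|_] := eqVneq A A'; last first.
  by rewrite andbF big1 // => x _; rewrite andbF mulr0.
under eq_bigr do rewrite andbT.
rewrite andbT -mulr_sumr -natr_sum; have [HA|nHA] := boolP (A \in _).
  have [a Ga defA] := rcosetsP HA.
  rewrite -[X in _ * X%:R](_ : #|H| = _) ?mulVr //.
  rewrite -(card_rcoset H a) -sum1_card [LHS]big_mkcond [RHS]big_mkcond /=.
  apply: eq_bigr => x _; rewrite defA -rcosetM -[X in _ == X]rcoset1 eq_rcoset.
  rewrite invg1 mulg1.
  have -> : (x \in H :* a) = ((a * x^-1)%g \in H).
    by rewrite mem_rcoset -groupV invMg invgK.
  case: (boolP (x \in G)) => [_|nGx]; first by case: (_ \in H).
  by case: ifP => // /(subsetP sHG); rewrite groupMl // groupV (negPf nGx).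
rewrite big1 ?mulr0 // => x Gx; apply/eqP; rewrite eqb0; apply: contra nHA => /eqP.
by move/(canRL (rcosetKV x)) ->; apply/rcosetsP; exists x.
Qed.

End CosetKer.

(** [Q] maps the image of [EM] onto that of [EX], with an [R]-linear section [S]. As [EX] satisfies
    Higman's criterion, averaging makes the section equivariant, so the map splits and [EY] projects
    onto its kernel. *)
Lemma split_off n (rG : mx_representation R G n) (EM EX tM tX Q S : 'M_n) :
    EM *m EM = EM -> {in G, forall x, EM *m rG x = rG x *m EM} ->
    EM *m mx_trace1 rG tM = EM ->
    EX *m EX = EX -> {in G, forall x, EX *m rG x = rG x *m EX} ->
    mx_trace1 rG tX = EX ->
    {in G, forall x, Q *m rG x = rG x *m Q} ->
    EM *m Q = Q -> Q *m EX = Q -> S *m Q = EX ->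
  exists EY, [/\ EY *m EY = EY, {in G, forall x, EY *m rG x = rG x *m EY},
    EY *m mx_trace1 rG tM = EY
    & {in G, forall x, \tr (EY *m rG x) = \tr (EM *m rG x) - \tr (EX *m rG x)}].
Proof.
move=> idM cM trM idX cX trX cQ MQ QX SQ.
pose s := mx_trace1 rG (tX *m S) *m EM.
have sQ : s *m Q = EX.
  by rewrite -mulmxA MQ -mx_trace1_mulr // -mulmxA SQ mx_trace1_mulr // trX.
have cs x : x \in G -> s *m rG x = rG x *m s.
  by move=> Gx; rewrite -mulmxA cM // !mulmxA mx_trace1_cent.
pose E' := Q *m s.
have idE' : E' *m E' = E' by rewrite -mulmxA [s *m (_ *m _)]mulmxA sQ mulmxA QX.
have ME' : EM *m E' = E' by rewrite mulmxA MQ.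
have E'M : E' *m EM = E' by rewrite -!mulmxA idM.
have YM : (EM - E') *m EM = EM - E' by rewrite mulmxBl idM E'M.
exists (EM - E'); split.
- by rewrite mulmxBr YM mulmxBl ME' idE' subrr subr0.
- move=> x Gx; rewrite mulmxBl mulmxBr cM //; congr (_ - _).
  by rewrite -mulmxA cs // !mulmxA cQ.
- by rewrite -[in LHS]YM -mulmxA trM YM.
move=> x Gx; rewrite mulmxBl raddfB /=; congr (_ - _).
by rewrite -mulmxA mxtrace_mulC -mulmxA -cQ // mulmxA sQ.
Qed.

End CosetModules.

(** * Abelian centralizers *)

Section AbelianCentralizers.

Variables (p : nat) (gT : finGroupType) (G : {group gT}).
Hypothesis p_pr : prime p.
Hypothesis abC : forall x : gT, x \in G -> p.-elt x -> x != 1%g -> abelian 'C_G[x].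

Variable P : {group gT}.
Hypothesis sylP : p.-Sylow(G) P.

Let sPG : P \subset G. Proof. exact: pHall_sub sylP. Qed.
Let pP : p.-group P. Proof. exact: pHall_pgroup sylP. Qed.

(** [P] lies in the centralizer of a nontrivial element of its own centre, which is abelian. *)
Lemma syl_abelian : abelian P.
Proof.
have [->|ntP] := eqVneq (P : {set gT}) 1%g; first exact: abelian1.
have /trivgPn[z /centerP[Pz cPz] nt_z] : 'Z(P) != 1%g.
  by rewrite center_nil_eq1 ?(pgroup_nil pP).
apply: abelianS (abC (subsetP sPG z Pz) (mem_p_elt pP Pz) nt_z).
by rewrite subsetI sPG; apply/subsetP=> y Py; apply/cent1P; apply/esym/cPz.
Qed.

(** [P] and its conjugate by [g] are both Sylow subgroups of the abelian centralizer of [x ^ g],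
    hence equal. *)
Lemma syl_TI (x g : gT) : x \in P -> x != 1%g -> g \in G -> (x ^ g)%g \in P ->
  g \in 'N(P)%g.
Proof.
move=> Px nt_x Gg Pxg; set C := 'C_G[x ^ g]%G.
have Gxg := subsetP sPG _ Pxg.
have abelC : abelian C.
  by apply: abC => //; [apply: mem_p_elt pP Pxg | rewrite conjg_eq1].
have sPC : P \subset C.
  by rewrite subsetI sPG sub_cent1 (subsetP syl_abelian).
have sPgC : (P :^ g)%g \subset C.
  by rewrite subsetI conj_subG //= cent1J conjSg sub_cent1 (subsetP syl_abelian).
have sCG : C \subset G by apply: subsetIl.
have sylPC := pHall_subl sPC sCG sylP.
have sylPgC : p.-Sylow(C) (P :^ g)%g.
  by apply: pHall_subl sPgC sCG _; rewrite pHallJ.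
have [c Cc defPg] := Sylow_trans sylPC sylPgC.
rewrite inE /= defPg (normP _) //.
by rewrite (subsetP _ c Cc) // (subset_trans abelC) // cents_norm ?centS.
Qed.

Let N := 'N_G(P)%G.
Let sPN : P \subset N. Proof. by rewrite subsetI sPG normG. Qed.
Let sNG : N \subset G. Proof. exact: subsetIl. Qed.
Let nPN : P <| N. Proof. by rewrite /normal sPN subsetIr. Qed.
Let hallPN : p.-Hall(N) P. Proof. exact: pHall_subl sPN sNG sylP. Qed.

(** The p-elements of [N] lie in its normal Hall subgroup [P], so the TI property applies. This is
    the semiregularity needed for the augmentation kernel. *)
Lemma norm_syl_semireg (x b : gT) : x \in P -> x != 1%g -> b \in G ->
  (x ^ b^-1)%g \in N -> b \in N.
Proof.
move=> Px nt_x Gb Nxb; rewrite inE Gb -groupV.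
apply: (syl_TI Px) => //; first by rewrite groupV.
by rewrite (mem_normal_Hall hallPN) // p_eltJ (mem_p_elt pP).
Qed.

Variable H : {group gT}.
Hypothesis complH : H \in [complements to P in N].

Let tiPH : P :&: H = 1%g. Proof. by case/complP: complH. Qed.
Let defN : (P * H)%g = N. Proof. by case/complP: complH. Qed.
Lemma sub_compl_norm : H \subset N. Proof. by rewrite -defN mulG_subr. Qed.

Lemma compl_norm_p'group : p^'.-group H.
Proof.
have := hallPN => /and3P[_ _]; rewrite -divgS // -defN TI_cardMg // mulKn //.
Qed.

(** Let [h] be the factor of [w] in [H]. Then [w] and [h] generate, together with [P], the same
    group, in which their cyclic groups are complements of [P], hence conjugate under [P] by
    Schur-Zassenhaus. *)
Lemma conj_into_compl (w : gT) : w \in N -> p^'.-elt w ->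
  exists2 v, v \in P & (w ^ v)%g \in H.
Proof.
move=> Nw p'w; move: (Nw); rewrite -defN => /mulsgP[u h Pu Hh defw].
have nPh : <[h]> \subset 'N(P)%g.
  by rewrite cycle_subG (subsetP (normal_norm nPN)) // (subsetP sub_compl_norm).
have nPw : <[w]> \subset 'N(P)%g by rewrite cycle_subG (subsetP (normal_norm nPN)).
have tiPh : P :&: <[h]> = 1%g.
  by apply/trivgP; rewrite -tiPH setIS // cycle_subG.
have tiPw : P :&: <[w]> = 1%g by apply: coprime_TIg; apply: pnat_coprime p'w.
have eqPwh : (P * <[w]> = P * <[h]>)%g.
  rewrite -!norm_joinEr //; apply/eqP; rewrite eqEsubset !join_subG !joing_subl /=.
  rewrite !cycle_subG; apply/andP; split.
    by rewrite {1}defw groupM ?mem_gen // inE ?Pu ?cycle_id ?orbT.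
  have defh : h = (u^-1 * w)%g by rewrite defw mulKg.
  by rewrite {1}defh groupM ?groupV ?mem_gen // inE ?Pu ?cycle_id ?orbT.
have card_wh : #|<[w]>| = #|<[h]>|.
  apply/eqP; rewrite -(eqn_pmul2l (cardG_gt0 P)) -!TI_cardMg //.
  by rewrite eqPwh.
have [| |v Pv defw'] := SchurZassenhaus_trans_sol (abelian_sol syl_abelian) nPh _ _ card_wh.
- by rewrite -eqPwh mulG_subr.
- by rewrite -card_wh; apply: pnat_coprime p'w.
exists v^-1%g; first by rewrite groupV.
have : w \in (<[h]> :^ v)%g by rewrite -defw' cycle_id.
by rewrite mem_conjg; apply/subsetP; rewrite cycle_subG.
Qed.

(** If [w'] and [w' ^ z] lie in [H] with [z] in [P], the commutator of [w'] and [z] lies in both [H]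
    and [P], so [z] centralizes [w']: the set is a coset of a centralizer. *)
Lemma card_conj_compl (w : gT) : w \in N -> p^'.-elt w ->
  #|[set v in P | (w ^ v)%g \in H]| = #|'C_P[w]|.
Proof.
move=> Nw p'w; have [v0 Pv0 Hw] := conj_into_compl Nw p'w.
pose w' := (w ^ v0)%g.
transitivity #|'C_P[w']|; last first.
  rewrite -(cardJg 'C_P[w] v0) conjIg (conjGid Pv0) /w'.
  by congr #|_ :&: _|; rewrite cent1J.
rewrite -(card_lcoset 'C_P[w'] v0); apply: eq_card => v.
have Pv0V : v0^-1%g \in P by rewrite groupV.
rewrite mem_lcoset in_setI [LHS]inE (groupMl _ Pv0V).
case: (boolP (v \in P)) => //= Pv.
set z := (v0^-1 * v)%g; have -> : (w ^ v = w' ^ z)%g by rewrite -conjgM mulKVg.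
have Pz : z \in P by rewrite groupM.
rewrite cent1C; apply/idP/cent1P => [Hwz|/commgP/conjg_fixP->//].
apply/commgP; rewrite -in_set1 -[[set _]]tiPH in_setI; apply/andP; split.
  rewrite commgEr groupMr // memJ_norm ?groupV //.
  by rewrite (subsetP (normal_norm nPN)) // (subsetP sub_compl_norm).
by rewrite commgEl groupM ?groupV.
Qed.

Lemma syl_conj_elt s : s \in G -> p.-elt s -> exists2 g, g \in G & (s ^ g)%g \in P.
Proof.
move=> Gs p_s; have [|g Gg] := Sylow_Jsub sylP (_ : <[s]> \subset G) p_s.
  by rewrite cycle_subG.
by rewrite -cycleJ cycle_subG; exists g.
Qed.

Lemma card_conj_syl z : z \in G -> p.-elt z -> z != 1%g ->
  #|[set y in G | (z ^ y)%g \in P]| = #|N|.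
Proof.
move=> Gz p_z nt_z; have [g0 Gg0 Pzg] := syl_conj_elt Gz p_z.
rewrite -(card_lcoset N g0); apply: eq_card => y; rewrite in_set mem_lcoset.
case: (boolP (y \in G)) => [Gy|nGy] /=; last first.
  by apply/esym/negP=> /(subsetP sNG); rewrite groupMl ?groupV // (negPf nGy).
have zy : (z ^ y = (z ^ g0) ^ (g0^-1 * y))%g by rewrite -conjgM mulKVg.
apply/idP/idP => [Pzy|]; last by rewrite zy => /setIP[_ /memJ_norm->].
rewrite in_setI groupM ?groupV //=; apply: (syl_TI Pzg); last by rewrite -zy.
  by rewrite conjg_eq1.
by rewrite groupM ?groupV.
Qed.

(** The identity Psi = Ind_H 1 - Ind_N 1 + 1 without subtraction. After multiplication by [#|N|]
    every term counts elements of [G] or pairs of them. *)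
Lemma Psi_val_fix_cosets x : x \in G ->
  (Psi_val p G x + fix_cosets G N x = fix_cosets G H x + 1)%N.
Proof.
move=> Gx; have sHG := subset_trans sub_compl_norm sNG.
have cN := card_fix_cosets x sNG; have cH := card_fix_cosets x sHG.
have [p'x|p_x] := boolP (p^'.-elt x); last first.
  rewrite /Psi_val (negPf p_x).
  have -> : fix_cosets G H x = 0%N.
    apply/eqP; rewrite -(eqn_pmul2r (cardG_gt0 H)) mul0n cH.
    rewrite -leqn0 leqNgt; apply: contra p_x => /card_gt0P[y].
    by rewrite inE => /andP[Gy /(mem_p_elt compl_norm_p'group)]; rewrite p_eltJ.
  apply/eqP; rewrite -(eqn_pmul2r (cardG_gt0 N)) !add0n mul1n cN.
  (* For p-singular [x], the elements bringing [x] into [N] are those bringing its p-part [s] into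
     [P]; by the TI property they form a single coset of [N]. *)
  pose s := (x.`_p)%g.
  have nt_s : s != 1%g.
    apply: contra p_x => /eqP s1.
    by rewrite -(consttC p x) -/s s1 mul1g p_elt_constt.
  have Gs : s \in G by rewrite groupX.
  have [g0 Gg0 Psg] := syl_conj_elt Gs (p_elt_constt p x).
  rewrite -(card_lcoset N g0); apply/eqP/eq_card => y.
  rewrite inE mem_lcoset; case: (boolP (y \in G)) => [Gy|nGy] /=; last first.
    by apply/esym/negP=> /(subsetP sNG); rewrite groupMl ?groupV // (negPf nGy).
  apply/idP/idP => [Nxy|Ny].
    have Psy : (s ^ y)%g \in P.
      rewrite (mem_normal_Hall hallPN) ?p_eltJ ?p_elt_constt //.
      by rewrite /s -consttJ groupX.
    rewrite inE groupM ?groupV //=; apply: (syl_TI Psg) => //.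
    - by rewrite conjg_eq1.
    - by rewrite groupM ?groupV.
    by rewrite -conjgM mulKVg.
  have -> : (x ^ y = (x ^ g0) ^ (g0^-1 * y))%g by rewrite -conjgM mulKVg.
  suff Nxg : (x ^ g0)%g \in N by rewrite groupJ.
  have sx : (s ^ x)%g = s.
    apply/conjg_fixP/commgP.
    by rewrite /s /constt; apply/commute_sym/commuteX/commute_refl.
  have Psgx : ((s ^ g0) ^ (x ^ g0))%g \in P by rewrite -conjJg sx.
  by rewrite inE groupJ //=; apply: (syl_TI Psg _ _ Psgx); rewrite ?conjg_eq1 ?groupJ.
rewrite /Psi_val p'x; set S := [set z in _ | _].
apply/eqP; rewrite -(eqn_pmul2r (cardG_gt0 N)) mulnDl mulnDl mul1n cN.
have cardN : (#|N| = #|H| * #|P|)%N by rewrite -defN TI_cardMg // mulnC.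
rewrite [in (fix_cosets _ _ _ * _)%N]cardN mulnA cH.
(* For p-regular [x], count in two ways the pairs of [y] in [G] and [v] in [P] whose product
   conjugates [x] into [H]. *)
have -> : (#|[set y in G | (x ^ y)%g \in H]| * #|P| =
           \sum_(y in G) ((x ^ y)%g \in N) * #|'C_P[x ^ y]|)%N.
  transitivity (\sum_(v in P) \sum_(y in G) ((x ^ (y * v))%g \in H))%N.
    rewrite mulnC -sum_nat_const; apply: eq_bigr => v Pv.
    rewrite -sum1_card big_mkcond [RHS]big_mkcond /= (reindex_inj (mulIg v)).
    apply: eq_bigr => y _; rewrite inE groupMr ?(subsetP sPG v Pv) //.
    by case: (y \in G) => //=; case: (_ \in H).
  rewrite exchange_big; apply: eq_bigr => y Gy /=.
  case: (boolP ((x ^ y)%g \in N)) => [Nxy|nNxy]; last first.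
    rewrite mul0n big1 // => v Pv; apply/eqP; rewrite eqb0.
    apply: contra nNxy => /(subsetP sub_compl_norm).
    by rewrite conjgM groupJr // (subsetP sPN).
  rewrite mul1n -card_conj_compl ?p_eltJ // -sum1_card [LHS]big_mkcond [RHS]big_mkcond /=.
  by apply: eq_bigr => v _; rewrite inE conjgM; case: (v \in P) => //=; case: (_ \in H).
(* Split off the identity of each ['C_P[x ^ y]]. A nontrivial element of [P] commuting with [x ^ y]
   already forces [x ^ y] into [N], so that condition disappears from the rest, which becomes a sum
   over the nontrivial p-elements [z] centralizing [x]. *)
have -> : (\sum_(y in G) ((x ^ y)%g \in N) * #|'C_P[x ^ y]| =
    #|[set y in G | (x ^ y)%g \in N]| +
    \sum_(y in G) \sum_(z in S | z != 1%g) ((z ^ y)%g \in P))%N.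
  rewrite -sum1_card big_mkcond [X in _ = (X + _)%N]big_mkcond /= [in X in (_ + X)%N]big_mkcond
    -big_split /=.
  apply: eq_bigr => y _.
  have -> : (y \in [set y0 in G | (x ^ y0)%g \in N]) = (y \in G) && ((x ^ y)%g \in N).
    by rewrite in_set.
  case: (boolP (y \in G)) => //= Gy.
  have -> : (\sum_(z in S | z != 1%g) ((z ^ y)%g \in P) = #|'C_P[x ^ y]^#|)%N.
    rewrite -sum1_card [LHS]big_mkcond [RHS]big_mkcond /= [RHS](reindex_inj (conjg_inj y)).
    apply: eq_bigr => z _; rewrite in_setD1 in_setI conjg_eq1 in_set in_setI.
    case: (boolP ((z ^ y)%g \in P)) => [Pzy|_]; last by rewrite if_same andbF.
    have -> : p.-elt z by rewrite -(p_eltJ _ _ y) (mem_p_elt pP).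
    have -> : z \in G by rewrite -(groupJr z Gy) (subsetP sPG).
    rewrite /= andbT andbC -(memJ_conjg 'C[x] y) -cent1J.
    by case: (_ && _).
  case: (boolP ((x ^ y)%g \in N)) => [Nxy|nNxy].
    by rewrite /= mul1n (cardsD1 1%g) group1.
  rewrite /= mul0n add0n; apply/esym/eqP; rewrite cards_eq0 -subset0.
  apply/subsetP=> z /setD1P[nt_z /setIP[Pz cz]]; case/negP: nNxy.
  rewrite inE groupJ //=; apply: (syl_TI Pz) => //; first by rewrite groupJ.
  suff -> : (z ^ (x ^ y) = z)%g by [].
  exact/conjg_fixP/commgP/cent1P.
have -> : (\sum_(y in G) \sum_(z in S | z != 1%g) ((z ^ y)%g \in P)
           = #|S :\ 1%g| * #|N|)%N.
  rewrite exchange_big -sum_nat_const; apply: eq_big => [z|z /andP[Sz nt_z]].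
    by rewrite in_setD1 andbC.
  move: Sz; rewrite in_set => /andP[/setIP[Gz _] p_z].
  rewrite -(card_conj_syl Gz p_z nt_z) -sum1_card big_mkcond [RHS]big_mkcond /=.
  by apply: eq_bigr => y _; rewrite in_set; case: (y \in G) => //=; case: (_ \in P).
have S1 : 1%g \in S by rewrite in_set group1 p_elt1.
by rewrite (cardsD1 1%g S) S1 mulnDl mul1n addnC -addnA [(#|N| + _)%N]addnC.
Qed.

Section TIAfforded.

Variables (R : idomainType) (K F : fieldType).
Variables (iota : {rmorphism R -> K}) (rho : {rmorphism R -> F}).
Hypothesis smsG : splitting_modular_system p G iota rho.

Lemma unit_p'nat n : (0 < n)%N -> p^'.-nat n -> (n%:R : R) \is a GRing.unit.
Proof.
move=> n_gt0 p'n; rewrite (unit_residue (sms_residue_ker smsG)) rmorph_nat.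
have chF := sms_pchar_residue smsG; rewrite -(dvdn_pcharf chF).
by rewrite -prime.p'natE.
Qed.

(** With [G] for [B], the augmentation kernel is the complement of the trivial module in R[G / N];
    splitting it off R[G / H] leaves the character Ind_H 1 - Ind_N 1 + 1. *)
Lemma TI_afforded_compl : afforded_by_projective G iota (Psi_val p G).
Proof.
have sHN := sub_compl_norm; have sHG := subset_trans sHN sNG.
have uH : (#|H|%:R : R) \is a GRing.unit.
  by rewrite unit_p'nat ?cardG_gt0 //; apply: compl_norm_p'group.
have uGP : (#|G : P|%:R : R) \is a GRing.unit.
  by rewrite unit_p'nat ?indexg_gt0 //; case/and3P: sylP.
have semireg x b : x \in P -> x != 1%g -> b \in G -> (x ^ b^-1)%g \in N -> b \in N.
  exact: norm_syl_semireg.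
have uGN := unit_index_BN sPN sNG uGP.
pose EM := kmx (coset_ker R G H); pose EX := kmx (aug_ker R G G N).
have [tM trM] := coset_ker_trace1 sHG uH.
have [tX trX] := aug_ker_trace1 sPN sNG (subxx G) semireg uGP.
have idM := coset_ker_idem R G H; have idX := aug_ker_idem sPN sNG (subxx G) uGP.
(* [phi] is the natural map R[G / H] -> R[G / N]. [psi] lifts a coset of [N] to that of a chosen
   representative: a section that is linear, but not equivariant in general. *)
pose phi A C : R := ((A \in rcosets H G) && (C == N * A)%g)%:R.
pose psi A C : R := ((A \in rcosets N G) && (C == H :* repr A)%g)%:R.
have cM x : x \in G -> EM *m rset_repr R G x = rset_repr R G x *m EM.
  by move=> Gx; apply: rset_cent => A A'; apply: coset_ker_mulr.
have cX x : x \in G -> EX *m rset_repr R G x = rset_repr R G x *m EX.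
  by move=> Gx; apply: rset_cent => A A'; apply: aug_ker_mulr.
have cphi x : x \in G -> kmx phi *m rset_repr R G x = rset_repr R G x *m kmx phi.
  move=> Gx; apply: rset_cent => A A'.
  by rewrite /phi mem_rcosetsM // mulgA (can_eq (rcosetK x)).
have cQ x : x \in G -> kmx phi *m EX *m rset_repr R G x = rset_repr R G x *m (kmx phi *m EX).
  by move=> Gx; rewrite -mulmxA cX // !mulmxA cphi.
have Mphi : EM *m kmx phi = kmx phi.
  rewrite kmx_mul; apply: eq_kmx => A C; rewrite (bigD1 A) //= big1 => [|A' nA].
    by rewrite addr0 /coset_ker /phi eqxx andbT; case: (A \in _); rewrite ?mul1r ?mul0r.
  by rewrite /coset_ker eq_sym (negPf nA) andbF mul0r.
have psiQ : kmx psi *m (kmx phi *m EX) = EX.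
  rewrite mulmxA kmx_mul -[RHS]mul1mx -kmx1 !kmx_mul; apply: eq_kmx => A A'.
  have [NA|nNA] := boolP (A \in rcosets N G); last first.
    rewrite [RHS](bigD1 A) //= !big1 ?addr0 => [|C neqC|C _].
    - by rewrite /aug_ker (negPf nNA) mulr0.
    - by rewrite eq_sym (negPf neqC) mul0r.
    by rewrite big1 ?mul0r // => C' _; rewrite /psi (negPf nNA) mul0r.
  apply: eq_bigr => C _; congr (_ * _).
  have [a Ga defA] := rcosetsP NA.
  have Arepr : repr A \in A by rewrite defA mem_repr_rcoset.
  have AreprA : A = N :* repr A.
    by rewrite {1}defA; apply/esym/rcoset_eqP; rewrite -defA.
  have GreprA : repr A \in G.
    by move: Arepr; rewrite {2}defA => /rcosetP[n Nn ->]; rewrite groupM ?(subsetP sNG n Nn).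
  rewrite (bigD1 (H :* repr A)) //= big1 ?addr0 => [|C' neqC]; last first.
    by rewrite /psi (negPf neqC) andbF mul0r.
  rewrite /psi /phi NA eqxx mul1r mem_rcosets mulSGid // GreprA /=.
  by rewrite mulg_rcoset // -AreprA eq_sym.
have idMt : EM *m mx_trace1 (rset_repr R G) (kmx tM) = EM by rewrite trM idM.
have QX : kmx phi *m EX *m EX = kmx phi *m EX by rewrite -mulmxA idX.
have MQ : EM *m (kmx phi *m EX) = kmx phi *m EX by rewrite mulmxA Mphi.
have [EY [idY cY trY tracY]] := split_off idM cM idMt idX cX trX cQ MQ QX psiQ.
have [m [rM tr_rM trace_rM]] :=
  proj_summand (sms_residue_surj smsG) (sms_residue_ker smsG) idY cY trY.
apply: higman_afforded_projective; exists m, rM => // x Gx.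
rewrite trace_rM // tracY // mxtrace_coset_ker // mxtrace_aug_ker //.
have fixG : fix_cosets G G x = 1%N.
  rewrite /fix_cosets rcosets_id.
  apply/eqP/cards1P; exists (G : {set gT}); apply/setP=> A; rewrite !inE.
  by apply/andP/idP => [[]//|/eqP->]; rewrite rcoset_id.
have := Psi_val_fix_cosets Gx; rewrite -/N => /(congr1 (fun n => n%:R : R)).
rewrite !natrD => PsiE; rewrite fixG opprB addrA -PsiE addrK.
by rewrite rmorph_nat.
Qed.

End TIAfforded.

(** The trivial character is a constituent of Ind_H^N 1; removing it before inducing to [G] leaves a
    character. *)
Lemma Psi1_char_compl : Psi1 p G \is a character.
Proof.
have sHN := sub_compl_norm; have sHG := subset_trans sHN sNG.
have -> : Psi1 p G = 1 + 'Ind[G, N] ('Ind[N, H] 1 - 1).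
  apply/cfun_inP=> x Gx; rewrite linearB /= cfIndInd //.
  have fixE (X : {group gT}) : X \subset G ->
      ('Ind[G] (1 : 'CF(X))) x = (fix_cosets G X x)%:R.
    move=> sXG; rewrite cfIndE //; apply: (canLR (mulKf (neq0CG X))).
    rewrite mulrC -natrM card_fix_cosets // -sum1_card natr_sum.
    rewrite big_mkcond [RHS]big_mkcond /=; apply: eq_bigr => y _.
    by rewrite in_set cfun1E; case: (y \in G) => //=; case: (_ \in X).
  rewrite !cfunE ?ffunE cfun1E Gx !fixE //.
  have := Psi_val_fix_cosets Gx; rewrite -/N => /(congr1 (fun n => n%:R : algC)).
  by rewrite !natrD => PsiE; rewrite addrA [1 + _]addrC -PsiE addrK.
rewrite rpredD ?rpred1 // cfInd_char //.
have chI : 'Ind[N] (1 : 'CF(H)) \is a character by rewrite cfInd_char ?rpred1.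
have constt0 : 0 \in irr_constt ('Ind[N] (1 : 'CF(H))).
  rewrite irr_consttE irr0 -cfdot_Res_r cfRes_cfun1 // cfnorm1 oner_eq0 //.
have [chi Nchi ->] := constt_charP 0 chI constt0.
by rewrite irr0 addrC addKr.
Qed.

End AbelianCentralizers.

Section AbelianCentralizerCase.

Variables (p : nat) (gT : finGroupType) (G : {group gT}).
Hypothesis p_pr : prime p.
Hypothesis abC : forall x : gT, x \in G -> p.-elt x -> x != 1%g -> abelian 'C_G[x].

Lemma syl_norm_compl : exists P : {group gT}, p.-Sylow(G) P /\
  exists H : {group gT}, H \in [complements to P in 'N_G(P)].
Proof.
have [P sylP] := Sylow_exists p G; exists P; split=> //.
have sPN : P \subset 'N_G(P) by rewrite subsetI (pHall_sub sylP) normG.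
have := SchurZassenhaus_split (pHall_Hall (pHall_subl sPN (subsetIl _ _) sylP)).
rewrite /normal sPN subsetIr => /(_ isT)/splitsP[H complH].
by exists H.
Qed.

Lemma Psi1_char_abC : Psi1 p G \is a character.
Proof. by have [P [sylP [H complH]]] := syl_norm_compl; apply: Psi1_char_compl complH. Qed.

Lemma Psi_afforded_abC (R : idomainType) (K F : fieldType)
    (iota : {rmorphism R -> K}) (rho : {rmorphism R -> F}) :
  splitting_modular_system p G iota rho ->
  afforded_by_projective G iota (Psi_val p G).
Proof.
by move=> sms; have [P [sylP [H complH]]] := syl_norm_compl;
  exact: (TI_afforded_compl p_pr abC sylP complH sms).
Qed.

End AbelianCentralizerCase.

(** * The quotient of SL(2, k) *)

Section Mx2.

Variable k : comUnitRingType.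

Definition mx2 (a b c d : k) : 'M[k]_2 :=
  \matrix_(i, j) if (i == 0 :> nat) then (if (j == 0 :> nat) then a else b)
                 else (if (j == 0 :> nat) then c else d).

Lemma ord2P (i : 'I_2) : (i = 0) + (i = 1).
Proof.
by case: i => [[|[|//]] lti]; [left | right]; apply: val_inj.
Qed.

Lemma mx2_ind (T : 'M[k]_2 -> Prop) : (forall a b c d, T (mx2 a b c d)) -> forall M, T M.
Proof.
move=> TM M; have -> : M = mx2 (M 0 0) (M 0 1) (M 1 0) (M 1 1); last exact: TM.
by apply/matrixP=> i j; case: (ord2P i) => ->; case: (ord2P j) => ->; rewrite !mxE.
Qed.

Lemma mx2_mul a b c d a' b' c' d' : mx2 a b c d *m mx2 a' b' c' d' =
  mx2 (a * a' + b * c') (a * b' + b * d') (c * a' + d * c') (c * b' + d * d').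
Proof.
by apply/matrixP=> i j; rewrite !mxE !big_ord_recl big_ord0 !mxE /= addr0;
  case: (ord2P i) => ->; case: (ord2P j) => ->.
Qed.

Lemma det_mx2 a b c d : \det (mx2 a b c d) = a * d - b * c.
Proof. rewrite (expand_det_row _ 0) !big_ord_recl big_ord0 /cofactor !det_mx11 !mxE /=.
by rewrite expr0 expr1 mul1r mulN1r mulrN addr0. Qed.

Lemma mx2_inj a b c d a' b' c' d' : mx2 a b c d = mx2 a' b' c' d' ->
  [/\ a = a', b = b', c = c' & d = d'].
Proof.
move=> eqM; have e i j := congr1 (fun M : 'M_2 => M i j) eqM.
by have := (e 0 0, e 0 1, e 1 0, e 1 1); rewrite !mxE /= => -[[[]]].
Qed.

Lemma scalar_mx2 a : a%:M = mx2 a 0 0 a :> 'M[k]_2.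
Proof. by apply/matrixP=> i j; rewrite !mxE; case: (ord2P i) => ->; case: (ord2P j) => ->;
  rewrite ?mxE. Qed.

End Mx2.

Section SL2Model.

Variables (k : finFieldType) (gT : finGroupType) (G : {group gT}).

(** PSL(2, k) presented by plain matrices: [phi] is total but constrained only on determinant 1, so
    that later computations avoid the quotient and the type of invertible matrices. *)
Definition SL2_model (phi : 'M[k]_2 -> gT) : Prop :=
  [/\ forall M N, \det M = 1 -> \det N = 1 -> phi (M *m N) = (phi M * phi N)%g,
      forall M, \det M = 1 -> phi M \in G,
      forall g, g \in G -> exists2 M, \det M = 1 & phi M = g
    & forall M, \det M = 1 -> (phi M = 1%g <-> exists a, M = a%:M)].

Lemma PSL2_model : G \isog PSL2 k -> exists phi, SL2_model phi.
Proof.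
rewrite isog_sym => /isogP[f injf imf].
pose toGL (M : 'M[k]_2) : {'GL_2[k]} := insubd (1%g : {'GL_2[k]}) (M : 'M[k]_2.-1.+1).
have valGL M : \det M = 1 -> GLval (toGL M) = M.
  by move=> dM; rewrite /toGL [GLval _]insubdK // -topredE /= unitmxE dM unitr1.
have toGLK (u : {'GL_2[k]}) : toGL (GLval u) = u by apply: valKd.
have SLtoGL M : \det M = 1 -> toGL M \in SL2 k.
  by move=> dM; rewrite inE valGL // dM.
have nZ u : u \in SL2 k -> u \in 'N('Z(SL2 k)).
  by move=> SLu; apply: (subsetP (normal_norm (center_normal _))).
pose phi M := f (coset 'Z(SL2 k) (toGL M)).
have PSL M : \det M = 1 -> coset 'Z(SL2 k) (toGL M) \in PSL2 k.
  by move=> dM; rewrite mem_quotient ?SLtoGL.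
exists phi; split=> [M N dM dN|M dM|g|M dM].
- rewrite /phi -morphM ?PSL // -morphM ?nZ ?SLtoGL //; congr (f (coset _ _)).
  apply: val_inj; change (GLval (toGL (M *m N)) = GLval (toGL M * toGL N)).
  by rewrite GL_MxE !valGL // det_mulmx dM dN mulr1.
- by rewrite -imf mem_morphim ?PSL.
- rewrite -imf => /morphimP[x _ /morphimP[u _ SLu ->] ->].
  exists (GLval u); last by rewrite /phi toGLK.
  by apply/eqP; rewrite inE in SLu.
have phi1 : (phi M = 1%g) <-> toGL M \in 'Z(SL2 k).
  split=> [/eqP|ZM]; last by rewrite /phi coset_id // morph1.
  by rewrite morph_injm_eq1 ?PSL // => /eqP/coset_idr; apply; rewrite nZ ?SLtoGL.
apply: iff_trans phi1 _; split=> [/centerP[_ cM]|[a defM]].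
  (* Commuting with the two elementary matrices already makes a matrix scalar. *)
  have d1 : \det (mx2 1 1 0 1 : 'M[k]_2) = 1 by rewrite det_mx2 mulr1 mulr0 subr0.
  have d2 : \det (mx2 1 0 1 1 : 'M[k]_2) = 1 by rewrite det_mx2 mulr1 mul0r subr0.
  have := congr1 (@GLval 2 k) (cM _ (SLtoGL _ d2)).
  have := congr1 (@GLval 2 k) (cM _ (SLtoGL _ d1)).
  rewrite !GL_MxE !valGL //; elim/mx2_ind: M {dM cM} => a b c d.
  rewrite !mx2_mul !(mulr0, mulr1, mul0r, mul1r, addr0, add0r).
  move=> /mx2_inj[/esym/(canRL (addKr _))]; rewrite addNr => c0 eqad _ _.
  move=> /mx2_inj[/(canRL (addKr _))]; rewrite addNr => b0 _ _ _.
  move: eqad; rewrite b0 c0 addr0 add0r => ->; exists d.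
  by rewrite scalar_mx2.
apply/centerP; split=> [|u SLu]; first exact: SLtoGL.
apply: val_inj; change (GLval (toGL M * u) = GLval (u * toGL M)).
by rewrite !GL_MxE !valGL // defM scalar_mxC.
Qed.

End SL2Model.

(** Proves an equation modulo a hypothesis: [ring] only has to match the two differences of
    sides. *)
Lemma eq_of_sub_eq (V : zmodType) (x y u v : V) : u = v -> x - y = u - v -> x = y.
Proof. by move=> -> /eqP; rewrite subrr subr_eq0 => /eqP. Qed.

(** Commuting with [M] means that the vector made of the off-diagonal entries and the difference of
    the diagonal ones is parallel to that of [M]. The latter is nonzero, so the vectors of [N] and
    [N'] are parallel to each other. *)
Lemma mx2_nonscalar_comm (k : fieldType) (M N N' : 'M[k]_2) :
    (forall a, M <> a%:M) -> M *m N = N *m M -> M *m N' = N' *m M ->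
  N *m N' = N' *m N.
Proof.
elim/mx2_ind: M => a b c d; elim/mx2_ind: N => e f g h; elim/mx2_ind: N' => e' f' g' h'.
move=> nsM; rewrite !mx2_mul => /mx2_inj[E1 E2 E3 _] /mx2_inj[E1' E2' E3' _].
have bg : b * g = f * c by apply: eq_of_sub_eq E1 _; ring.
have bg' : b * g' = f' * c by apply: eq_of_sub_eq E1' _; ring.
have bf : b * (e - h) = (a - d) * f by apply: eq_of_sub_eq (esym E2) _; ring.
have bf' : b * (e' - h') = (a - d) * f' by apply: eq_of_sub_eq (esym E2') _; ring.
have cg : c * (e - h) = (a - d) * g by apply: eq_of_sub_eq E3 _; ring.
have cg' : c * (e' - h') = (a - d) * g' by apply: eq_of_sub_eq E3' _; ring.
suff [H1 H2 H3] : [/\ f * g' = f' * g, (e - h) * f' = f * (e' - h')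
                    & g * (e' - h') = g' * (e - h)].
  congr mx2.
  - by apply: eq_of_sub_eq H1 _; ring.
  - by apply: eq_of_sub_eq H2 _; ring.
  - by apply: eq_of_sub_eq H3 _; ring.
  - by apply: eq_of_sub_eq (esym H1) _; ring.
have [b0|nzb] := eqVneq b 0; last first.
  have H1 : f * g' = f' * g.
    apply: (mulfI nzb); have -> : b * (f * g') = f * (b * g') by ring.
    have -> : b * (f' * g) = f' * (b * g) by ring.
    by rewrite bg bg'; ring.
  split=> //; apply: (mulfI nzb).
    have -> : b * (f * (e' - h')) = f * (b * (e' - h')) by ring.
    by rewrite [b * (_ * _)]mulrA bf bf'; ring.
  rewrite !mulrA bg bg' -!mulrA cg cg'.
  have -> : f * ((a - d) * g') = (f * g') * (a - d) by ring.
  by rewrite H1; ring.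
have [c0|nzc] := eqVneq c 0; last first.
  have H1 : f * g' = f' * g.
    by apply: (mulIf nzc); rewrite mulrAC -bg [RHS]mulrAC -bg'; ring.
  split=> //; apply: (mulfI nzc).
    have -> : c * (f * (e' - h')) = f * (c * (e' - h')) by ring.
    rewrite [c * (_ * _)]mulrA cg cg'.
    have -> : f * ((a - d) * g') = (f * g') * (a - d) by ring.
    by rewrite H1; ring.
  have -> : c * (g * (e' - h')) = g * (c * (e' - h')) by ring.
  have -> : c * (g' * (e - h)) = g' * (c * (e - h)) by ring.
  by rewrite cg cg'; ring.
have nzw : a - d != 0.
  rewrite subr_eq0; apply/eqP=> ad; apply: (nsM d).
  by rewrite scalar_mx2 ad b0 c0.
have z v : (a - d) * v = 0 -> v = 0.
  by move/eqP; rewrite mulf_eq0 (negPf nzw) => /eqP.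
move: bf bf' cg cg'; rewrite b0 c0 !mul0r.
by do 4!move=> /esym/z ->; rewrite !(mul0r, mulr0).
Qed.

Section CaseOddOrEven.

Variables (k : finFieldType) (gT : finGroupType) (G : {group gT}) (phi : 'M[k]_2 -> gT).
Hypothesis mphi : SL2_model G phi.
Let phiM : forall M N, \det M = 1 -> \det N = 1 -> phi (M *m N) = (phi M * phi N)%g.
Proof. by case: mphi. Qed.
Let phiG : forall M, \det M = 1 -> phi M \in G. Proof. by case: mphi. Qed.
Let phi_surj : forall g, g \in G -> exists2 M, \det M = 1 & phi M = g.
Proof. by case: mphi. Qed.
Let phi_ker : forall M, \det M = 1 -> (phi M = 1%g <-> exists a, M = a%:M).
Proof. by case: mphi. Qed.

Lemma phi1 : phi 1%:M = 1%g.
Proof. by apply/phi_ker; [rewrite det1 | exists 1]. Qed.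

Lemma det_unitmx (M : 'M[k]_2) : \det M = 1 -> M \in unitmx.
Proof. by move=> dM; rewrite unitmxE dM unitr1. Qed.

Lemma det_invmx1 (M : 'M[k]_2) : \det M = 1 -> \det (invmx M) = 1.
Proof. by move=> dM; rewrite det_inv dM invr1. Qed.

Lemma phiV M : \det M = 1 -> phi (invmx M) = (phi M)^-1%g.
Proof.
move=> dM; apply: (mulgI (phi M)); rewrite mulgV -phiM ?det_invmx1 //.
by rewrite mulmxV ?det_unitmx // phi1.
Qed.

Lemma phi_eqP M N : \det M = 1 -> \det N = 1 ->
  phi M = phi N <-> exists2 a, a ^+ 2 = 1 & M = a *: N.
Proof.
move=> dM dN; have uN := det_unitmx dN; split=> [eqMN|[a a2 defM]].
  have dMN : \det (M *m invmx N) = 1 by rewrite det_mulmx dM det_invmx1 ?mulr1.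
  have : phi (M *m invmx N) = 1%g by rewrite phiM ?det_invmx1 // phiV // eqMN mulgV.
  case/phi_ker=> // a defMN; exists a; first by rewrite -dMN defMN det_scalar.
  by rewrite -[M](mulmxKV uN) defMN mul_scalar_mx.
have dMN : \det (M *m invmx N) = 1 by rewrite det_mulmx dM det_invmx1 ?mulr1.
apply/eqP; rewrite eq_mulgV1 -phiV // -phiM ?det_invmx1 //; apply/eqP/phi_ker => //.
by exists a; rewrite defM -scalemxAl mulmxV // scalemx1.
Qed.

Lemma phiX M n : \det M = 1 -> phi (M ^+ n) = (phi M ^+ n)%g /\ \det (M ^+ n) = 1.
Proof.
move=> dM; elim: n => [|n [IHn dn]]; first by rewrite expr0 expg0 phi1 det1.
by rewrite exprS expgS phiM // IHn det_mulmx dM dn mulr1.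
Qed.

(* A lift of an element commuting with [x] commutes with a lift of [x] up to a
   sign, and this sign is killed by the odd order of [x]. *)
Lemma abelian_cent1_pelt (p : nat) : prime p -> odd p \/ 2%:R = 0 :> k ->
  forall x, x \in G -> p.-elt x -> x != 1%g -> abelian 'C_G[x].
Proof.
move=> p_pr p_or_k x Gx p_x nt_x; have [M dM defx] := phi_surj Gx.
have nsM a : M <> a%:M.
  by move=> defM; case/eqP: nt_x; rewrite -defx; apply/phi_ker => //; exists a.
have comM N : \det N = 1 -> phi N \in 'C[x] -> M *m N = N *m M.
  move=> dN /cent1P; rewrite -defx /commute -!phiM // => /phi_eqP.
  rewrite !det_mulmx dM dN mulr1 => /(_ erefl erefl)[a a2 eNM].
  suff a1 : a = 1 by rewrite eNM a1 scale1r.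
  case: p_or_k => [odd_p|k2]; last first.
    have : (a - 1) ^+ 2 = 0.
      have -> : (a - 1) ^+ 2 = a ^+ 2 + 1 - 2%:R * a by ring.
      by rewrite a2 k2 mul0r subr0 -k2 mulr2n.
    by move/eqP; rewrite expf_eq0 subr_eq0 => /andP[_ /eqP].
  have [j ordx] := p_natP p_x.
  have [phiMn dMn] := phiX #[x] dM.
  have [s defMn] : exists s, M ^+ #[x] = s%:M.
    by apply/(phi_ker dMn); rewrite phiMn defx expg_order.
  have comX n : N *m M ^+ n = a ^+ n *: (M ^+ n *m N).
    elim: n => [|n IHn]; first by rewrite !expr0 scale1r mul1mx mulmx1.
    rewrite exprS [_ * _]/(_ *m _) mulmxA eNM -scalemxAl -mulmxA IHn.
    by rewrite -scalemxAr scalerA -exprS mulmxA.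
  have := comX #[x]; rewrite defMn scalar_mxC mul_scalar_mx => eqN.
  have aN : a ^+ #[x] = 1.
    have nzs : s != 0.
      by apply: contra_eq_neq dMn => s0; rewrite defMn s0 det_scalar expr0n /= eq_sym oner_eq0.
    have uN := det_unitmx dN.
    have : s *: N = (a ^+ #[x] * s) *: N by rewrite eqN scalerA.
    move/(congr1 (mulmx^~ (invmx N))); rewrite -!scalemxAl mulmxV //.
    rewrite !scalemx1 => /(congr1 (fun A : 'M_2 => A 0 0)); rewrite !mxE eqxx !mulr1n.
    by move/esym; rewrite -{2}[s]mul1r => /(mulIf nzs).
  have odd_x : odd #[x] by rewrite ordx oddX odd_p orbT.
  move: aN; rewrite -(odd_double_half #[x]) odd_x exprD expr1 -muln2 mulnC exprM a2.
  by rewrite expr1n mulr1.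
apply/centsP=> y /setIP[Gy Cy] z /setIP[Gz Cz].
have [N dN defy] := phi_surj Gy; have [N' dN' defz] := phi_surj Gz.
rewrite /commute -defy -defz -!phiM //; congr phi.
by apply: mx2_nonscalar_comm nsM _ _; apply: comM; rewrite ?defy ?defz.
Qed.

End CaseOddOrEven.

(** * The quadratic character *)

Section QuadraticCharacter.

Variable k : finFieldType.
Hypothesis k2 : 2%:R != 0 :> k.

Let h := (#|k|.-1)./2.

Lemma neq1N1 : (1 : k) != -1.
Proof. by rewrite -subr_eq0 opprK -mulr2n. Qed.

Lemma odd_card_field : odd #|k|.
Proof.
apply/negPn/negP=> evq; have := expf_card (-1 : k).
by rewrite -signr_odd (negPf evq) expr0 => /eqP; rewrite (negPf neq1N1).
Qed.

Lemma card_field_half : #|k| = (h.*2).+1.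
Proof.
have odq := odd_card_field; rewrite /h -[LHS](prednK (ltnW (finNzRing_gt1 k))).
congr _.+1; rewrite -[LHS]odd_double_half.
by move: odq; rewrite -{1}(prednK (ltnW (finNzRing_gt1 k))) /= => /negPf->.
Qed.

Lemma expf_half (x : k) : x != 0 -> (x ^+ h == 1) || (x ^+ h == -1).
Proof.
move=> nzx; rewrite -eqf_sqr expr1n -exprM muln2.
have := expf_card x; rewrite card_field_half exprS => /eqP.
by rewrite -[X in _ == X]mulr1 -subr_eq0 -mulrBr mulf_eq0 (negPf nzx) subr_eq0.
Qed.

(** The quadratic character through Euler's criterion, integer-valued so that it can be read in [R],
    [K] and [algC]. *)
Definition quad_char (x : k) : int :=
  if x == 0 then 0 else if x ^+ h == 1 then 1 else -1.

Lemma quad_char0 : quad_char 0 = 0. Proof. by rewrite /quad_char eqxx. Qed.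

Lemma quad_char1 : quad_char 1 = 1.
Proof. by rewrite /quad_char oner_eq0 expr1n eqxx. Qed.

Lemma quad_charM x y : quad_char (x * y) = quad_char x * quad_char y.
Proof.
rewrite /quad_char mulf_eq0; have [->|nzx] := eqVneq x 0; first by rewrite /= mul0r.
have [->|nzy] := eqVneq y 0; first by rewrite orbT mulr0.
have N11 : ((-1 : k) == 1) = false by rewrite eq_sym (negPf neq1N1).
rewrite /= exprMn; case/orP: (expf_half nzx) => /eqP->; case/orP: (expf_half nzy) => /eqP->;
  by rewrite ?(mulr1, mul1r, mulrNN) ?eqxx ?N11 ?(mulr1, mul1r, mulrNN).
Qed.

Lemma quad_char_sqr a : a != 0 -> quad_char (a ^+ 2) = 1.
Proof.
move=> nza; rewrite /quad_char expf_eq0 /= (negPf nza).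
rewrite exprAC; case/orP: (expf_half nza) => /eqP->; rewrite ?expr1n ?eqxx //.
by rewrite sqrrN expr1n eqxx.
Qed.

Lemma quad_char_neq0 x : (quad_char x != 0) = (x != 0).
Proof. by rewrite /quad_char; case: (x == 0) => //; case: ifP. Qed.

Lemma quad_char_sqr1 x : x != 0 -> quad_char x ^+ 2 = 1.
Proof. by rewrite /quad_char => /negPf->; case: ifP. Qed.

(** Otherwise all [2 h] nonzero elements would be roots of [X^h - 1]. *)
Lemma exists_nonsquare : exists2 D, D != 0 & quad_char D = -1.
Proof.
have [D /andP[nzD DN1]|all1] := pickP [pred D | (D != 0) && (quad_char D == -1)].
  by exists D => //; apply/eqP.
pose p : {poly k} := 'X^h - 1.
have h_gt0 : (0 < h)%N.
  by have := finNzRing_gt1 k; rewrite card_field_half; case: (h).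
have sz_p : size p = h.+1 by rewrite size_XnsubC.
have nzp : p != 0 by rewrite -size_poly_eq0 sz_p.
have rts : all (root p) (enum [pred x : k | x != 0]).
  apply/allP=> x; rewrite mem_enum inE => nzx; rewrite rootE !hornerE subr_eq0.
  have := all1 x; rewrite /= nzx /quad_char (negPf nzx).
  by case: ifP.
have := max_poly_roots nzp rts (enum_uniq _); rewrite sz_p -cardE.
have -> : #|[pred x : k | x != 0]| = h.*2.
  have := cardC1 (0 : k); rewrite card_field_half /= => <-; apply: eq_card => x.
  by rewrite !inE.
by rewrite -addnn ltnS leqNgt -{1}[h]addn0 ltn_add2l h_gt0.
Qed.

Lemma sum_quad_char : \sum_x quad_char x = 0.
Proof.
have [D nzD DN1] := exists_nonsquare.
have: \sum_x quad_char x = - \sum_x quad_char x.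
  rewrite {1}(reindex_inj (mulfI nzD)) -sumrN; apply: eq_bigr => x _.
  by rewrite quad_charM DN1 mulN1r.
by move: (\sum_x quad_char x) => s; lia.
Qed.

(** The square of the quadratic Gauss sum, computed in the group algebra of the additive group of
    [k], without additive characters or roots of unity. *)
Lemma quad_char_conv w : \sum_u quad_char u * quad_char (w - u) =
  quad_char (-1) * (#|k|%:R * (w == 0)%:R - 1).
Proof.
have [->|nzw] := eqVneq w 0.
  under eq_bigr => u _.
    rewrite sub0r -[- u]mulN1r quad_charM mulrCA -expr2.
    have -> : quad_char u ^+ 2 = (u != 0)%:R.
      by case: eqP => [->|/eqP/quad_char_sqr1//]; rewrite quad_char0.
    over.
  rewrite -mulr_sumr; congr (_ * _); rewrite mulr1.
  rewrite (bigD1 0) //= eqxx add0r (eq_bigr (fun=> 1)); last by move=> u /= ->.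
  rewrite sumr_const -[#|_|]/#|predC1 (0 : k)| cardC1.
  by rewrite -subn1 natrB // ltnW ?finNzRing_gt1.
rewrite mulr0 sub0r mulrN1.
(* [u (w - u)] is [u^2 (w / u - 1)], and for nonzero [u] the last factor runs over everything but
   -1. *)
transitivity (\sum_(u | u != 0) quad_char (w / u - 1)).
  rewrite (bigD1 0) //= quad_char0 mul0r add0r; apply: eq_bigr => u nzu.
  rewrite -quad_charM; have -> : u * (w - u) = u ^+ 2 * (w / u - 1) by field.
  by rewrite quad_charM quad_char_sqr // mul1r.
transitivity (\sum_(v | v != -1) quad_char v).
  rewrite [RHS](reindex_inj (addIr (-1))) /=.
  rewrite [LHS](reindex_inj (@invr_inj k)) /= [LHS](reindex_inj (mulfI (invr_neq0 nzw))) /=.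
  apply: eq_big => [u|u _]; last by rewrite invrK mulrA mulfV // mul1r.
  rewrite invr_eq0 mulf_eq0 invr_eq0 (negPf nzw) /=.
  by rewrite -[in RHS](inj_eq (addIr 1)) subrK addNr.
have := sum_quad_char; rewrite (bigD1 (-1)) //= => /eqP.
by rewrite addr_eq0 => /eqP->; rewrite opprK.
Qed.

Lemma norm_form_neq0 D a b : quad_char D = -1 -> a ^+ 2 - D * b ^+ 2 = 0 -> a = 0 /\ b = 0.
Proof.
move=> DN1 /eqP; rewrite subr_eq0 => /eqP eab.
have [b0|nzb] := eqVneq b 0.
  by move: eab; rewrite b0 expr0n mulr0 => /eqP; rewrite expf_eq0 => /andP[_ /eqP].
have nza : a != 0.
  apply: contraTneq isT => a0; move/eqP: eab; rewrite a0 expr0n /= eq_sym.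
  rewrite mulf_eq0 expf_eq0 (negPf nzb) andbF orbF => /eqP D0.
  by move: DN1; rewrite D0 quad_char0.
have := quad_char_sqr nza; rewrite eab quad_charM quad_char_sqr // DN1.
by [].
Qed.

Lemma card_squares : (#|k| < 2 * #|[set a ^+ 2 | a : k]|)%N.
Proof.
set S := [set a ^+ 2 | a : k].
have S0 : 0 \in S by apply/imsetP; exists 0; rewrite ?expr0n.
have fib y : y \in S -> (#|[set a : k | a ^+ 2 == y]| <= 2 - (y == 0%R))%N.
  case/imsetP=> a _ ->; rewrite expf_eq0 /=.
  have [->|nza] := eqVneq a 0.
    rewrite expr0n /= leq_eqVlt; apply/orP; left; apply/cards1P; exists 0.
    by apply/setP=> b; rewrite !inE expf_eq0.
  apply: leq_trans (_ : #|[set a; -a]| <= _)%N; last by rewrite cards2; case: eqP.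
  by apply/subset_leq_card/subsetP=> b; rewrite !inE eqf_sqr.
have -> : #|k| = (\sum_(y in S) #|[set a : k | a ^+ 2 == y]|)%N.
  rewrite -sum1_card (partition_big (fun a => a ^+ 2) [in S]) => [|a _]; last first.
    by apply/imsetP; exists a.
  by apply: eq_bigr => y _; rewrite -sum1_card; apply: eq_bigl => a; rewrite !inE.
apply: (@leq_ltn_trans (\sum_(y in S) (2 - (y == 0%R)))%N); first exact: leq_sum.
rewrite (cardsD1 0) S0 (big_setD1 0) //= eqxx.
rewrite (eq_bigr (fun=> 2%N)) => [|y /setD1P[/negPf-> _]//].
by rewrite sum_nat_const mulnDr mulnC ltn_add2r.
Qed.

(** Pigeonhole: the squares and the values [D b^2 - 1] each fill more than half of [k]. The solution
    provides the matrix of determinant 1 that inverts the nonsplit torus. *)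
Lemma norm_form_surjN1 (D : k) : D != 0 -> exists a b : k, - a ^+ 2 + D * b ^+ 2 = 1.
Proof.
move=> nzD; set S := [set a ^+ 2 | a : k].
pose f (x : k) := D * x - 1.
have finj : injective f by apply: inj_comp (addIr _) (mulfI nzD).
have : S :&: f @: S != set0.
  rewrite -card_gt0; have := cardsUI S (f @: S); rewrite (card_imset _ finj).
  have := max_card (S :|: f @: S); have := card_squares; rewrite -/S.
  by move: #|_ :|: _| #|_ :&: _| #|S| #|k| => /=; lia.
case/set0Pn=> x /setIP[/imsetP[a _ ->] /imsetP[_ /imsetP[b _ ->] eab]].
by exists a, b; rewrite eab /f; ring.
Qed.

End QuadraticCharacter.

(** * Borel subgroup and tori *)

(** The later arguments see PSL(2, q), q odd, only through these facts: [U] is unipotent, [B] a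
    Borel subgroup, [T0] and [T1] the split and nonsplit tori, [N0] and [N1] their extensions by an
    inverting element. In [ps_uJ], [B] acts on [U] through squares, which makes the quadratic
    character of [U] invariant. *)
Record psl2_structure (k : finFieldType) (gT : finGroupType) (G U B T0 N0 T1 N1 : {group gT})
    (u : k -> gT) : Prop := Psl2Structure {
  ps_sBG : B \subset G;
  ps_sN0G : N0 \subset G;
  ps_sN1G : N1 \subset G;
  ps_sT0B : T0 \subset B;
  ps_sT0N0 : T0 \subset N0;
  ps_sT1N1 : T1 \subset N1;
  ps_abT0 : abelian T0;
  ps_abT1 : abelian T1;
  ps_cardT0 : (#|T0| * 2).+1 = #|k|;
  ps_cardT1 : (#|T1| * 2 = #|k|.+1)%N;
  ps_cardB : (#|B| = #|k| * #|T0|)%N;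
  ps_cardN0 : (#|N0| = #|T0| * 2)%N;
  ps_cardN1 : (#|N1| = #|T1| * 2)%N;
  ps_cardG : (#|G| = #|B| * #|k|.+1)%N;
  ps_u_inj : injective u;
  ps_uD : forall b c, u (b + c) = (u b * u c)%g;
  ps_U : U = [set u b | b : k] :> {set gT};
  ps_sUB : U \subset B;
  ps_uJ : forall g, g \in B -> exists2 a, a != 0 & forall b, (u b ^ g)%g = u (a ^+ 2 * b);
  ps_tiU : forall x g, x \in U -> x != 1%g -> g \in G -> (x ^ g)%g \in U -> g \in B;
  ps_tiT0 : forall x g, x \in T0 -> x != 1%g -> g \in G -> (x ^ g)%g \in T0 -> g \in N0;
  ps_tiT1 : forall x g, x \in T1 -> x != 1%g -> g \in G -> (x ^ g)%g \in T1 -> g \in N1;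
  ps_cU : forall x g, x \in U -> x != 1%g -> g \in G -> commute x g -> g \in U;
  ps_invT0 : forall x g, x \in T0 -> g \in N0 -> g \notin T0 -> (x ^ g = x^-1)%g;
  ps_invT1 : forall x g, x \in T1 -> g \in N1 -> g \notin T1 -> (x ^ g = x^-1)%g }.

Section OddStructure.

Variables (k : finFieldType) (gT : finGroupType) (G : {group gT}) (phi : 'M[k]_2 -> gT).
Hypothesis mphi : SL2_model G phi.
Hypothesis k2 : 2%:R != 0 :> k.
Let phiM : forall M N, \det M = 1 -> \det N = 1 -> phi (M *m N) = (phi M * phi N)%g.
Proof. by case: mphi. Qed.
Let phiG : forall M, \det M = 1 -> phi M \in G. Proof. by case: mphi. Qed.
Let phi_surj : forall g, g \in G -> exists2 M, \det M = 1 & phi M = g.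
Proof. by case: mphi. Qed.

Lemma sqr1P (a : k) : a ^+ 2 = 1 -> (a == 1) || (a == -1).
Proof. by move=> /eqP; rewrite -[1 in X in X -> _](expr1n k 2) eqf_sqr. Qed.

Section GroupOfPred.

Variable P : pred 'M[k]_2.
Hypothesis P1 : P 1%:M.
Hypothesis PM : forall M N, \det M = 1 -> \det N = 1 -> P M -> P N -> P (M *m N).
Hypothesis PN : forall M, P M -> P (- M).

Definition pred_set : {set 'M[k]_2} := [set M | (\det M == 1) && P M].

Lemma pred_group_set : group_set (phi @: pred_set).
Proof.
apply/group_setP; split=> [|x y].
  by apply/imsetP; exists 1%:M; rewrite ?(phi1 mphi) // inE det1 eqxx.
case/imsetP=> M; rewrite inE => /andP[/eqP dM PMm] ->.
case/imsetP=> N; rewrite inE => /andP[/eqP dN PNn] ->.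
apply/imsetP; exists (M *m N); last by rewrite phiM.
by rewrite inE det_mulmx dM dN mulr1 eqxx PM.
Qed.

Definition pred_group := Group pred_group_set.

Let Pscale a M : a ^+ 2 = 1 -> P (a *: M) -> P M.
Proof.
move=> /sqr1P/orP[]/eqP->; first by rewrite scale1r.
by rewrite scaleN1r => /PN; rewrite opprK.
Qed.

(** The preimages of [phi M] of determinant 1 are [M] and [- M], on which [P] agrees. *)
Lemma mem_pred_group M : \det M = 1 -> (phi M \in pred_group) = P M.
Proof.
move=> dM; apply/imsetP/idP => [[N]|PMm]; last by exists M; rewrite // inE dM eqxx.
rewrite inE => /andP[/eqP dN PNn] /esym/(phi_eqP mphi dN dM)[a a2 defN].
by apply: Pscale a2 _; rewrite -defN.
Qed.

Lemma pred_group_sub : pred_group \subset G.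
Proof.
by apply/subsetP=> x /imsetP[M]; rewrite inE => /andP[/eqP dM _] ->; apply: phiG.
Qed.

Lemma card_pred_group : (#|pred_group| * 2 = #|pred_set|)%N.
Proof.
rewrite -[RHS]sum1_card (partition_big phi [in pred_group]) /=; last first.
  by move=> M PMm; apply: imset_f.
rewrite -sum_nat_const; apply: eq_bigr => x /imsetP[M SM ->].
have /andP[/eqP dM PMm] : (\det M == 1) && P M by rewrite inE in SM.
rewrite sum1dep_card (_ : [set _ | _] = [set M; - M]).
  rewrite cards2; have -> // : M != - M.
  apply: contraTneq isT => MN; have : 2%:R *: M = 0.
    by rewrite scaler_nat mulr2n {1}MN addNr.
  move/(congr1 (fun N : 'M_2 => \det N)); rewrite detZ dM det0 mulr1.
  by move/eqP; rewrite expf_eq0 /= (negPf k2).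
apply/setP=> N; rewrite !inE; apply/andP/orP.
  case=> /andP[/eqP dN PNn] /eqP/(phi_eqP mphi dN dM)[a a2 ->].
  by case/orP: (sqr1P a2) => /eqP->; rewrite ?scale1r ?scaleN1r eqxx; [left | right].
have dNM : \det (- M) = 1 by rewrite -scaleN1r detZ dM mulr1 sqrrN expr1n.
case=> /eqP->; first by rewrite dM !eqxx PMm.
rewrite dNM eqxx PN //; split=> //; apply/eqP/(phi_eqP mphi dNM dM).
by exists (-1); rewrite ?sqrrN ?expr1n // scaleN1r.
Qed.

(** Conjugation in the quotient lifts to matrices up to a sign, which is absorbed into [M']. *)
Lemma pred_group_conj M N : \det M = 1 -> \det N = 1 ->
  (phi M ^ phi N)%g \in pred_group ->
  exists M', [/\ \det M' = 1, P M' & M *m N = N *m M'].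
Proof.
move=> dM dN /imsetP[M0]; rewrite inE => /andP[/eqP dM0 PM0] /eqP.
rewrite -(inj_eq (mulgI (phi N))) -conjgC -!phiM // => /eqP/(phi_eqP mphi).
rewrite !det_mulmx dM dN dM0 mulr1 => /(_ erefl erefl)[a a2 eMN].
exists (a *: M0); split; last by rewrite eMN scalemxAr.
  by rewrite detZ a2 dM0 mulr1.
by apply: (Pscale a2); rewrite scalerA -expr2 a2 scale1r.
Qed.

End GroupOfPred.

Lemma phi_conj M N M' : \det M = 1 -> \det N = 1 -> \det M' = 1 ->
  M *m N = N *m M' -> (phi M ^ phi N)%g = phi M'.
Proof. by move=> dM dN dM' e; apply: (mulgI (phi N)); rewrite -conjgC -!phiM // e. Qed.

Lemma phi_neq1 M : \det M = 1 -> phi M != 1%g -> forall a, M <> a%:M.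
Proof.
by move=> dM nt a defM; case/eqP: nt; case: mphi => _ _ _ ker; apply/ker => //; exists a.
Qed.

Variable D : k.
Hypothesis DN1 : quad_char D = -1.
Let nzD : D != 0.
Proof. by rewrite -quad_char_neq0 DN1. Qed.

(** All these conditions are stable under sign, so [predU] admits -1 on the diagonal. [predT1]
    describes multiplication by [d + c sqrt(D)] on the quadratic extension, with the norm as
    determinant; [predN1] adds the compositions with conjugation. *)
Definition predU : pred 'M[k]_2 := fun M => (M 1 0 == 0) && (M 0 0 == M 1 1).
Definition predB : pred 'M[k]_2 := fun M => M 1 0 == 0.
Definition predT0 : pred 'M[k]_2 := fun M => (M 1 0 == 0) && (M 0 1 == 0).
Definition predN0 : pred 'M[k]_2 := fun M => predT0 M || ((M 0 0 == 0) && (M 1 1 == 0)).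
Definition predT1 : pred 'M[k]_2 := fun M => (M 0 0 == M 1 1) && (M 0 1 == D * M 1 0).
Definition predN1 : pred 'M[k]_2 := fun M =>
  predT1 M || ((M 0 0 == - M 1 1) && (M 0 1 == - (D * M 1 0))).

Let mx2E (a b c d : k) : [/\ mx2 a b c d 0 0 = a, mx2 a b c d 0 1 = b,
  mx2 a b c d 1 0 = c & mx2 a b c d 1 1 = d].
Proof. by split; rewrite mxE. Qed.
Let mx2E00 (a b c d : k) : mx2 a b c d 0 0 = a. Proof. by case: (mx2E a b c d). Qed.
Let mx2E01 (a b c d : k) : mx2 a b c d 0 1 = b. Proof. by case: (mx2E a b c d). Qed.
Let mx2E10 (a b c d : k) : mx2 a b c d 1 0 = c. Proof. by case: (mx2E a b c d). Qed.
Let mx2E11 (a b c d : k) : mx2 a b c d 1 1 = d. Proof. by case: (mx2E a b c d). Qed.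
Let E := (mx2E00, mx2E01, mx2E10, mx2E11).
Let mx2N (a b c d : k) : - mx2 a b c d = mx2 (- a) (- b) (- c) (- d).
Proof. by apply/matrixP=> i j; rewrite !mxE; do 2!case: ifP. Qed.

Lemma predU1 : predU 1%:M. Proof. by rewrite scalar_mx2 /predU !E !eqxx. Qed.
Lemma predB1 : predB 1%:M. Proof. by rewrite scalar_mx2 /predB !E !eqxx. Qed.
Lemma predT01 : predT0 1%:M. Proof. by rewrite scalar_mx2 /predT0 !E !eqxx. Qed.
Lemma predN01 : predN0 1%:M. Proof. by rewrite /predN0 predT01. Qed.
Lemma predT11 : predT1 1%:M. Proof. by rewrite scalar_mx2 /predT1 !E mulr0 !eqxx. Qed.
Lemma predN11 : predN1 1%:M. Proof. by rewrite /predN1 predT11. Qed.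

Lemma predUN M : predU M -> predU (- M).
Proof. by elim/mx2_ind: M => a b c d; rewrite mx2N /predU !E oppr_eq0 eqr_opp. Qed.
Lemma predBN M : predB M -> predB (- M).
Proof. by elim/mx2_ind: M => a b c d; rewrite mx2N /predB !E oppr_eq0. Qed.
Lemma predT0N M : predT0 M -> predT0 (- M).
Proof. by elim/mx2_ind: M => a b c d; rewrite mx2N /predT0 !E !oppr_eq0. Qed.
Lemma predN0N M : predN0 M -> predN0 (- M).
Proof. by elim/mx2_ind: M => a b c d; rewrite mx2N /predN0 /predT0 !E !oppr_eq0. Qed.
Lemma predT1N M : predT1 M -> predT1 (- M).
Proof. by elim/mx2_ind: M => a b c d; rewrite mx2N /predT1 !E mulrN !eqr_opp. Qed.
Lemma predN1N M : predN1 M -> predN1 (- M).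
Proof. by elim/mx2_ind: M => a b c d; rewrite mx2N /predN1 /predT1 !E mulrN !eqr_opp. Qed.

Lemma predUM M N : \det M = 1 -> \det N = 1 -> predU M -> predU N -> predU (M *m N).
Proof.
elim/mx2_ind: M => a b c d; elim/mx2_ind: N => a' b' c' d' _ _.
rewrite mx2_mul /predU !E => /andP[/eqP-> /eqP->] /andP[/eqP-> /eqP->].
by rewrite !(mulr0, mul0r, add0r, addr0) !eqxx.
Qed.
Lemma predBM M N : \det M = 1 -> \det N = 1 -> predB M -> predB N -> predB (M *m N).
Proof.
elim/mx2_ind: M => a b c d; elim/mx2_ind: N => a' b' c' d' _ _.
rewrite mx2_mul /predB !E => /eqP-> /eqP->.
by rewrite !(mulr0, mul0r, add0r, addr0).
Qed.
Lemma predT0M M N : \det M = 1 -> \det N = 1 -> predT0 M -> predT0 N -> predT0 (M *m N).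
Proof.
elim/mx2_ind: M => a b c d; elim/mx2_ind: N => a' b' c' d' _ _.
rewrite mx2_mul /predT0 !E => /andP[/eqP-> /eqP->] /andP[/eqP-> /eqP->].
by rewrite !(mulr0, mul0r, add0r, addr0) !eqxx.
Qed.
Lemma predN0M M N : \det M = 1 -> \det N = 1 -> predN0 M -> predN0 N -> predN0 (M *m N).
Proof.
elim/mx2_ind: M => a b c d; elim/mx2_ind: N => a' b' c' d' _ _.
rewrite mx2_mul /predN0 /predT0 !E.
by case/orP=> /andP[/eqP-> /eqP->]; case/orP=> /andP[/eqP-> /eqP->];
  rewrite !(mulr0, mul0r, add0r, addr0) !eqxx ?orbT.
Qed.
Lemma predT1M M N : \det M = 1 -> \det N = 1 -> predT1 M -> predT1 N -> predT1 (M *m N).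
Proof.
elim/mx2_ind: M => a b c d; elim/mx2_ind: N => a' b' c' d' _ _.
rewrite mx2_mul /predT1 !E => /andP[/eqP-> /eqP->] /andP[/eqP-> /eqP->].
by apply/andP; split; apply/eqP; ring.
Qed.
Lemma predN1M M N : \det M = 1 -> \det N = 1 -> predN1 M -> predN1 N -> predN1 (M *m N).
Proof.
elim/mx2_ind: M => a b c d; elim/mx2_ind: N => a' b' c' d' _ _.
rewrite mx2_mul /predN1 /predT1 !E.
case/orP=> /andP[/eqP-> /eqP->]; case/orP=> /andP[/eqP-> /eqP->]; apply/orP;
  by [left; apply/andP; split; apply/eqP; ring | right; apply/andP; split; apply/eqP; ring].
Qed.

Definition PU := pred_group predU1 predUM.
Definition PB := pred_group predB1 predBM.
Definition PT0 := pred_group predT01 predT0M.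
Definition PN0 := pred_group predN01 predN0M.
Definition PT1 := pred_group predT11 predT1M.
Definition PN1 := pred_group predN11 predN1M.

Lemma PT0_sub_PB : PT0 \subset PB.
Proof.
apply/subsetP=> _ /imsetP[M + ->]; rewrite inE => /andP[/eqP dM /andP[P10 _]].
by rewrite mem_pred_group // => ?; apply: predBN.
Qed.

Lemma PT0_sub_PN0 : PT0 \subset PN0.
Proof.
apply/subsetP=> _ /imsetP[M + ->]; rewrite inE => /andP[/eqP dM PM].
rewrite mem_pred_group //; first by rewrite /predN0 PM.
by move=> ?; apply: predN0N.
Qed.

Lemma PT1_sub_PN1 : PT1 \subset PN1.
Proof.
apply/subsetP=> _ /imsetP[M + ->]; rewrite inE => /andP[/eqP dM PM].
rewrite mem_pred_group //; first by rewrite /predN1 PM.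
by move=> ?; apply: predN1N.
Qed.

Lemma PU_sub_PB : PU \subset PB.
Proof.
apply/subsetP=> _ /imsetP[M + ->]; rewrite inE => /andP[/eqP dM /andP[P10 _]].
by rewrite mem_pred_group // => ?; apply: predBN.
Qed.

Lemma PT0_abelian : abelian PT0.
Proof.
apply/centsP=> _ /imsetP[M + ->] _ /imsetP[N + ->]; rewrite !inE.
move=> /andP[/eqP dM PM] /andP[/eqP dN PN].
rewrite /commute -!phiM //; congr phi; move: PM PN {dM dN}; elim/mx2_ind: M => a b c d.
elim/mx2_ind: N => a' b' c' d'; rewrite /predT0 !E !mx2_mul.
move=> /andP[/eqP-> /eqP->] /andP[/eqP-> /eqP->].
by congr mx2; ring.
Qed.

Lemma PT1_abelian : abelian PT1.
Proof.
apply/centsP=> _ /imsetP[M + ->] _ /imsetP[N + ->]; rewrite !inE.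
move=> /andP[/eqP dM PM] /andP[/eqP dN PN].
rewrite /commute -!phiM //; congr phi; move: PM PN {dM dN}; elim/mx2_ind: M => a b c d.
elim/mx2_ind: N => a' b' c' d'; rewrite /predT1 !E !mx2_mul.
move=> /andP[/eqP-> /eqP->] /andP[/eqP-> /eqP->].
by congr mx2; ring.
Qed.

Lemma PU_norm_PB x g : x \in PU -> x != 1%g -> g \in G -> (x ^ g)%g \in PU -> g \in PB.
Proof.
case/imsetP=> M + -> nt Gg; rewrite inE => /andP[/eqP dM PMm].
have nsM := phi_neq1 dM nt; have [N dN <-] := phi_surj Gg.
case/(pred_group_conj predUN dM dN) => M' [dM' PM' eMN].
rewrite mem_pred_group //; last by move=> ?; apply: predBN.
move: PMm PM' eMN nsM; elim/mx2_ind: M {dM nt} => a b c d; elim/mx2_ind: M' {dM'} => a' b' c' d'.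
elim/mx2_ind: N {dN Gg} => n1 n2 n3 n4.
rewrite /predU /predB !E !mx2_mul => /andP[/eqP-> /eqP->] /andP[/eqP-> /eqP->].
rewrite !(mulr0, mul0r, addr0, add0r) => /mx2_inj[e1 e2 e3 e4] nsM.
have [//|nz3] := eqVneq n3 0; case: (nsM d).
have dd' : d = d' by apply: (mulIf nz3); rewrite e3 mulrC.
move: e1; rewrite dd' [n1 * _]mulrC -[RHS]addr0 => /addrI/eqP.
by rewrite mulf_eq0 (negPf nz3) orbF => /eqP->; rewrite scalar_mx2.
Qed.

Lemma PT0_norm x g : x \in PT0 -> x != 1%g -> g \in G -> (x ^ g)%g \in PT0 -> g \in PN0.
Proof.
case/imsetP=> M + -> nt Gg; rewrite inE => /andP[/eqP dM PMm].
have nsM := phi_neq1 dM nt; have [N dN <-] := phi_surj Gg.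
case/(pred_group_conj predT0N dM dN) => M' [dM' PM' eMN].
rewrite mem_pred_group //; last by move=> ?; apply: predN0N.
move: PMm PM' eMN nsM dN; elim/mx2_ind: M {dM nt} => a b c d; elim/mx2_ind: M' {dM'} => a' b' c' d'.
elim/mx2_ind: N {Gg} => n1 n2 n3 n4.
rewrite /predN0 /predT0 !E !mx2_mul det_mx2 => /andP[/eqP-> /eqP->] /andP[/eqP-> /eqP->].
rewrite !(mulr0, mul0r, addr0, add0r) => /mx2_inj[e1 e2 e3 e4] nsM dN.
(* [a] and [d] are distinct eigenvalues, so [N], which conjugates one diagonal matrix to another, is
   monomial. *)
have nad : a != d by apply: contra_not_neq (nsM d) => ->; rewrite scalar_mx2.
have n13 : n1 * n3 = 0.
  apply: (mulfI (_ : a - d != 0)); first by rewrite subr_eq0.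
  rewrite mulr0; have -> : (a - d) * (n1 * n3) = (a * n1) * n3 - n1 * (d * n3) by ring.
  by rewrite e1 e3; ring.
have n24 : n2 * n4 = 0.
  apply: (mulfI (_ : a - d != 0)); first by rewrite subr_eq0.
  rewrite mulr0; have -> : (a - d) * (n2 * n4) = (a * n2) * n4 - n2 * (d * n4) by ring.
  by rewrite e2 e4; ring.
move/eqP: n13; rewrite mulf_eq0 => /orP[/eqP n10|/eqP n30].
  move: dN; rewrite n10 mul0r sub0r => dN; rewrite eqxx /=; apply/orP; right.
  move/eqP: n24; rewrite mulf_eq0 => /orP[/eqP n20|//].
  by move/eqP: dN; rewrite n20 mul0r oppr0 eq_sym oner_eq0.
move: dN; rewrite n30 mulr0 subr0 => dN; rewrite eqxx /=; apply/orP; left.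
move/eqP: n24; rewrite mulf_eq0 => /orP[//|/eqP n40].
by move/eqP: dN; rewrite n40 mulr0 eq_sym oner_eq0.
Qed.

Lemma PT1_norm x g : x \in PT1 -> x != 1%g -> g \in G -> (x ^ g)%g \in PT1 -> g \in PN1.
Proof.
case/imsetP=> M + -> nt Gg; rewrite inE => /andP[/eqP dM PMm].
have nsM := phi_neq1 dM nt; have [N dN <-] := phi_surj Gg.
case/(pred_group_conj predT1N dM dN) => M' [dM' PM' eMN].
rewrite mem_pred_group //; last by move=> ?; apply: predN1N.
(* Equal traces give equal diagonal entries, 2 being invertible. The determinants then give [c' = c]
   or [c' = - c], and these signs correspond to the two cosets making up [predN1]. *)
have trM : \tr M' = \tr M.
  by rewrite -[M'](mulKmx (det_unitmx dN)) -eMN mxtrace_mulC mulmxK ?det_unitmx.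
have tr2 (A : 'M[k]_2) : \tr A = A 0 0 + A 1 1.
  by rewrite /mxtrace !big_ord_recl big_ord0 addr0; congr (_ + A _ _); apply: val_inj.
move: PMm PM' eMN nsM dM dM' trM; rewrite !tr2; elim/mx2_ind: M {nt} => a b c d.
elim/mx2_ind: M' => a' b' c' d'; elim/mx2_ind: N {dN Gg} => n1 n2 n3 n4.
rewrite /predN1 /predT1 !E !mx2_mul !det_mx2 => /andP[/eqP-> /eqP->] /andP[/eqP-> /eqP->].
move=> /mx2_inj[e1 e2 e3 e4] nsM dM dM' trM.
have dd' : d' = d.
  by apply: (mulfI k2); rewrite !mulr_natl !mulr2n.
move: dM' e1 e2 e3 e4; rewrite {}dd' => dM' e1 e2 e3 e4.
have nzc : c != 0 by apply: contra_not_neq (nsM d) => ->; rewrite scalar_mx2 mulr0.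
have /eqP : c' ^+ 2 = c ^+ 2.
  by apply: (mulfI nzD); apply: eq_of_sub_eq (etrans dM (esym dM')) _; ring.
rewrite eqf_sqr => /orP[]/eqP c'E; apply/orP; [left | right].
  apply/andP; split; apply/eqP; apply: (mulfI nzc).
    by apply: eq_of_sub_eq e3 _; rewrite c'E; ring.
  by apply: eq_of_sub_eq (esym e1) _; rewrite c'E; ring.
apply/andP; split; apply/eqP; apply: (mulfI nzc).
  by apply: eq_of_sub_eq e3 _; rewrite c'E; ring.
by apply: eq_of_sub_eq e1 _; rewrite c'E; ring.
Qed.

Lemma PT0_inv x g : x \in PT0 -> g \in PN0 -> g \notin PT0 -> (x ^ g = x^-1)%g.
Proof.
case/imsetP=> M + -> /imsetP[N + ->]; rewrite !inE => /andP[/eqP dM PM] /andP[/eqP dN PN].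
rewrite mem_pred_group //; last by move=> ?; apply: predT0N.
rewrite -(phiV mphi) // => nPN; apply: phi_conj; rewrite ?det_invmx1 //.
apply: (can_inj (mulmxK (det_unitmx dM))); rewrite mulmxKV ?det_unitmx //.
move: PM PN nPN dM {dN}; elim/mx2_ind: M => a b c d; elim/mx2_ind: N => a' b' c' d'.
rewrite /predN0 /predT0 !E => /andP[/eqP-> /eqP->] /orP[->//|/andP[/eqP-> /eqP->] _].
rewrite det_mx2 !mx2_mul !(mulr0, mul0r, addr0, add0r, subr0) => dM.
by congr mx2; rewrite -[RHS]mulr1 -dM; ring.
Qed.

Lemma PT1_inv x g : x \in PT1 -> g \in PN1 -> g \notin PT1 -> (x ^ g = x^-1)%g.
Proof.
case/imsetP=> M + -> /imsetP[N + ->]; rewrite !inE => /andP[/eqP dM PM] /andP[/eqP dN PN].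
rewrite mem_pred_group //; last by move=> ?; apply: predT1N.
rewrite -(phiV mphi) // => nPN; apply: phi_conj; rewrite ?det_invmx1 //.
apply: (can_inj (mulmxK (det_unitmx dM))); rewrite mulmxKV ?det_unitmx //.
move: PM PN nPN dM {dN}; elim/mx2_ind: M => a b c d; elim/mx2_ind: N => a' b' c' d'.
rewrite /predN1 /predT1 !E => /andP[/eqP-> /eqP->] /orP[->//|/andP[/eqP-> /eqP->] _].
rewrite det_mx2 !mx2_mul => dM.
by congr mx2; rewrite -[RHS]mulr1 -dM; ring.
Qed.

Lemma PU_cent x g : x \in PU -> x != 1%g -> g \in G -> commute x g -> g \in PU.
Proof.
move=> Ux nt Gg cxg; have Bg : g \in PB.
  have xg : (x ^ g = x)%g by apply/conjg_fixP/commgP.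
  by apply: (PU_norm_PB Ux nt Gg); rewrite xg.
case/imsetP: Ux nt cxg => M + -> nt; case/imsetP: Bg => N + ->; rewrite !inE.
move=> /andP[/eqP dN PN] /andP[/eqP dM PM].
have nsM := phi_neq1 dM nt; rewrite /commute -!phiM //.
move/(phi_eqP mphi); rewrite !det_mulmx dM dN mulr1 => /(_ erefl erefl)[a a2 eMN].
rewrite mem_pred_group //; last by move=> ?; apply: predUN.
move: PM PN nsM eMN dM dN; elim/mx2_ind: M {nt} => m1 m2 m3 m4; elim/mx2_ind: N => n1 n2 n3 n4.
rewrite /predU /predB !E => /andP[/eqP-> /eqP->] /eqP->.
rewrite !mx2_mul !det_mx2 !(mulr0, mul0r, addr0, add0r, subr0) => nsM.
have -> (x1 x2 x3 x4 : k) : a *: mx2 x1 x2 x3 x4 = mx2 (a * x1) (a * x2) (a * x3) (a * x4).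
  by apply/matrixP=> i j; rewrite !mxE; do 2!case: ifP.
case/mx2_inj=> e1 e2 _ _ dM dN; rewrite eqxx /=.
have nz4 : m4 != 0 by apply: contra_eq_neq dM => ->; rewrite mulr0 eq_sym oner_eq0.
have nz1 : n1 != 0 by apply: contra_eq_neq dN => ->; rewrite mul0r eq_sym oner_eq0.
have a1 : a = 1.
  by apply: (mulIf (_ : n1 * m4 != 0)); rewrite ?mulf_neq0 // mul1r -e1 mulrC.
have nz2 : m2 != 0 by apply: contra_not_neq (nsM m4) => ->; rewrite scalar_mx2.
apply/eqP/(mulfI nz2).
by apply: eq_of_sub_eq (esym e2) _; rewrite a1; ring.
Qed.

Definition upar (b : k) : gT := phi (mx2 1 b 0 1).

Lemma det_upar b : \det (mx2 1 b 0 1 : 'M[k]_2) = 1.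
Proof. by rewrite det_mx2 mulr0 subr0 mulr1. Qed.

Lemma scale_mx2 a (x1 x2 x3 x4 : k) :
  a *: mx2 x1 x2 x3 x4 = mx2 (a * x1) (a * x2) (a * x3) (a * x4).
Proof. by apply/matrixP=> i j; rewrite !mxE; do 2!case: ifP. Qed.

Lemma upar_inj : injective upar.
Proof.
move=> b b' /(phi_eqP mphi (det_upar b) (det_upar b'))[a _].
by rewrite scale_mx2 => /mx2_inj[a1 -> _ _]; rewrite -[a]mulr1 -a1 mul1r.
Qed.

Lemma uparD b c : upar (b + c) = (upar b * upar c)%g.
Proof.
rewrite /upar -phiM ?det_upar // mx2_mul; congr (phi (mx2 _ _ _ _));
  by rewrite !(mulr0, mul0r, mulr1, mul1r, addr0, add0r) // addrC.
Qed.

Lemma PU_upar : PU = [set upar b | b : k] :> {set gT}.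
Proof.
apply/setP=> x; apply/imsetP/imsetP=> [[M + ->]|[b _ ->]]; last first.
  by exists (mx2 1 b 0 1) => //; rewrite inE det_upar /predU !E !eqxx.
elim/mx2_ind: M => a b c d; rewrite inE /predU !E => /and3P[/eqP dM /eqP c0 /eqP ad].
exists (b / a) => //; move: dM; rewrite {}c0 -{}ad det_mx2 mulr0 subr0 => aa.
have nza : a != 0 by apply: contra_eq_neq aa => ->; rewrite mul0r eq_sym oner_eq0.
apply/(phi_eqP mphi) => //; first by rewrite det_mx2 mulr0 subr0.
  exact: det_upar.
exists a; first by rewrite expr2.
by rewrite scale_mx2; congr mx2; rewrite ?mulr1 ?mulr0 // mulrC divfK.
Qed.

Lemma upar_conj g : g \in PB -> exists2 a, a != 0 & forall b, (upar b ^ g)%g = upar (a ^+ 2 * b).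
Proof.
case/imsetP=> N + ->; elim/mx2_ind: N => n1 n2 n3 n4.
rewrite inE /predB !E => /andP[/eqP dN /eqP n30]; exists n4.
  by apply: contra_eq_neq dN => ->; rewrite det_mx2 n30 !mulr0 subr0 eq_sym oner_eq0.
move=> b; apply: phi_conj; rewrite ?det_upar //.
move: dN; rewrite n30 det_mx2 mulr0 subr0 => dN.
rewrite !mx2_mul !(mulr0, mul0r, mulr1, mul1r, addr0, add0r); congr mx2.
by rewrite mulrA expr2 mulrA dN mul1r addrC mulrC.
Qed.

Lemma card_PT0 : (#|PT0| * 2).+1 = #|k|.
Proof.
rewrite card_pred_group //; last by move=> ?; apply: predT0N.
have -> : pred_set predT0 = [set mx2 a 0 0 a^-1 | a in [set~ 0]].
  apply/setP=> M; apply/idP/imsetP=> [|[a]]; last first.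
    by rewrite !inE => nza ->; rewrite det_mx2 mulr0 subr0 mulfV // /predT0 !E !eqxx.
  elim/mx2_ind: M => a b c d; rewrite inE /predT0 !E => /and3P[/eqP dM /eqP c0 /eqP b0].
  move: dM; rewrite c0 b0 det_mx2 mulr0 subr0 => ad.
  have nza : a != 0 by apply: contra_eq_neq ad => ->; rewrite mul0r eq_sym oner_eq0.
  exists a; first by rewrite !inE.
  by congr mx2; apply: (mulfI nza); rewrite ad mulfV.
rewrite card_imset ?cardsC1 ?prednK //; first by rewrite ltnW ?finNzRing_gt1.
by move=> a b /mx2_inj[].
Qed.

(** Rational parametrization of the norm 1 conic from its point -1, with parameter [c / (1 + a)]:
    the other points correspond to [k], so there are q + 1 matrices. *)
Lemma card_PT1 : (#|PT1| * 2 = #|k|.+1)%N.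
Proof.
rewrite card_pred_group //; last by move=> ?; apply: predT1N.
rewrite (cardsD1 (- 1%:M)) [X in (X + _)%N = _](_ : _ = 1%N); last first.
  rewrite inE predT1N ?predT11 // -scaleN1r detZ det1 mulr1 sqrrN expr1n.
  by rewrite eqxx.
rewrite add1n; congr _.+1.
pose f s := mx2 ((1 + D * s ^+ 2) / (1 - D * s ^+ 2)) (D * (2%:R * s / (1 - D * s ^+ 2)))
  (2%:R * s / (1 - D * s ^+ 2)) ((1 + D * s ^+ 2) / (1 - D * s ^+ 2)).
have nzs s : 1 - D * s ^+ 2 != 0.
  apply/eqP=> e; have [|/eqP] := @norm_form_neq0 k k2 D 1 s DN1; first by rewrite expr1n.
  by rewrite oner_eq0.
have -> : pred_set predT1 :\ (- 1%:M) = f @: [set: k].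
  apply/setP=> M; apply/idP/imsetP=> [|[s _ ->]]; last first.
    have nz := nzs s; rewrite in_setD1 inE det_mx2 /predT1 !E !eqxx !andbT.
    apply/andP; split; last by apply/eqP; field.
    rewrite scalar_mx2 mx2N oppr0; apply: contra k2 => /eqP/mx2_inj[_ _ e3 e4].
    have s0 : s = 0.
      move/eqP: e3; rewrite mulf_eq0 invr_eq0 (negPf nz) orbF mulf_eq0 (negPf k2).
      by move/eqP.
    move: e4; rewrite s0 expr0n /= mulr0 subr0 addr0 divr1 => e4.
    by rewrite mulr2n {1}e4 addNr.
  rewrite in_setD1; elim/mx2_ind: M => a b c d; rewrite inE /predT1 !E scalar_mx2 mx2N.
  case/andP=> n1 /and3P[/eqP dM /eqP ad /eqP bc]; move: dM n1; rewrite {}bc -{}ad det_mx2 => dM n1.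
  have nza : 1 + a != 0.
    apply: contra n1; rewrite addrC addr_eq0 => /eqP a1; move: dM; rewrite a1 => dM.
    have c0 : c = 0.
      have : D * c ^+ 2 = 0 by apply: eq_of_sub_eq (esym dM) _; ring.
      by move/eqP; rewrite mulf_eq0 (negPf nzD) expf_eq0 => /eqP.
    by rewrite c0 mulr0 oppr0.
  exists (c / (1 + a)) => //.
  have e : 1 - D * (c / (1 + a)) ^+ 2 = 2%:R / (1 + a).
    have -> : 1 - D * (c / (1 + a)) ^+ 2 = (1 + 2%:R * a + (a * a - D * c * c)) / (1 + a) ^+ 2.
      by field.
    by rewrite dM; field.
  have e' : 1 + D * (c / (1 + a)) ^+ 2 = 2%:R * a / (1 + a).
    have -> : 1 + D * (c / (1 + a)) ^+ 2 = (1 + 2%:R * a + 2%:R * (a * a) - (a * a - D * c *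
      c)) / (1 + a) ^+ 2.
      by field.
    by rewrite dM; field.
  by rewrite /f e e'; congr mx2; field; rewrite nza k2.
rewrite card_imset ?cardsT // => s t /mx2_inj[e1 _ e3 _].
have inv x : 1 + (1 + D * x ^+ 2) / (1 - D * x ^+ 2) = 2%:R / (1 - D * x ^+ 2).
  by have nz := nzs x; field.
have e5 : (1 - D * s ^+ 2)^-1 = (1 - D * t ^+ 2)^-1.
  by apply: (mulfI k2); rewrite -inv -[RHS]inv e1.
move: e3; rewrite e5 => /(mulIf _) -/(_ (invr_neq0 (nzs t))).
by move/(mulfI k2).
Qed.

Lemma card_index2 (X N : {group gT}) w : X \subset N -> w \in N -> w \notin X ->
  (forall n, n \in N -> n \notin X -> (n * w^-1)%g \in X) -> (#|N| = #|X| * 2)%N.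
Proof.
move=> sXN Nw nXw Xn; rewrite -(cardsID X N) (setIidPr sXN) muln2 -addnn; congr addn.
rewrite -(card_rcoset X w); apply: eq_card => n; rewrite in_setD mem_rcoset.
apply/andP/idP=> [[nX Nn]|Xnw]; first exact: Xn.
rewrite -(mulgKV w n) groupMl // nXw; split=> //.
by rewrite groupM // (subsetP sXN).
Qed.

Lemma card_PN0 : (#|PN0| = #|PT0| * 2)%N.
Proof.
have dw : \det (mx2 0 1 (-1) 0 : 'M[k]_2) = 1 by rewrite det_mx2; ring.
have memN0 M : \det M = 1 -> (phi M \in PN0) = predN0 M.
  by apply: mem_pred_group => ?; apply: predN0N.
have memT0 M : \det M = 1 -> (phi M \in PT0) = predT0 M.
  by apply: mem_pred_group => ?; apply: predT0N.
apply: (@card_index2 _ _ (phi (mx2 0 1 (-1) 0))).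
- exact: PT0_sub_PN0.
- by rewrite memN0 // /predN0 !E !eqxx orbT.
- by rewrite memT0 // /predT0 !E oppr_eq0 oner_eq0.
move=> _ /imsetP[M + ->]; rewrite inE => /andP[/eqP dM PM]; rewrite memT0 // => nPM.
rewrite -(phiV mphi) // -phiM ?det_invmx1 // memT0 ?det_mulmx ?dM ?det_invmx1 ?mulr1 //.
have -> : invmx (mx2 0 1 (-1) 0) = mx2 0 (-1) 1 0 :> 'M[k]_2.
  apply: (can_inj (mulmxK (det_unitmx dw))); rewrite mulVmx ?det_unitmx // mx2_mul scalar_mx2.
  by congr mx2; ring.
move: PM nPM {dM}; elim/mx2_ind: M => a b c d; rewrite /predN0 /predT0 mx2_mul !E.
case/orP=> [->//|/andP[/eqP-> /eqP->] _].
by rewrite !(mulr0, mul0r, addr0, add0r) !eqxx.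
Qed.

Lemma card_PN1 : (#|PN1| = #|PT1| * 2)%N.
Proof.
have [al [be dJ]] := norm_form_surjN1 k2 nzD.
pose J := mx2 al (- (D * be)) be (- al).
have dw : \det J = 1 by rewrite -dJ det_mx2; ring.
have memN1 M : \det M = 1 -> (phi M \in PN1) = predN1 M.
  by apply: mem_pred_group => ?; apply: predN1N.
have memT1 M : \det M = 1 -> (phi M \in PT1) = predT1 M.
  by apply: mem_pred_group => ?; apply: predT1N.
apply: (@card_index2 _ _ (phi J)).
- exact: PT1_sub_PN1.
- by rewrite memN1 // /predN1 !E opprK !eqxx orbT.
- rewrite memT1 // /predT1 !E; apply/negP=> /andP[/eqP ala /eqP beb].
  have al0 : al = 0.
    apply: (mulfI k2); rewrite mulr0 mulr_natl mulr2n {2}ala subrr //.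
  have be0 : be = 0.
    apply: (mulfI k2); apply: (mulfI nzD); rewrite !mulr0.
    by apply: eq_of_sub_eq (esym beb) _; ring.
  by move/eqP: dJ; rewrite al0 be0 expr0n mulr0 oppr0 addr0 eq_sym oner_eq0.
move=> _ /imsetP[M + ->]; rewrite inE => /andP[/eqP dM PM]; rewrite memT1 // => nPM.
rewrite -(phiV mphi) // -phiM ?det_invmx1 // memT1 ?det_mulmx ?dM ?det_invmx1 ?mulr1 //.
have -> : invmx J = - J.
  apply: (can_inj (mulmxK (det_unitmx dw))); rewrite mulVmx ?det_unitmx // mx2N mx2_mul.
  by rewrite scalar_mx2 -dJ; congr mx2; ring.
move: PM nPM {dM}; elim/mx2_ind: M => a b c d; rewrite /predN1 /predT1 mx2N mx2_mul !E.
case/orP=> [->//|/andP[/eqP-> /eqP->] _].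
by apply/andP; split; apply/eqP; ring.
Qed.

Lemma card_PB : (#|PB| = #|k| * #|PT0|)%N.
Proof.
have cardU : #|PU| = #|k| by rewrite PU_upar card_imset //; apply: upar_inj.
have memU M : \det M = 1 -> (phi M \in PU) = predU M.
  by apply: mem_pred_group => ?; apply: predUN.
have -> : PB = (PU * PT0)%g :> {set gT}.
  apply/eqP; rewrite eqEsubset mul_subG ?PU_sub_PB ?PT0_sub_PB // andbT.
  apply/subsetP=> _ /imsetP[M + ->]; elim/mx2_ind: M => a b c d.
  rewrite inE /predB !E => /andP[/eqP dM /eqP c0]; move: dM; rewrite {}c0 det_mx2 mulr0 subr0 => ad.
  have nzd : d != 0 by apply: contra_eq_neq ad => ->; rewrite mulr0 eq_sym oner_eq0.
  have dd : \det (mx2 a 0 0 d) = 1 by rewrite det_mx2 mulr0 subr0.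
  have -> : mx2 a b 0 d = mx2 1 (b / d) 0 1 *m mx2 a 0 0 d.
    rewrite mx2_mul !(mulr0, mul0r, mulr1, mul1r, addr0, add0r) //.
    by rewrite divfK.
  rewrite phiM ?det_upar //; apply: mem_mulg.
    by rewrite PU_upar; apply/imsetP; exists (b / d).
  by rewrite mem_pred_group => // [|?]; [rewrite /predT0 !E !eqxx | apply: predT0N].
rewrite TI_cardMg ?cardU //; apply/trivgP/subsetP=> x /setIP[/imsetP[M + ->]].
rewrite inE => /andP[/eqP dM PM]; rewrite mem_pred_group //; last by move=> ?; apply: predT0N.
move: PM dM; elim/mx2_ind: M => a b c d; rewrite /predT0 /predU !E.
move=> /andP[_ /eqP->] dM /andP[/eqP c0 /eqP b0]; move: dM; rewrite b0 c0 => dM.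
by rewrite inE; apply/eqP; case: mphi => _ _ _ ker; apply/ker => //; exists d; rewrite scalar_mx2.
Qed.

(** Bruhat decomposition: an element outside [PB] is uniquely a product of an element of [PB], the
    Weyl element [w] and some [upar y]. *)
Lemma card_G_PB : (#|G| = #|PB| * #|k|.+1)%N.
Proof.
have dw : \det (mx2 0 1 (-1) 0 : 'M[k]_2) = 1 by rewrite det_mx2; ring.
have memB M : \det M = 1 -> (phi M \in PB) = predB M.
  by apply: mem_pred_group => ?; apply: predBN.
have sBG : PB \subset G by apply: pred_group_sub.
rewrite mulnS -(cardsID PB G) (setIidPr sBG); congr addn.
pose w := phi (mx2 0 1 (-1) 0).
pose f (z : gT * k) := (z.1 * (w * upar z.2))%g.
have dwu y : \det (mx2 0 1 (-1) 0 *m mx2 1 y 0 1 : 'M[k]_2) = 1.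
  by rewrite det_mulmx dw det_upar mulr1.
have fE M y : \det M = 1 -> f (phi M, y) = phi (M *m (mx2 0 1 (-1) 0 *m mx2 1 y 0 1)).
  by move=> dM; rewrite /f /w /upar -!phiM ?det_upar.
have -> : G :\: PB = f @: setX PB [set: k].
  apply/setP=> g; apply/setDP/imsetP=> [[Gg]|[[_ y] /setXP[/imsetP[M + ->] _] ->]]; last first.
    elim/mx2_ind: M => a b c d; rewrite inE /predB !E => /andP[/eqP dM /eqP c0]; rewrite fE //.
    rewrite phiG ?memB ?det_mulmx ?dM ?dw ?det_upar ?mulr1 //; split=> //.
    rewrite /predB !mx2_mul !E c0 !(mulr0, mul0r, mulr1, addr0, add0r, mulrN1) oppr_eq0.
    apply: contra_eq_neq dM => ->; rewrite det_mx2 c0 !mulr0 subr0 eq_sym oner_eq0 //.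
  have [M dM <-] := phi_surj Gg; rewrite memB //; move: dM; elim/mx2_ind: M => a b c d.
  rewrite /predB !E => dM nzc; exists (phi (mx2 (- c^-1) (- a) 0 (- c)), d / c).
    rewrite in_setX inE andbT memB ?/predB ?E //.
    by rewrite det_mx2 mulr0 subr0 mulrNN mulVf.
  rewrite fE; last by rewrite det_mx2 mulr0 subr0 mulrNN mulVf.
  congr phi; rewrite !mx2_mul; move: dM; rewrite det_mx2 => dM.
  congr mx2; try by field.
  by apply: (mulfI nzc); apply: eq_of_sub_eq (esym dM) _; field.
rewrite card_in_imset ?cardsX ?cardsT // => -[b y] [b' y'] /setXP[Bb _] /setXP[Bb' _].
rewrite /f /= => e.
have Bw : (w * upar (y - y') * w^-1)%g \in PB.
  have -> : (w * upar (y - y') * w^-1 = b^-1 * b')%g.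
    apply: (mulgI b); rewrite mulKVg; apply: (mulIg (w * upar y')%g).
    by rewrite -e !mulgA mulgKV -[LHS]mulgA -uparD subrK.
  by rewrite groupM ?groupV.
have yy' : y = y'.
  have := det_invmx1 dw => dV; have := dwu (y - y') => dWU.
  move: Bw; rewrite /w /upar -(phiV mphi dw) -(phiM dw (det_upar _)) -(phiM dWU dV).
  rewrite memB; last by rewrite det_mulmx dWU dV mulr1.
  have -> : invmx (mx2 0 1 (-1) 0) = mx2 0 (-1) 1 0 :> 'M[k]_2.
    apply: (can_inj (mulmxK (det_unitmx dw))); rewrite mulVmx ?det_unitmx // mx2_mul scalar_mx2.
    by congr mx2; ring.
  rewrite /predB !mx2_mul !E !(mulr0, mul0r, mulr1, mul1r, addr0, add0r, mulN1r).
  by rewrite oppr_eq0 subr_eq0 => /eqP.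
by move: e; rewrite yy' => /mulIg->.
Qed.

Lemma psl2_structureP : psl2_structure G PU PB PT0 PN0 PT1 PN1 upar.
Proof.
have cardT0 := card_PT0; have cardT1 := card_PT1; have cardB := card_PB.
split; rewrite ?pred_group_sub //.
- exact: PT0_sub_PB.
- exact: PT0_sub_PN0.
- exact: PT1_sub_PN1.
- exact: PT0_abelian.
- exact: PT1_abelian.
- exact: card_PN0.
- exact: card_PN1.
- exact: card_G_PB.
- exact: upar_inj.
- exact: uparD.
- exact: PU_upar.
- exact: PU_sub_PB.
- exact: upar_conj.
- exact: PU_norm_PB.
- exact: PT0_norm.
- exact: PT1_norm.
- exact: PU_cent.
- exact: PT0_inv.
exact: PT1_inv.
Qed.

End OddStructure.

(** * Conjugacy classes and fixed cosets in PSL(2, q), q odd *)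

Section StructureConsequences.

Variables (k : finFieldType) (gT : finGroupType) (G U B T0 N0 T1 N1 : {group gT}).
Variable u : k -> gT.
Hypothesis ps : psl2_structure G U B T0 N0 T1 N1 u.

Let sBG := ps_sBG ps.
Let sUB := ps_sUB ps.
Let sUG : U \subset G. Proof. exact: subset_trans sUB sBG. Qed.
Let sT0B := ps_sT0B ps.
Let sT0G : T0 \subset G. Proof. exact: subset_trans sT0B sBG. Qed.
Let sN0G := ps_sN0G ps.
Let sN1G := ps_sN1G ps.
Let sT1G : T1 \subset G. Proof. exact: subset_trans (ps_sT1N1 ps) sN1G. Qed.

Lemma card_U : #|U| = #|k|.
Proof. by rewrite (ps_U ps) card_imset //; apply: ps_u_inj ps. Qed.

Lemma card_q : #|k| = (#|T0| * 2).+1. Proof. by rewrite (ps_cardT0 ps). Qed.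

Lemma card_T1 : #|T1| = #|T0|.+1.
Proof. by have := ps_cardT1 ps; rewrite card_q; lia. Qed.

Lemma coprime_q_T0 : coprime #|k| #|T0|.
Proof.
by rewrite card_q; apply: coprime_dvdr (dvdn_mulr 2 (dvdnn _)) (coprimeSn _).
Qed.

Lemma coprime_q_T1 : coprime #|k| #|T1|.
Proof.
have dvd : (#|T1| %| #|k|.+1)%N by rewrite -(ps_cardT1 ps) dvdn_mulr.
exact: coprime_dvdr dvd (coprimenS _).
Qed.

Lemma coprime_T0_T1 : coprime #|T0| #|T1|.
Proof. by rewrite card_T1 coprimenS. Qed.

Lemma order_dvd (X : {group gT}) x : x \in X -> (x ^+ #|X| = 1)%g.
Proof. by move=> Xx; apply/eqP; rewrite -order_dvdn order_dvdG. Qed.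

Lemma coprime_expg_eq1 m n (x : gT) : coprime m n -> (x ^+ m = 1)%g -> (x ^+ n = 1)%g -> x = 1%g.
Proof.
move=> co /eqP; rewrite -order_dvdn => dm /eqP; rewrite -order_dvdn => dn.
by apply/eqP; rewrite -order_eq1 -dvdn1 -(eqP co) dvdn_gcd dm dn.
Qed.

Lemma expg_eq1J n (x g : gT) : ((x ^ g) ^+ n == 1)%g = (x ^+ n == 1)%g.
Proof. by rewrite -conjXg conjg_eq1. Qed.

Lemma ti_U_T0 : U :&: T0 = 1%g.
Proof.
apply/trivgP/subsetP=> x /setIP[Ux Tx]; rewrite inE; apply/eqP.
apply: coprime_expg_eq1 coprime_q_T0 _ (order_dvd Tx).
by rewrite -card_U order_dvd.
Qed.

Lemma norm_U_B : B \subset 'N(U).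
Proof.
apply/subsetP=> g Bg; rewrite inE; apply/subsetP=> _ /imsetP[x Ux ->].
have [a _ ua] := ps_uJ ps Bg; rewrite (ps_U ps) in Ux *.
by case/imsetP: Ux => b _ ->; rewrite ua imset_f.
Qed.

Lemma memJ_U x g : x \in U -> x != 1%g -> g \in G -> ((x ^ g)%g \in U) = (g \in B).
Proof.
move=> Ux nt Gg; apply/idP/idP=> [|Bg]; first exact: ps_tiU ps _ _ Ux nt Gg.
by rewrite memJ_norm // (subsetP norm_U_B).
Qed.

Lemma memJ_sub_T0 (M : {group gT}) x g : M \subset T0 -> x \in M -> x != 1%g -> g \in G ->
  ((x ^ g)%g \in M) = (g \in N0).
Proof.
move=> sMT Mx nt Gg; have T0x := subsetP sMT x Mx; apply/idP/idP=> [Mxg|Ng].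
  exact: (ps_tiT0 ps T0x nt Gg (subsetP sMT _ Mxg)).
have [Tg|nTg] := boolP (g \in T0).
  rewrite (_ : x ^ g = x)%g //; apply/conjg_fixP/commgP.
  exact: (centsP (ps_abT0 ps)).
by rewrite (ps_invT0 ps T0x Ng nTg) groupV.
Qed.

Lemma memJ_sub_T1 (M : {group gT}) x g : M \subset T1 -> x \in M -> x != 1%g -> g \in G ->
  ((x ^ g)%g \in M) = (g \in N1).
Proof.
move=> sMT Mx nt Gg; have T1x := subsetP sMT x Mx; apply/idP/idP=> [Mxg|Ng].
  exact: (ps_tiT1 ps T1x nt Gg (subsetP sMT _ Mxg)).
have [Tg|nTg] := boolP (g \in T1).
  rewrite (_ : x ^ g = x)%g //; apply/conjg_fixP/commgP.
  exact: (centsP (ps_abT1 ps)).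
by rewrite (ps_invT1 ps T1x Ng nTg) groupV.
Qed.

Lemma card_class_support_TI (X L : {group gT}) : L \subset G ->
    (forall x g, x \in X -> x != 1%g -> g \in G -> ((x ^ g)%g \in X) = (g \in L)) ->
  #|class_support X^# G| = (#|X|.-1 * #|G : L|)%N.
Proof.
(* TI sets are required to be nonempty, while a torus can be trivial, as [T0] for q = 3. *)
move=> sLG memJ; have [X1|ntX] := eqVneq (X^#) set0.
  have -> : class_support X^# G = set0.
    by apply/eqP; rewrite -subset0; apply/subsetP=> y /imset2P[z g]; rewrite X1 inE.
  by rewrite (cardsD1 1%g X) group1 X1 !cards0.
rewrite (@card_support_normedTI _ _ _ L); first by rewrite (cardsD1 1%g X) group1.
apply/normedTI_memJ_P; split=> // x g /setD1P[nt Xx] Gg.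
by rewrite in_setD1 conjg_eq1 nt /= memJ.
Qed.

Definition conj_into (X : {group gT}) (x : gT) := exists2 g, g \in G & (x ^ g)%g \in X.

Lemma class_supportP (X : {group gT}) x :
  reflect (x != 1%g /\ conj_into X x) (x \in class_support X^# G).
Proof.
apply: (iffP imset2P) => [[y g /setD1P[nt Xy] Gg ->]|[nt [g Gg Xxg]]].
  by rewrite conjg_eq1; split=> //; exists g^-1%g; rewrite ?groupV // conjgK.
by exists (x ^ g)%g g^-1%g; rewrite ?groupV ?conjgK // in_setD1 conjg_eq1 nt.
Qed.

(** A count: the three class supports are disjoint because the orders of [U], [T0] and [T1] are
    coprime, and by the TI property their sizes, plus 1 for the identity, add up to [#|G|]. *)
Lemma psl2_cover x : x \in G -> x != 1%g ->
  [\/ conj_into U x, conj_into T0 x | conj_into T1 x].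
Proof.
set CU := class_support U^# G; set C0 := class_support T0^# G; set C1 := class_support T1^# G.
have cU := card_class_support_TI sBG memJ_U; rewrite -/CU in cU.
have c0 := card_class_support_TI sN0G (fun x g => @memJ_sub_T0 T0 x g (subxx _)).
have c1 := card_class_support_TI sN1G (fun x g => @memJ_sub_T1 T1 x g (subxx _)).
rewrite -/C0 in c0; rewrite -/C1 in c1.
have sCG (X : {group gT}) : X \subset G -> class_support X^# G \subset G.
  by move=> sXG; apply: class_support_sub_norm; rewrite ?normG // (subset_trans (subD1set _ _)).
have disj (X Y : {group gT}) : coprime #|X| #|Y| ->
    class_support X^# G :&: class_support Y^# G = set0.
  move=> co; apply/setP=> y; rewrite in_setI in_set0; apply/negP.
  case/andP=> /class_supportP[nt [g _ Xy]] /class_supportP[_ [h _ Yy]].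
  case/eqP: nt; apply: coprime_expg_eq1 co _ _; apply/eqP.
    by rewrite -(expg_eq1J _ _ g) order_dvd.
  by rewrite -(expg_eq1J _ _ h) order_dvd.
have n1 (X : {group gT}) : class_support X^# G :&: [set 1%g] = set0.
  apply/setP=> y; rewrite in_setI in_set1 in_set0; apply/negP.
  by case/andP=> /class_supportP[/negPf-> _].
have defG : [set 1%g] :|: (CU :|: (C0 :|: C1)) = G.
  apply/eqP; rewrite eqEcard !subUset sub1set group1 !sCG //=.
  have tU0 : CU :&: C0 = set0 by apply: disj; rewrite card_U coprime_q_T0.
  have tU1 : CU :&: C1 = set0 by apply: disj; rewrite card_U coprime_q_T1.
  have t01 : C0 :&: C1 = set0 by apply: disj; rewrite coprime_T0_T1.
  rewrite !cardsU !setIUr tU0 tU1 t01 ![[set 1%g] :&: _]setIC !n1 !setU0 !cards0 cards1 !subn0.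
  rewrite cU c0 c1 card_U.
  have iB : #|G : B| = #|k|.+1 by rewrite -divgS // (ps_cardG ps) mulKn.
  have iN0 : #|G : N0| = (#|k| * #|T1|)%N.
    apply/eqP; rewrite -(eqn_pmul2l (cardG_gt0 N0)) Lagrange //; apply/eqP.
    by rewrite (ps_cardG ps) (ps_cardB ps) (ps_cardN0 ps) -(ps_cardT1 ps); ring.
  have iN1 : #|G : N1| = (#|k| * #|T0|)%N.
    apply/eqP; rewrite -(eqn_pmul2l (cardG_gt0 N1)) Lagrange //; apply/eqP.
    by rewrite (ps_cardG ps) (ps_cardB ps) (ps_cardN1 ps) -(ps_cardT1 ps); ring.
  rewrite iB iN0 iN1 (ps_cardG ps) (ps_cardB ps) card_T1 card_q /=.
  have := cardG_gt0 T0; case: #|T0| => // t _.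
  by rewrite leq_eqVlt; apply/orP; left; apply/eqP; rewrite /=; ring.
move=> Gx nt; move: Gx; rewrite -defG !inE (negPf nt) /=.
case/or3P=> /class_supportP[_ ?]; [exact: Or31 | exact: Or32 | exact: Or33].
Qed.

Lemma fix_cosets1 (X : {group gT}) : X \subset G -> fix_cosets G X 1 = #|G : X|.
Proof.
move=> sXG; rewrite /fix_cosets; apply: eq_card => A.
by rewrite inE rcoset1 eqxx andbT.
Qed.

Lemma fix_cosets_conj_none (X : {group gT}) x : X \subset G -> ~ conj_into X x ->
  fix_cosets G X x = 0%N.
Proof.
move=> sXG nX; apply/eqP; rewrite -(eqn_pmul2r (cardG_gt0 X)) card_fix_cosets // mul0n.
rewrite cards_eq0 -subset0; apply/subsetP=> y; rewrite inE => /andP[Gy Xy].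
by case: nX; exists y.
Qed.

Lemma card_conj_into_TI (X L : {group gT}) x : L \subset G ->
    (forall x g, x \in X -> x != 1%g -> g \in G -> ((x ^ g)%g \in X) = (g \in L)) ->
  x != 1%g -> conj_into X x -> #|[set y in G | (x ^ y)%g \in X]| = #|L|.
Proof.
move=> sLG memJ nt [g Gg Xxg]; rewrite -(card_lcoset L g); apply: eq_card => y.
rewrite inE mem_lcoset; case: (boolP (y \in G)) => [Gy|nGy] /=; last first.
  by apply/esym/negP=> /(subsetP sLG); rewrite groupMl ?groupV // (negPf nGy).
have -> : (x ^ y = (x ^ g) ^ (g^-1 * y))%g by rewrite -conjgM mulKVg.
by rewrite (memJ _ _ Xxg) ?conjg_eq1 // groupM ?groupV.
Qed.

Lemma cent_U_T0 x t : x \in U -> t \in T0 -> t != 1%g -> commute x t -> x = 1%g.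
Proof.
move=> Ux Tt nt cxt; apply: contraNeq nt => ntx; apply/eqP/set1gP.
rewrite -ti_U_T0 inE Tt andbT; apply: (ps_cU ps Ux ntx) => //.
exact: (subsetP sT0G).
Qed.

Section BorelSubgroup.

Variable S : {group gT}.
Hypothesis sST : S \subset T0.

Let nUS : S \subset 'N(U). Proof. exact: subset_trans (subset_trans sST sT0B) norm_U_B. Qed.

Lemma joing_U_sub : U <*> S \subset B.
Proof. by rewrite join_subG sUB (subset_trans sST). Qed.

Let tiUS : U :&: S = 1%g.
Proof. by apply/trivgP; rewrite -ti_U_T0 setIS. Qed.

Lemma card_joing_U : #|U <*> S| = (#|k| * #|S|)%N.
Proof. by rewrite norm_joinEr // TI_cardMg // card_U. Qed.

(* [U] permutes regularly the conjugates of [t] in the coset [U t]. *)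
Lemma card_conj_S w : w \in G -> (w ^+ #|k| != 1)%g ->
  #|[set v in U | (w ^ v)%g \in S]| = (w \in U <*> S) :> nat.
Proof.
move=> Gw nUw; have [USw|nUSw] := boolP (w \in U <*> S); last first.
  apply/eqP; rewrite cards_eq0 -subset0; apply/subsetP=> v; rewrite inE => /andP[Uv Sv].
  case/negP: nUSw; rewrite -(conjgK v w).
  apply: groupJ; first exact: (subsetP (joing_subr U S)).
  by rewrite groupV; apply: (subsetP (joing_subl U S)).
move: USw; rewrite norm_joinEr // => /mulsgP[v0 t Uv0 St defw].
have Tt := subsetP sST t St.
have nt : t != 1%g.
  apply: contra nUw => /eqP t1; rewrite defw t1 mulg1 -card_U; apply/eqP.
  exact: order_dvd.
have injf : {in U &, injective (fun v => (t ^ v * t^-1)%g)}.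
  move=> v v' Uv Uv' /= /mulIg e.
  have: (v * v'^-1)%g = 1%g; last by move/eqP; rewrite -eq_mulgV1 => /eqP.
  apply: (cent_U_T0 _ Tt nt); first by rewrite groupM ?groupV.
  apply/commute_sym/commgP/conjg_fixP.
  by rewrite conjgM e conjgK.
have imf : [set (t ^ v * t^-1)%g | v in U] = U.
  apply/eqP; rewrite eqEcard (card_in_imset injf) leqnn andbT.
  apply/subsetP=> _ /imsetP[v Uv ->].
  rewrite conjgE -!mulgA groupM ?groupV //.
  have -> : (t * (v * t^-1) = v ^ t^-1)%g by rewrite conjgE invgK mulgA.
  by rewrite memJ_norm // groupV (subsetP nUS).
have [v1 Uv1 defw'] : exists2 v1, v1 \in U & w = (t ^ v1)%g.
  have /imsetP[v1 Uv1 e] : v0 \in [set (t ^ v * t^-1)%g | v in U] by rewrite imf.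
  by exists v1; rewrite // e mulgKV in defw *.
transitivity #|[set v1^-1%g]|; last by rewrite cards1.
apply: eq_card => v; rewrite !inE; apply/andP/eqP=> [[Uv Sv]|->]; last first.
  by rewrite groupV defw' conjgK.
have Uz : (v1 * v)%g \in U by rewrite groupM.
rewrite defw' -conjgM in Sv.
have : (t ^ (v1 * v) * t^-1)%g \in U :&: S.
  have := imset_f (fun v => (t ^ v * t^-1)%g) Uz; rewrite imf inE => -> /=.
  by rewrite groupM ?groupV.
rewrite tiUS => /set1gP/eqP; rewrite -eq_mulgV1 => /eqP/conjg_fixP/commgP cz.
have := cent_U_T0 Uz Tt nt (commute_sym cz).
by move/eqP; rewrite -eq_invg_mul => /eqP <-.
Qed.

(** A nontrivial [x] with [x^q = 1] is conjugate into [U] but not into [S], and meets [U <*> S] only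
    in [U]. For other [x], each conjugate lying in [U <*> S] is brought into [S] by exactly one
    element of [U], so only the fixed cosets of [S] count. *)
Lemma fix_cosets_joing_U x : x \in G -> x != 1%g ->
  fix_cosets G (U <*> S) x = (#|T0 : S| * (x ^+ #|k| == 1)%g + fix_cosets G S x)%N.
Proof.
move=> Gx nt; have sJB := joing_U_sub; have sJG := subset_trans sJB sBG.
have sSG : S \subset G := subset_trans sST sT0G.
apply/eqP; rewrite -(eqn_pmul2r (cardG_gt0 (U <*> S))) card_fix_cosets //.
have [xq|nxq] := boolP (x ^+ #|k| == 1)%g.
  have nSx : ~ conj_into S x.
    case=> g _ Sg; case/eqP: nt; apply: coprime_expg_eq1 coprime_q_T0 (eqP xq) _.
    by apply/eqP; rewrite -(expg_eq1J _ _ g) order_dvd // (subsetP sST).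
  rewrite (fix_cosets_conj_none sSG nSx) addn0 muln1 card_joing_U.
  have Ux : conj_into U x.
    have [//| [g _ Tg] | [g _ Tg]] := psl2_cover Gx nt; case/eqP: nt.
      apply: coprime_expg_eq1 coprime_q_T0 (eqP xq) _.
      by apply/eqP; rewrite -(expg_eq1J _ _ g) order_dvd.
    apply: coprime_expg_eq1 coprime_q_T1 (eqP xq) _.
    by apply/eqP; rewrite -(expg_eq1J _ _ g) order_dvd.
  have -> : [set y in G | (x ^ y)%g \in U <*> S] = [set y in G | (x ^ y)%g \in U].
    apply/setP=> y; rewrite !inE; congr (_ && _); apply/idP/idP=> [|Uy]; last first.
      exact: (subsetP (joing_subl U S)).
    rewrite norm_joinEr // => /mulsgP[v t Uv St exy].
    suff t1 : t = 1%g by rewrite exy t1 mulg1.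
    apply: (coprime_expg_eq1 coprime_q_T0 _ (order_dvd (subsetP sST t St))).
    apply/set1gP; rewrite -tiUS inE (groupX _ St) andbT.
    have nUt := subsetP nUS t St; have nUv := subsetP (normG U) v Uv.
    apply: coset_idr; first by rewrite groupX.
    have : coset U ((x ^ y) ^+ #|k|) = 1%g by rewrite -conjXg (eqP xq) conj1g morph1.
    have e1 : coset U (v * t) = coset U t.
      by rewrite morphM //= coset_id // mul1g.
    by rewrite exy !morphX ?groupM //= e1.
  rewrite (card_conj_into_TI sBG memJ_U nt Ux) (ps_cardB ps) -(Lagrange sST).
  by apply/eqP; ring.
rewrite muln0 add0n card_joing_U mulnCA card_fix_cosets // -card_U.
apply/eqP; transitivity (\sum_(v in U) \sum_(y in G) ((x ^ (y * v))%g \in S))%N.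
  rewrite exchange_big /= -sum1_card big_mkcond [RHS]big_mkcond /=.
  apply: eq_bigr => y _; rewrite inE; case: (boolP (y \in G)) => //= Gy.
  transitivity ((x ^ y)%g \in U <*> S : nat); first by case: (_ \in _).
  rewrite -card_conj_S ?groupJ ?expg_eq1J // -sum1_card big_mkcond [RHS]big_mkcond /=.
  by apply: eq_bigr => v _; rewrite inE conjgM; case: (v \in U) => //=; case: (_ \in S).
rewrite -sum_nat_const; apply: eq_bigr => v Uv.
rewrite -sum1_card big_mkcond [RHS]big_mkcond /= [RHS](reindex_inj (mulIg v)).
apply: eq_bigr => y _; rewrite inE (groupMr _ (subsetP sUG v Uv)).
by case: (y \in G) => //=; case: (_ \in S).
Qed.

End BorelSubgroup.

End StructureConsequences.

(** * Square roots in splitting fields *)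

Section SquareRoot.

Variable K : fieldType.

(** The characteristic polynomial divides a power of the irreducible [X^2 - d], so it is a power of
    it and a polynomial in [X^2]; the coefficient carrying the trace has odd degree and vanishes. *)
Lemma char_poly_sqr_nonsquare n (Z : 'M[K]_n) d :
  Z *m Z = d%:M -> (forall c, c ^+ 2 != d) -> \tr Z = 0.
Proof.
case: n Z => [|n] Z Zd nd; first by rewrite [Z]flatmx0 mxtrace0.
pose p : {poly K} := 'X^2 - d%:P.
have sz_p : size p = 3 by rewrite size_XnsubC.
have irr_p : irreducible_poly p.
  apply: cubic_irreducible; rewrite ?sz_p // => x.
  by rewrite /root !hornerE subr_eq0.
have dvd_cp : char_poly Z %| p ^+ n.+1.
  have -> : p ^+ n.+1 = \det (char_poly_mx Z *m ('X%:M + map_mx polyC Z)).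
    have -> : char_poly_mx Z *m ('X%:M + map_mx polyC Z) = p%:M.
      rewrite /char_poly_mx mulmxBl !mulmxDr -map_mxM Zd map_scalar_mx /=.
      rewrite [map_mx _ _ *m _]scalar_mxC opprD addrA addrK -scalar_mxM -expr2.
      by rewrite /p raddfB.
    by rewrite det_scalar.
  by rewrite det_mulmx dvdp_mulr.
have [k] : exists k, char_poly Z = p ^+ k.
  have : char_poly Z \is monic := char_poly_monic Z.
  have mp : p \is monic by rewrite monicXnsubC.
  elim: (n.+1) (char_poly Z) dvd_cp => [|m IHm] f.
    rewrite expr0 dvdp1 => /size_poly1P[c nzc ->]; rewrite monicE lead_coefC => /eqP->.
    by exists 0%N; rewrite expr0.
  have [cop|] := boolP (coprimep f p).
    by rewrite exprS Gauss_dvdpr //; apply: IHm.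
  rewrite coprimep_sym (irreducible_poly_coprime _ irr_p) negbK => /dvdpP[g ->].
  rewrite exprS mulrC dvdp_mul2l -?size_poly_eq0 ?sz_p // => dvd_g.
  rewrite monicMl // => mg; have [k ->] := IHm g dvd_g mg.
  by exists k.+1; rewrite exprS.
move=> cpE; have := char_poly_trace Z (ltn0Sn n); rewrite cpE => /= trE.
apply/eqP; rewrite -oppr_eq0 -trE.
have szk : size (char_poly Z) = n.+2 by rewrite size_char_poly.
have k2 : (k.*2 = n.+1)%N.
  by have := size_exp p k; rewrite -cpE szk sz_p /= mul2n.
have -> : p ^+ k = (('X - d%:P) ^+ k) \Po 'X^2.
  by rewrite rmorphXn /= rmorphB /= comp_polyX comp_polyC.
rewrite coef_comp_poly_Xn // dvdn2.
have -> : odd n by have := congr1 odd k2; rewrite odd_double /= => /esym/negbFE.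
by [].
Qed.

End SquareRoot.

Section CentralSum.

Variables (K : fieldType) (gT : finGroupType) (G : {group gT}) (alpha : gT -> int).

(** The action of the sum of all conjugates of [alpha], seen as an element of the group algebra;
    this sum is central. *)
Definition conj_sum n (rG : mx_representation K G n) : 'M[K]_n :=
  \sum_(g in G) \sum_(z in G) (alpha z)%:~R *: rG (z ^ g)%g.

Lemma conj_sum_cent n (rG : mx_representation K G n) h : h \in G ->
  conj_sum rG *m rG h = rG h *m conj_sum rG.
Proof.
move=> Gh; rewrite /conj_sum mulmx_suml mulmx_sumr.
rewrite [RHS](reindex_inj (mulIg h)) /=; apply: eq_big => [g|g Gg].
  by rewrite groupMr.
rewrite mulmx_suml mulmx_sumr; apply: eq_bigr => z Gz.
rewrite -scalemxAl -scalemxAr -!repr_mxM ?groupJ ?groupM //.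
by rewrite conjgM -conjgC.
Qed.

Lemma conj_sum_tr n (rG : mx_representation K G n) :
  \tr (conj_sum rG) = #|G|%:R * \sum_(z in G) (alpha z)%:~R * \tr (rG z).
Proof.
rewrite /conj_sum raddf_sum mulr_natl -sumr_const; apply: eq_bigr => g Gg /=.
rewrite raddf_sum; apply: eq_bigr => z Gz /=; rewrite mxtraceZ; congr (_ * _).
have -> : (z ^ g = g^-1 * (z * g))%g by [].
by rewrite !repr_mxM ?groupM ?groupV // mxtrace_mulC -mulmxA -repr_mxM ?groupV //
  mulgV repr_mx1 mulmx1.
Qed.

Hypothesis splitG : group_splitting_field K G.
Hypothesis charK : [pchar K] =i pred0.

Let natK0 n : (n%:R == 0 :> K) = (n == 0)%N.
Proof. by move/pcharf0P: charK. Qed.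

(** Representations are semisimple, and on a simple submodule the central operator is a scalar
    because [K] splits [G]. Its trace is zero and the dimension is nonzero in [K], so the scalar
    vanishes. *)
Lemma conj_sum0 : (forall n (rG : mx_representation K G n),
    \sum_(z in G) (alpha z)%:~R * \tr (rG z) = 0) ->
  forall n (rG : mx_representation K G n), conj_sum rG = 0.
Proof.
move=> tr0 n rG; apply/eqP.
have redG : mx_completely_reducible rG 1%:M.
  apply: mx_Maschke_pchar; apply: sub_in_pnat (pnat_pi (cardG_gt0 G)) => p _ _.
  by rewrite inE /= charK.
have := mx_reducible_semisimple (mxmodule1 rG) redG; apply=> -[I W /= simW defW _].
apply/eqP; rewrite -[conj_sum rG]mul1mx.
apply/sub_kermxP; rewrite -defW; apply/sumsmx_subP => i _.
have modW : mxmodule rG (W i) by have [] := simW i.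
have irrW : mx_irreducible (submod_repr modW) by apply/submod_mx_irr.
have absW := splitG irrW.
pose A := conj_sum (submod_repr modW).
have cA : centgmx (submod_repr modW) A.
  by apply/centgmxP=> h Gh; apply: conj_sum_cent.
have /is_scalar_mxP[a defA] := mx_abs_irr_cent_scalar absW cA.
have a0 : a = 0.
  have := conj_sum_tr (submod_repr modW); rewrite tr0 mulr0 -/A defA mxtrace_scalar => /eqP.
  rewrite -mulr_natr mulf_eq0 natK0; case/orP=> [/eqP//|/eqP r0].
  have [_ nzW _] := simW i.
  by rewrite -mxrank_eq0 r0 in nzW.
apply/sub_kermxP; rewrite -[W i](in_submodK (submx_refl _)).
set v := in_submod _ _.
have -> : val_submod v *m conj_sum rG = val_submod (v *m A).
  rewrite /A /conj_sum !mulmx_sumr linear_sum; apply: eq_bigr => g Gg.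
  rewrite !mulmx_sumr linear_sum; apply: eq_bigr => z Gz.
  by rewrite -!scalemxAr linearZ /= val_submodJ // groupJ.
by rewrite defA a0 raddf0 mulmx0 linear0.
Qed.

(** Singletons carry the regular action, so the coefficient of [y] is the entry of the vanishing
    operator at the singletons of 1 and [y]. *)
Lemma conj_sum_coef y : y \in G -> (forall n (rG : mx_representation K G n),
    \sum_(z in G) (alpha z)%:~R * \tr (rG z) = 0) ->
  \sum_(g in G) \sum_(z in G) alpha z * ((z ^ g)%g == y)%:R = 0.
Proof.
move=> Gy tr0; have A0 := conj_sum0 tr0 (rset_repr K G).
pose f A A' : K := \sum_(g in G) \sum_(z in G) (alpha z)%:~R * (A :* (z ^ g)%g == A')%:R.
have : kmx f = 0.
  rewrite -A0 /conj_sum /f -kmx_sum; apply: eq_bigr => g _.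
  rewrite -kmx_sum; apply: eq_bigr => z _.
  by apply/matrixP=> i j; rewrite !mxE.
move/matrixP/(_ (enum_rank [set 1%g]) (enum_rank [set y])); rewrite !mxE !enum_rankK /f.
have intK0 (z : int) : (z%:~R == 0 :> K) -> z = 0.
  case: z => m; first by rewrite -pmulrn natK0 => /eqP->.
  by rewrite NegzE mulrNz oppr_eq0 -pmulrn natK0.
move=> e; apply/intK0; rewrite -[X in _ == X]e rmorph_sum; apply/eqP/eq_bigr => g _.
rewrite rmorph_sum; apply: eq_bigr => z _; rewrite rmorphM rmorph_nat /=; congr (_ * _%:R).
by rewrite (_ : [set 1%g] :* _ = [set (z ^ g)%g]) ?(inj_eq set1_inj) // mulg_set1 mul1g.
Qed.

End CentralSum.

Section IntegralSquareRoot.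

Variables (R : idomainType) (K : fieldType) (iota : {rmorphism R -> K}).
Hypothesis dvrR : complete_dvr R.
Hypothesis iota_inj : injective iota.
Hypothesis frac : forall z : K, exists a, exists2 b, b != 0 & z = iota a / iota b.

(** A discrete valuation ring is integrally closed: if the denominator had the larger valuation, the
    equation cleared of denominators would put the unit [v ^+ 2] into the maximal ideal. *)
Lemma quadratic_integral (n : R) (z : K) : z ^+ 2 - z = iota n ->
  exists2 y : R, y ^+ 2 - y = n & iota y = z.
Proof.
move=> zn; suff [y yz] : exists y, iota y = z.
  by exists y => //; apply: iota_inj; rewrite rmorphB rmorphXn /= yz.
have [a [b nzb defz]] := frac z; have [pi [nzpi nupi ord] _] := dvrR.
have iu c : c != 0 -> iota c != 0.
  by rewrite -(inj_eq iota_inj) rmorph0.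
have [a0|nza] := eqVneq a 0; first by exists 0; rewrite defz a0 rmorph0 mul0r.
have [i [v uv da]] := ord _ nza; have [j [u uu db]] := ord _ nzb.
have [le_ji|lt_ij] := leqP j i.
  exists (v / u * pi ^+ (i - j)); rewrite defz; apply: (canRL (mulfK (iu _ nzb))).
  rewrite -rmorphM da db -{2}(subnK le_ji) exprD; congr (iota _).
  by rewrite mulrACA divrK.
have eqR : a ^+ 2 - a * b = n * b ^+ 2.
  apply: iota_inj; rewrite !(rmorphB, rmorphM, rmorphXn) /= -zn defz.
  by field; rewrite iu.
case/negP: nupi; have [m dj] : exists m, j = (i + m.+1)%N.
  by exists (j - i).-1; rewrite prednK ?subn_gt0 // subnKC // ltnW.
have : v ^+ 2 = pi * (pi ^+ m * (v * u + n * u ^+ 2 * pi ^+ m.+1)).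
  apply: (mulfI (expf_neq0 (i.*2) nzpi)); rewrite -addnn.
  have -> : pi ^+ (i + i) * v ^+ 2 = n * b ^+ 2 + a * b by rewrite -eqR subrK da exprD; ring.
  rewrite da db dj !exprD !exprS; ring.
move=> dv; have : v ^+ 2 \is a GRing.unit by rewrite unitrX.
by rewrite dv unitrM => /andP[].
Qed.

End IntegralSquareRoot.

(** * Operators on cosets of the split torus *)

Section BorelKernels.

Variables (k : finFieldType) (gT : finGroupType) (G U B T0 N0 T1 N1 : {group gT}).
Variable u : k -> gT.
Hypothesis ps : psl2_structure G U B T0 N0 T1 N1 u.
Variable R : idomainType.
Hypothesis natR : forall n, (n.+1)%:R != 0 :> R.

Implicit Types f h : k -> R.

Let sTB := ps_sT0B ps.
Let sBG := ps_sBG ps.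
Let sTG : T0 \subset G. Proof. exact: subset_trans sTB sBG. Qed.
Let Uu b : u b \in U. Proof. by rewrite (ps_U ps) imset_f. Qed.
Let Bu b : u b \in B. Proof. exact: subsetP (ps_sUB ps) _ (Uu b). Qed.
Let Gu b : u b \in G. Proof. exact: subsetP sBG _ (Bu b). Qed.

Lemma natT_neq0 : (#|T0|%:R : R) != 0.
Proof. by rewrite -(prednK (cardG_gt0 T0)). Qed.

(** [T0] acts on the parameter of [U] by squares, so such an [f] is invariant under conjugation by
    [T0]. *)
Definition sqr_inv f := forall a b, a != 0 -> f (a ^+ 2 * b) = f b.

Definition kconv f h c := \sum_b f (c - b) * h b.

(* Its value at [t * u b], for [t \in T0], is [f b]; it is bi-invariant under [T0]
   if [f] is invariant under the squares of [k]. *)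
Definition borel_fun f (x : gT) : R := \sum_b f b * ((x * (u b)^-1)%g \in T0)%:R.

Lemma borel_fun_mull f t x : t \in T0 -> borel_fun f (t * x)%g = borel_fun f x.
Proof. by move=> Tt; apply: eq_bigr => b _; rewrite -mulgA (groupMl _ Tt). Qed.

Lemma borel_fun_mulr f x t : sqr_inv f -> t \in T0 ->
  borel_fun f (x * t)%g = borel_fun f x.
Proof.
move=> fS Tt; have BtV : (t^-1)%g \in B by rewrite groupV (subsetP sTB).
have [a nza ua] := ps_uJ ps BtV.
rewrite /borel_fun [RHS](reindex_inj (mulfI (expf_neq0 2 nza))) /=.
apply: eq_bigr => b _; rewrite fS // -ua -[in LHS](groupMr _ (groupVr Tt)).
by rewrite conjgE invgK !invMg invgK !mulgA.
Qed.

Lemma borel_fun_kconv f h x :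
  \sum_b h b * borel_fun f (x * (u b)^-1)%g = borel_fun (kconv f h) x.
Proof.
rewrite /borel_fun /kconv; under [RHS]eq_bigr do rewrite mulr_suml.
rewrite [RHS]exchange_big /=; apply: eq_bigr => b _; rewrite mulr_sumr.
rewrite [RHS](reindex_inj (addIr b)) /=; apply: eq_bigr => c _.
by rewrite addrK (ps_uD ps) invMg mulgA mulrA [h b * _]mulrC.
Qed.

Lemma borel_fun_conv f h x : sqr_inv f ->
  \sum_(c in G) borel_fun f (x * c^-1)%g * borel_fun h c =
    #|T0|%:R * borel_fun (kconv f h) x.
Proof.
move=> fS; rewrite -borel_fun_kconv mulr_sumr.
under eq_bigr do rewrite {2}/borel_fun mulr_sumr.
rewrite exchange_big /=; apply: eq_bigr => b _.
rewrite (reindex_inj (mulIg (u b))) /=.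
under eq_bigl do rewrite groupMr //.
rewrite (eq_bigr (fun c => (if c \in T0 then h b * borel_fun f (x * (u b)^-1)%g else 0))).
  rewrite -big_mkcondr /= mulr_natl -sumr_const; apply: eq_bigl => c.
  by rewrite andb_idl // => /(subsetP sTG).
move=> c Gc; rewrite mulgK; case: ifP => Tc; rewrite ?mulr0 // mulr1 mulrC invMg mulgA.
by rewrite borel_fun_mulr ?groupV.
Qed.

(** The Hecke operator on R[G / T0] given by [borel_fun f]; for [f] invariant under squares the
    choice of representatives has no effect. *)
Definition borel_ker f (A A' : {set gT}) : R :=
  if (A \in rcosets T0 G) && (A' \in rcosets T0 G)
  then borel_fun f (repr A * (repr A')^-1)%g else 0.

Lemma borel_kerE f a a' : sqr_inv f -> a \in G -> a' \in G ->
  borel_ker f (T0 :* a) (T0 :* a') = borel_fun f (a * a'^-1)%g.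
Proof.
move=> fS Ga Ga'; rewrite /borel_ker !mem_rcosets mulSGid // Ga Ga' /=.
have [t Tt ->] := rcosetP (mem_repr_rcoset T0 a).
have [t' Tt' ->] := rcosetP (mem_repr_rcoset T0 a').
by rewrite invMg -!mulgA (borel_fun_mull _ _ Tt) mulgA (borel_fun_mulr _ fS (groupVr Tt')).
Qed.

Lemma borel_ker_mulr f x A A' : sqr_inv f -> x \in G ->
  borel_ker f (A :* x) (A' :* x) = borel_ker f A A'.
Proof.
move=> fS Gx; case: (boolP ((A \in rcosets T0 G) && (A' \in rcosets T0 G))) => [|nA].
  case/andP=> /rcosetsP[a Ga ->] /rcosetsP[a' Ga' ->]; rewrite -!rcosetM.
  by rewrite !borel_kerE ?groupM // invMg mulgA mulgK.
by rewrite /borel_ker !mem_rcosetsM // (negPf nA).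
Qed.

(** Multiplication of these Hecke operators is convolution on the additive group of [k]. *)
Lemma borel_ker_mul f h : sqr_inv f -> sqr_inv h ->
  kmx (borel_ker f) *m kmx (borel_ker h) = kmx (borel_ker (kconv f h)).
Proof.
move=> fS hS; rewrite kmx_mul; apply: eq_kmx => A A'.
have fhS : sqr_inv (kconv f h).
  move=> a b nza; rewrite /kconv (reindex_inj (mulfI (expf_neq0 2 nza))) /=.
  by apply: eq_bigr => c _; rewrite hS // -mulrBr fS.
have [RA|nRA] := boolP (A \in rcosets T0 G); last first.
  by rewrite [RHS]/borel_ker (negPf nRA) big1 // => C _; rewrite /borel_ker (negPf nRA) mul0r.
have [RA'|nRA'] := boolP (A' \in rcosets T0 G); last first.
  rewrite [RHS]/borel_ker (negPf nRA') andbF big1 // => C _.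
  by rewrite /borel_ker (negPf nRA') andbF mulr0.
have [[a Ga dA] [a' Ga' dA']] := (rcosetsP RA, rcosetsP RA'); rewrite dA dA'.
(* Summing over [G] counts each coset [#|T0|] times; this factor is nonzero in the domain [R] and
   can be cancelled even if it is not a unit. *)
apply: (mulfI natT_neq0); rewrite borel_kerE // -borel_fun_conv //.
rewrite (bigID [in rcosets T0 G]) /= [X in _ * (_ + X)]big1 ?addr0; last first.
  by move=> C /negPf nC; rewrite /borel_ker nC andbF mul0r.
rewrite mulr_natl -(sum_rcosets _ sTG) [RHS](reindex_inj (mulIg a'^-1%g)) /=.
apply: eq_big => [c|c Gc]; first by rewrite groupMr ?groupV.
by rewrite !borel_kerE // invMg invgK !mulgA mulgKV.
Qed.

Lemma borel_ker_trace f x : sqr_inv f -> x \in G ->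
  #|T0|%:R * \tr (kmx (borel_ker f) *m rset_mx R x) =
    \sum_(a in G) borel_fun f (x ^ a).
Proof.
move=> fS Gx; rewrite rset_mxtrace (bigID [in rcosets T0 G]) /= [X in _ + X]big1 ?addr0; last first.
  by move=> C /negPf nC; rewrite /borel_ker nC.
rewrite mulr_natl -(sum_rcosets _ sTG) [RHS](reindex_inj invg_inj) /=.
apply: eq_big => [c|c Gc]; first by rewrite groupV.
by rewrite -rcosetM borel_kerE ?groupM ?groupV // conjgE invMg !invgK mulgA.
Qed.

Lemma borel_factor x : x \in B -> exists t b, t \in T0 /\ x = (t * u b)%g.
Proof.
suff <- : (T0 * U)%g = B.
  by case/mulsgP=> t v Tt; rewrite (ps_U ps) => /imsetP[b _ ->] ->; exists t, b.
apply/eqP; rewrite eqEcard mul_subG ?(ps_sUB ps) //=.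
by rewrite TI_cardMg ?(ps_cardB ps) ?(card_U ps) 1?mulnC // setIC (ti_U_T0 ps).
Qed.

Lemma count_borel x : (\sum_b ((x * (u b)^-1)%g \in T0) = (x \in B))%N.
Proof.
have [Bx|nBx] := boolP (x \in B); last first.
  rewrite big1 // => b _; apply/eqP; rewrite eqb0; apply: contra nBx => /(subsetP sTB).
  by rewrite groupMr ?groupV.
have [t [b [Tt ->]]] := borel_factor Bx.
rewrite (bigD1 b) //= mulgK Tt big1 // => c neq_cb; apply/eqP; rewrite eqb0.
apply: contra neq_cb; rewrite -mulgA groupMl // => Tbc.
have : (u b * (u c)^-1)%g \in U :&: T0 by rewrite inE Tbc groupM ?groupV.
by rewrite (ti_U_T0 ps) => /set1gP/eqP; rewrite -eq_mulgV1 => /eqP/(ps_u_inj ps)->.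
Qed.

Lemma eq_borel_ker f h : f =1 h -> kmx (borel_ker f) = kmx (borel_ker h).
Proof.
move=> eq_fh; apply: eq_kmx => A A'; rewrite /borel_ker; case: ifP => // _.
by apply: eq_bigr => b _; rewrite eq_fh.
Qed.

Lemma borel_ker_cent f x : sqr_inv f -> x \in G ->
  kmx (borel_ker f) *m rset_mx R x = rset_mx R x *m kmx (borel_ker f).
Proof. by move=> fS Gx; apply: rset_cent => A A'; rewrite borel_ker_mulr. Qed.

Hypothesis uq : (#|k|%:R : R) \is a GRing.unit.
Hypothesis k2 : 2%:R != 0 :> k.

Let q : R := #|k|%:R.
Let eps : R := (quad_char (-1 : k))%:~R.
Definition eta (b : k) : R := (quad_char b)%:~R.
(** The unit for convolution among functions of sum zero; its operator is the augmentation kernel of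
    [T0] in [B]. *)
Definition dirac0 (b : k) : R := (b == 0)%:R - q^-1.

Variable y : R.
Hypothesis y_sqr : (2%:R * y - 1) ^+ 2 = eps * q.

(* Half of [dirac0 + eta / c] with [c = 2 y - 1] (see [halfdiracE]), written
   without dividing by 2. *)
Definition halfdirac (b : k) : R :=
  q^-1 * (if b == 0 then #|T0|%:R else y * eps * eta b - (eta b == eps)%:R).

Lemma quad_char_sign (b : k) : b != 0 -> quad_char b = 1 \/ quad_char b = -1.
Proof. by rewrite /quad_char => /negPf->; case: ifP; [left | right]. Qed.

Let two_neq0 : (2%:R : R) != 0. Proof. exact: natR. Qed.

Let qE : q = #|T0|%:R * 2%:R + 1.
Proof. by rewrite /q -(ps_cardT0 ps) -natrM natr1. Qed.

Lemma halfdiracE b :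
  2%:R * halfdirac b = dirac0 b + q^-1 * eps * (2%:R * y - 1) * eta b.
Proof.
rewrite /halfdirac /dirac0; have [->|nzb] := eqVneq b 0.
  rewrite /eta quad_char0 // mulr0 addr0 mulrCA mulr1n.
  have -> : 2%:R * #|T0|%:R = q - 1 by rewrite qE addrK mulrC.
  by rewrite mulrBr mulr1 mulVr.
have nN1 : (1 == -1 :> R) = false by rewrite -subr_eq0 opprK -mulr2n; apply: negbTE.
have : -1 != 0 :> k by rewrite oppr_eq0 oner_eq0.
rewrite /eta /eps; case/quad_char_sign=> ->; case: (quad_char_sign nzb) => ->.
all: by rewrite ?rmorphN ?rmorph1 ?eqxx ?nN1 ?[-1 == 1]eq_sym ?nN1 ?mulr1n ?mulr0n; ring.
Qed.

Lemma eta_sqr_inv : sqr_inv eta.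
Proof. by move=> a b nza; rewrite /eta quad_charM // quad_char_sqr // mul1r. Qed.

Lemma dirac0_sqr_inv : sqr_inv dirac0.
Proof. by move=> a b nza; rewrite /dirac0 mulf_eq0 expf_eq0 /= (negPf nza). Qed.

Lemma halfdirac_sqr_inv : sqr_inv halfdirac.
Proof.
by move=> a b nza; rewrite /halfdirac eta_sqr_inv // mulf_eq0 expf_eq0 /= (negPf nza).
Qed.

Lemma kconv_dirac0 f b : kconv f dirac0 b = f b - q^-1 * \sum_c f c.
Proof.
rewrite /kconv /dirac0; under eq_bigr do rewrite mulrBr.
rewrite sumrB (bigD1 0) //= subr0 eqxx mulr1 big1 ?addr0 => [|c /negPf->]; last exact: mulr0.
congr (_ - _); rewrite -mulr_suml mulrC; congr (_ * _).
by rewrite [RHS](reindex_inj (inj_comp (addrI b) oppr_inj)).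
Qed.

Lemma dirac0_kconv f b : kconv dirac0 f b = f b - q^-1 * \sum_c f c.
Proof.
rewrite -kconv_dirac0 /kconv (reindex_inj (inj_comp (addrI b) oppr_inj)) /=.
by apply: eq_bigr => c _; rewrite mulrC opprD addNKr opprK.
Qed.

Lemma sum_eta : \sum_b eta b = 0.
Proof. by rewrite /eta -rmorph_sum sum_quad_char. Qed.

Lemma sum_dirac0 : \sum_b dirac0 b = 0.
Proof.
rewrite /dirac0 sumrB sumr_const cardT -cardE -mulr_natl divrr // (bigD1 0) //= eqxx.
by rewrite big1 ?addr0 ?subrr // => b /negPf->.
Qed.

Lemma sum_halfdirac : \sum_b halfdirac b = 0.
Proof.
apply: (mulfI two_neq0); rewrite mulr0 mulr_sumr; under eq_bigr do rewrite halfdiracE.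
by rewrite big_split /= sum_dirac0 -mulr_sumr sum_eta mulr0 addr0.
Qed.

Lemma eta_kconv b : kconv eta eta b = eps * q * dirac0 b.
Proof.
have := congr1 (fun z : int => z%:~R : R) (quad_char_conv k2 b).
rewrite rmorph_sum rmorphM rmorphB rmorphM !rmorph_nat rmorph1 -/eps -/q => e.
rewrite /dirac0 -mulrA mulrBr divrr // -e; apply: eq_bigr => c _.
by rewrite rmorphM mulrC.
Qed.

(** [dirac0] acts as the identity on [eta], and [eta] convolved with itself is [c^2 dirac0], so half
    of [dirac0 + eta / c] is idempotent. The identity is proved after multiplication by 4. *)
Lemma halfdirac_kconv b : kconv halfdirac halfdirac b = halfdirac b.
Proof.
apply: (mulfI two_neq0); apply: (mulfI two_neq0).
(* [m] is [1 / c], since [c^2 = eps q] and [eps^2 = 1]. *)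
pose m := q^-1 * eps * (2%:R * y - 1).
have eps2 : eps * eps = 1.
  by rewrite -rmorphM -expr2 /= quad_char_sqr1 // oppr_eq0 oner_eq0.
have -> : 2%:R * (2%:R * kconv halfdirac halfdirac b) =
    kconv dirac0 dirac0 b + m * kconv dirac0 eta b + m * kconv eta dirac0 b
      + m ^+ 2 * kconv eta eta b.
  rewrite /kconv !mulr_sumr -!big_split /=; apply: eq_bigr => c _.
  have -> : 2%:R * (2%:R * (halfdirac (b - c) * halfdirac c)) =
      2%:R * halfdirac (b - c) * (2%:R * halfdirac c) by ring.
  by rewrite !halfdiracE -/m; ring.
rewrite !(kconv_dirac0, dirac0_kconv) sum_eta sum_dirac0 !mulr0 !subr0 eta_kconv.
have -> : m ^+ 2 * (eps * q * dirac0 b) = dirac0 b.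
  have -> : m ^+ 2 * (eps * q * dirac0 b) =
      q^-1 * q * (q^-1 * (2%:R * y - 1) ^+ 2) * (eps * eps) * eps * dirac0 b.
    by rewrite /m; ring.
  by rewrite y_sqr eps2 mulVr // mul1r mulr1 mulrCA mulVr // mulr1 eps2 mul1r.
by rewrite halfdiracE -/m; ring.
Qed.

Lemma aug_ker_dirac0 : kmx (aug_ker R G B T0) = kmx (borel_ker dirac0).
Proof.
apply: eq_kmx => A A'.
have [/rcosetsP[a Ga ->]|nA] := boolP (A \in rcosets T0 G); last first.
  by rewrite /aug_ker /borel_ker (negPf nA).
have [/rcosetsP[a' Ga' ->]|nA'] := boolP (A' \in rcosets T0 G); last first.
  by rewrite /aug_ker /borel_ker (negPf nA') andbF.
rewrite aug_kerE // borel_kerE //; last exact: dirac0_sqr_inv.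
have -> : #|B : T0| = #|k| by rewrite -divgS // (ps_cardB ps) mulnK.
rewrite /borel_fun /dirac0; under eq_bigr do rewrite mulrBl.
rewrite sumrB -mulr_sumr -natr_sum count_borel mulrC; congr (_ - _).
rewrite (bigD1 0) //= eqxx mul1r big1 ?addr0 => [|b /negPf->]; last exact: mul0r.
have -> : u 0 = 1%g.
  by apply: (mulgI (u 0)); rewrite -(ps_uD ps) addr0 mulg1.
by rewrite invg1 mulg1.
Qed.

(** Nontrivial elements of [T0] centralize nothing but 1 in [U], so [T0] is semiregular on its
    nontrivial cosets in [B]. The relative augmentation applies with [P = N = T0], where the index
    to invert is q. *)
Lemma aug_ker_higman : exists t,
  mx_trace1 (rset_repr R G) (kmx t) = kmx (borel_ker dirac0).
Proof.
rewrite -aug_ker_dirac0; apply: (aug_ker_trace1 (P := T0)) => //; last first.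
  by rewrite -divgS // (ps_cardB ps) mulnK.
move=> x b Tx ntx /borel_factor[t [c [Tt ->]]].
rewrite invMg conjgM memJ_norm ?groupV ?(subsetP (normG T0)) // => Txc.
have nUx : x \in 'N(U) by rewrite (subsetP (norm_U_B ps)) // (subsetP sTB).
have : [~ x, (u c)^-1]%g \in U :&: T0.
  rewrite inE; apply/andP; split; last by rewrite commgEl groupMl ?groupV.
  by rewrite commgEr groupM ?groupV // memJ_norm ?groupV.
rewrite (ti_U_T0 ps) => /set1gP/eqP/commgP => cxu.
have cux : commute (u c) x by apply: commute_sym; rewrite -[u c]invgK; apply: commuteV.
by rewrite (cent_U_T0 ps (Uu c) Tx ntx cux) mulg1.
Qed.

Lemma halfdirac_trace x : x \in G ->
  #|T0|%:R * (2%:R * \tr (kmx (borel_ker halfdirac) *m rset_mx R x)) =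
    #|T0|%:R * ((fix_cosets G T0 x)%:R - (fix_cosets G B x)%:R)
      + q^-1 * eps * (2%:R * y - 1) * \sum_(c in G) borel_fun eta (x ^ c).
Proof.
move=> Gx; rewrite -(mxtrace_aug_ker (N := T0)) //; last first.
  by rewrite -divgS // (ps_cardB ps) mulnK.
rewrite aug_ker_dirac0 mulrCA !borel_ker_trace //.
- rewrite !mulr_sumr -big_split; apply: eq_bigr => c _ /=.
  rewrite /borel_fun !mulr_sumr -big_split; apply: eq_bigr => b _ /=.
  by rewrite mulrA halfdiracE; ring.
- exact: dirac0_sqr_inv.
- exact: halfdirac_sqr_inv.
Qed.

Variables (F : fieldType) (rho : {rmorphism R -> F}).
Hypothesis rho_surj : forall z : F, exists a, z = rho a.
Hypothesis rho_ker : forall a, (rho a == 0) = (a \isn't a GRing.unit).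

(** [a] lists the coefficients of a central idempotent of the group algebra. By [a_eta], the
    products of the operator of [eta] with group elements have trace zero on the part that it cuts
    out. *)
Variable a : gT -> R.
Hypothesis aJ : forall x g, x \in G -> g \in G -> a (x ^ g)%g = a x.
Hypothesis a_idem : forall x, x \in G -> \sum_(z in G) a (z * x)%g * a z^-1%g = a x.
Hypothesis a_eta : forall x, x \in G ->
  \sum_(z in G) a (z * x)%g * (\sum_(c in G) borel_fun eta (z^-1 ^ c)%g) = 0.

Let Z : 'M[R]_#|{set gT}| := \sum_(g in G) a g *: rset_mx R g^-1%g.

Let rset_mxM (x z : gT) : rset_mx R (x * z)%g = rset_mx R x *m rset_mx R z.
Proof. by rewrite -[RHS](repr_mxM (rset_repr R [set: gT]%G)) ?inE. Qed.

Let Z_cent x : x \in G -> Z *m rset_mx R x = rset_mx R x *m Z.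
Proof.
move=> Gx; rewrite mulmx_suml mulmx_sumr [LHS](reindex_inj (conjg_inj x^-1%g)) /=.
apply: eq_big => [g|g Gg]; first by rewrite groupJr ?groupV.
rewrite groupJr ?groupV // in Gg; rewrite aJ ?groupV // -scalemxAl -scalemxAr -!rset_mxM;
  congr (_ *: rset_mx R _).
by rewrite -conjVg conjgE invgK mulgA mulgKV.
Qed.

Let Z_idem : Z *m Z = Z.
Proof.
rewrite mulmx_suml; under eq_bigr do rewrite mulmx_sumr.
transitivity (\sum_(z in G) (\sum_(h in G) a (h^-1 * z)%g * a h) *: rset_mx R z^-1%g).
  under [RHS]eq_bigr do rewrite scaler_suml.
  rewrite exchange_big [RHS]exchange_big /=; apply: eq_bigr => h Gh.
  rewrite [RHS](reindex_inj (mulgI h)) /=; apply: eq_big => [g|g Gg].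
    by rewrite groupMl.
  by rewrite mulKg -scalemxAl -scalemxAr scalerA -rset_mxM invMg.
apply: eq_bigr => z Gz; congr (_ *: _); rewrite -[RHS](a_idem Gz) [LHS](reindex_inj invg_inj) /=.
by apply: eq_big => [h|h Gh]; rewrite ?groupV ?invgK.
Qed.

(** The summand is the image of the half projection times the central idempotent [Z]. The
    contribution of [eta] to its trace is killed by [a_eta], so twice the trace is that of the whole
    augmentation kernel cut by [Z]. *)
Lemma proj_cutoff : exists m, exists2 rM : mx_representation R G m,
  exists s, mx_trace1 rM s = 1%:M
  & {in G, forall x, 2%:R * \tr (rM x) =
      \sum_(z in G) a (z * x)%g *
        ((fix_cosets G T0 z^-1%g)%:R - (fix_cosets G B z^-1%g)%:R)}.
Proof.
pose P := kmx (borel_ker halfdirac).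
have PZ : P *m Z = Z *m P.
  rewrite /Z mulmx_suml mulmx_sumr; apply: eq_bigr => g Gg.
  by rewrite -scalemxAl -scalemxAr borel_ker_cent ?groupV //; apply: halfdirac_sqr_inv.
have P_idem : P *m P = P.
  rewrite borel_ker_mul; try exact: halfdirac_sqr_inv.
  exact/eq_borel_ker/halfdirac_kconv.
have P_dirac : P *m kmx (borel_ker dirac0) = P.
  rewrite borel_ker_mul; [|exact: halfdirac_sqr_inv|exact: dirac0_sqr_inv].
  by apply: eq_borel_ker => b; rewrite kconv_dirac0 sum_halfdirac mulr0 subr0.
have [t tE] := aug_ker_higman.
have cP x : x \in G -> P *m rset_mx R x = rset_mx R x *m P.
  by move=> Gx; apply: borel_ker_cent => //; apply: halfdirac_sqr_inv.
have [||| m [rM sM trM]] :=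
    proj_summand rho_surj rho_ker (rG := rset_repr R G) (E := P *m Z) (t := kmx t).
- by rewrite {2}PZ mulmxA -[P *m Z *m Z]mulmxA Z_idem PZ -mulmxA P_idem.
- by move=> x Gx; rewrite /= -mulmxA Z_cent // !mulmxA cP.
- by rewrite tE PZ -mulmxA P_dirac.
exists m, rM => // x Gx; rewrite trM //=; apply: (mulfI natT_neq0).
transitivity (\sum_(z in G) a (z * x)%g *
   (#|T0|%:R * (2%:R * \tr (kmx (borel_ker halfdirac) *m rset_mx R z^-1%g)))).
  rewrite -mulmxA Z_cent // mulmxA cP // -mulmxA mxtrace_mulC /Z mulmx_sumr mulmx_suml.
  rewrite raddf_sum !mulr_sumr /=.
  rewrite [LHS](reindex_inj (mulgI x)) /=; apply: eq_big => [z|z Gz].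
    by rewrite groupMl.
  rewrite groupMl // in Gz; rewrite -scalemxAr -scalemxAl mxtraceZ -mulmxA -rset_mxM invMg mulgKV.
  have -> : a (x * z)%g = a (z * x)%g.
    by rewrite -(aJ (groupM Gz Gx) (groupVr Gx)) conjgE invgK !mulgA mulgK.
  by rewrite !mulrA; congr (_ * _); ring.
under [LHS]eq_bigr => z Gz do rewrite halfdirac_trace ?groupV // mulrDr.
rewrite big_split /= [X in _ + X](_ : _ = 0) ?addr0; last first.
  transitivity (q^-1 * eps * (2%:R * y - 1) *
      \sum_(z in G) a (z * x)%g * (\sum_(c in G) borel_fun eta (z^-1 ^ c)%g)).
    by rewrite mulr_sumr; apply: eq_bigr => z Gz; rewrite mulrCA.
  by rewrite a_eta // mulr0.
by rewrite mulr_sumr; apply: eq_bigr => z Gz; rewrite mulrCA.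
Qed.

End BorelKernels.

(** * The quadratic Gauss sum in a splitting field *)

Section GaussSum.

Variables (k : finFieldType) (gT : finGroupType) (G U B T0 N0 T1 N1 : {group gT}).
Variable u : k -> gT.
Hypothesis ps : psl2_structure G U B T0 N0 T1 N1 u.
Hypothesis k2 : 2%:R != 0 :> k.
Variable K : fieldType.
Hypothesis splitG : group_splitting_field K G.
Hypothesis charK : [pchar K] =i pred0.

Let natK0 n : (n%:R == 0 :> K) = (n == 0)%N.
Proof. by move/pcharf0P: charK. Qed.

Let Gu b : u b \in G.
Proof.
by rewrite (subsetP (subset_trans (ps_sUB ps) (ps_sBG ps))) // (ps_U ps) imset_f.
Qed.

Let u0 : u 0 = 1%g.
Proof. by apply: (mulgI (u 0)); rewrite -(ps_uD ps) addr0 mulg1. Qed.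

Definition unip_mx n (rG : mx_representation K G n) (f : k -> K) : 'M_n :=
  \sum_b f b *: rG (u b).

Lemma unip_mx_mul n (rG : mx_representation K G n) f h :
  unip_mx rG f *m unip_mx rG h = unip_mx rG (fun w => \sum_b f (w - b) * h b).
Proof.
rewrite /unip_mx mulmx_suml; under eq_bigr do rewrite mulmx_sumr.
under [RHS]eq_bigr do rewrite scaler_suml.
rewrite exchange_big [RHS]exchange_big /=; apply: eq_bigr => b _.
rewrite [RHS](reindex_inj (addIr b)) /=; apply: eq_bigr => c _.
by rewrite addrK -scalemxAl -scalemxAr scalerA -repr_mxM // -(ps_uD ps).
Qed.

Let d : K := (quad_char (-1 : k))%:~R * #|k|%:R.

(* Y^2 = d (1 - e), where e is the projection on the fixed points of U and
   e Y = 0; the block matrix [Y, d e; e, Y] therefore squares to d. *)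
Lemma tr_unip_quad_char n (rG : mx_representation K G n) :
  (forall c, c ^+ 2 != d) -> \tr (unip_mx rG (fun b => (quad_char b)%:~R)) = 0.
Proof.
move=> nsq; set Y := unip_mx rG _.
have nzq : (#|k|%:R : K) != 0 by rewrite natK0 -lt0n; apply/card_gt0P; exists 0.
pose e := unip_mx rG (fun=> #|k|%:R^-1).
have sum0 : \sum_(b : k) (quad_char b)%:~R = 0 :> K by rewrite -rmorph_sum sum_quad_char.
have z0 : unip_mx rG (fun=> 0) = 0 by apply: big1 => b _; rewrite scale0r.
have Ye : Y *m e = 0.
  rewrite unip_mx_mul -[RHS]z0; apply: eq_bigr => w _; congr (_ *: _).
  rewrite -mulr_suml [X in X * _](_ : _ = 0) ?mul0r // -[RHS]sum0.
  by rewrite [RHS](reindex_inj (inj_comp (addrI w) oppr_inj)).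
have eY : e *m Y = 0.
  rewrite unip_mx_mul -[RHS]z0; apply: eq_bigr => w _; congr (_ *: _).
  by rewrite -mulr_sumr sum0 mulr0.
have ee : e *m e = e.
  rewrite unip_mx_mul; apply: eq_bigr => w _; congr (_ *: _).
  by rewrite sumr_const cardT -cardE -[LHS]mulr_natl mulrA divff ?mul1r.
have YY : Y *m Y = d%:M - d *: e.
  rewrite unip_mx_mul.
  transitivity (unip_mx rG (fun w => d * (w == 0)%:R - d / #|k|%:R)).
    apply: eq_bigr => w _; congr (_ *: _).
    have := congr1 (fun z : int => z%:~R : K) (quad_char_conv k2 w).
    rewrite rmorph_sum rmorphM rmorphB rmorphM !rmorph_nat rmorph1.
    rewrite mulrBr mulr1 mulrA -/d /d mulfK // => <-.
    by apply: eq_bigr => c _; rewrite rmorphM mulrC.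
  rewrite /unip_mx; under eq_bigr do rewrite scalerBl.
  rewrite sumrB; congr (_ - _); last first.
    by rewrite scaler_sumr; apply: eq_bigr => w _; rewrite scalerA.
  rewrite (bigD1 0) //= eqxx mulr1 u0 repr_mx1 scalemx1 big1 ?addr0 // => w /negPf->.
  by rewrite mulr0 scale0r.
pose Z := block_mx Y (d *: e) e Y.
have ZZ : Z *m Z = d%:M.
  rewrite mulmx_block -!scalemxAl -!scalemxAr Ye eY ee YY !scaler0 !addr0.
  by rewrite subrK [X in block_mx _ _ _ X]addrC subrK scalar_mx_block.
have := char_poly_sqr_nonsquare ZZ nsq; rewrite mxtrace_block -mulr2n -mulr_natl => /eqP.
by rewrite mulf_eq0 natK0 => /eqP.
Qed.

(** Without the root, [alpha] would have trace zero in all representations, and the sum of its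
    conjugates would vanish in the group algebra. Its coefficient at [u 1] is however positive: if
    [u b] is conjugate to [u 1], then [b] is a square, so no negative term occurs. *)
Lemma splitting_gauss_sum : exists c, c ^+ 2 = d.
Proof.
apply: NNPP => nsq.
pose alpha z := \sum_b quad_char b * (z == u b)%:R.
have tr0 n (rG : mx_representation K G n) : \sum_(z in G) (alpha z)%:~R * \tr (rG z) = 0.
  transitivity (\tr (unip_mx rG (fun b => (quad_char b)%:~R))); last first.
    by apply: tr_unip_quad_char => c; apply/eqP=> sq; apply: nsq; exists c.
  rewrite (raddf_sum (@mxtrace _ _)) /=; under eq_bigr do rewrite rmorph_sum mulr_suml.
  rewrite exchange_big; apply: eq_bigr => b _ /=.
  rewrite (bigD1 (u b)) //= eqxx mulr1 mxtraceZ big1 ?addr0 // => z /andP[_ /negPf->].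
  by rewrite mulr0 mul0r.
have coef0 := conj_sum_coef splitG charK (Gu 1) tr0.
pose F g b := quad_char b * ((u b ^ g)%g == u 1)%:R.
have Fge0 g b : g \in G -> 0 <= F g b.
  move=> Gg; rewrite /F; case: eqP => [ub1|]; last by rewrite mulr0.
  have ntu : u b != 1%g.
    rewrite -(conjg_eq1 _ g) ub1 -u0 (inj_eq (ps_u_inj ps)).
    exact: oner_neq0.
  have Bg : g \in B.
    by apply: (ps_tiU ps (x := u b)); rewrite // ?ub1 (ps_U ps) imset_f.
  have [a nza /(_ b)] := ps_uJ ps Bg; rewrite ub1 => /(ps_u_inj ps) e1.
  by have := quad_char1 k; rewrite e1 quad_charM // quad_char_sqr // mul1r => ->.
have : \sum_(g in G) \sum_b F g b = 0.
  rewrite -[RHS]coef0; apply: eq_bigr => g Gg.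
  under [RHS]eq_bigr do rewrite mulr_suml.
  rewrite exchange_big; apply: eq_bigr => b _ /=.
  rewrite (bigD1 (u b)) //= eqxx mulr1 big1 ?addr0 // => z /andP[_ /negPf->].
  by rewrite mulr0 mul0r.
rewrite (bigD1 1%g) //= (bigD1 (1 : k)) //= {1}/F conjg1 eqxx quad_char1 // mulr1 -addrA => e.
have ge0 : 0 <= \sum_(b | b != 1) F 1%g b + \sum_(g in G | g != 1%g) \sum_b F g b.
  rewrite addr_ge0 // sumr_ge0 // => [b _|g /andP[Gg _]]; first exact: Fge0.
  by apply: sumr_ge0 => b _; apply: Fge0.
by move: ge0; rewrite -(lerD2l 1) e.
Qed.

End GaussSum.

(** * Characters induced from tori *)

Section Convolution.

Variables (gT : finGroupType) (G : {group gT}).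

(** Convolution with an irreducible character extracts its component in [phi], by the generalized
    orthogonality relation. *)
Lemma conv_irr (i : Iirr G) (phi : 'CF(G)) x : x \in G ->
  \sum_(y in G) 'chi_i (y * x)%g * phi y^-1%g =
    #|G|%:R * '[phi, 'chi_i] * ('chi_i x / 'chi_i 1%g).
Proof.
move=> Gx; transitivity (\sum_j '[phi, 'chi_j] * \sum_(y in G) 'chi_i (y * x)%g * 'chi_j y^-1%g).
  transitivity (\sum_(y in G) \sum_j '[phi, 'chi_j] * ('chi_i (y * x)%g * 'chi_j y^-1%g)).
    apply: eq_bigr => y _; rewrite {1}[phi]cfun_sum_cfdot sum_cfunE mulr_sumr.
    by apply: eq_bigr => j _; rewrite cfunE mulrCA.
  by rewrite exchange_big; apply: eq_bigr => j _; rewrite mulr_sumr.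
have orth j : \sum_(y in G) 'chi_i (y * x)%g * 'chi_j y^-1%g =
    #|G|%:R * ((i == j)%:R * ('chi_i x / 'chi_i 1%g)).
  by rewrite -(generalized_orthogonality_relation x i j) mulrA mulfV ?mul1r ?neq0CG.
rewrite (bigD1 i) //= [X in _ + X]big1 => [|j neq_ji]; last first.
  by rewrite orth eq_sym (negPf neq_ji) mul0r !mulr0.
by rewrite addr0 orth eqxx mul1r mulrCA mulrA.
Qed.

(* The signs of a virtual irreducible cancel out in this formula. *)
Lemma conv_signed_irr (rho phi : 'CF(G)) x : x \in G -> rho \in 'Z[irr G] -> '[rho] = 1 ->
  \sum_(y in G) rho (y * x)%g * phi y^-1%g =
    #|G|%:R * '[phi, rho] * (rho x / rho 1%g).
Proof.
move=> Gx Zrho /(vchar_norm1P Zrho)[b [i ->]].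
under eq_bigr do rewrite cfunE -mulrA.
rewrite -mulr_sumr conv_irr // !cfunE cfdotZr.
have -> : ((-1) ^+ b : algC)^* = (-1) ^+ b by rewrite rmorph_sign.
rewrite -mulf_div mulfV ?signr_eq0 // mul1r; ring.
Qed.

End Convolution.

Section TorusCharacters.

Variables (gT : finGroupType) (G : {group gT}) (q : nat) (CU : {set gT}) (Gam : 'CF(G)).

(** Treats both tori at once: [s] is 1 for the split and -1 for the nonsplit one, [CU] is the set of
    nontrivial unipotent elements, and [M] is the subgroup of odd order on which the relevant
    characters of [X] are nontrivial. *)
Record torus (X N M : {group gT}) (s : algC) : Prop := Torus {
  tor_XG : X \subset G;
  tor_NG : N \subset G;
  tor_XN : X \subset N;
  tor_ab : abelian X;
  tor_MX : M \subset X;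
  tor_oddM : odd #|M|;
  tor_memJ : forall x g, x \in X -> x != 1%g -> g \in G -> ((x ^ g)%g \in X) = (g \in N);
  tor_inv : forall x g, x \in X -> g \in N -> g \notin X -> (x ^ g = x^-1)%g;
  tor_cardN : (#|N| = #|X| * 2)%N;
  tor_sq : s ^+ 2 = 1;
  tor_card : 2%:R * #|X|%:R = q%:R - s;
  tor_CU : forall x, x \in X -> x \notin CU;
  tor_CUJ : forall x y, x \in CU -> y \in G -> (x ^ y)%g \notin X }.

Hypothesis cardG : 2%:R * #|G|%:R = q%:R * (q%:R ^+ 2 - 1) :> algC.
Hypothesis q_gt1 : (1 < q)%N.
Hypothesis sCU : CU \subset G^#.
Hypothesis cardCU : #|CU|%:R = q%:R ^+ 2 - 1 :> algC.
Hypothesis GamZ : Gam \in 'Z[irr G].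
Hypothesis Gam1 : Gam 1%g = q%:R ^+ 2 - 1.
Hypothesis GamU : forall x, x \in CU -> Gam x = -1.
Hypothesis Gam0 : forall x, x \in G -> x != 1%g -> x \notin CU -> Gam x = 0.

Let qR : algC := q%:R.
Let nzq : qR != 0. Proof. by rewrite pnatr_eq0 -lt0n ltnW. Qed.
Let nzq1 : qR - 1 != 0. Proof. by rewrite subr_eq0 pnatr_eq1 gtn_eqF. Qed.
Let nzq2 : qR + 1 != 0. Proof. by rewrite /qR natr1 pnatr_eq0. Qed.
Let cG : #|G|%:R = qR * (qR ^+ 2 - 1) / 2%:R.
Proof. by rewrite -cardG mulrC mulKf // pnatr_eq0. Qed.

Lemma Gam_dot (f : 'CF(G)) c : (forall x, x \in CU -> f x = c) ->
  '[Gam, f] = 2%:R / qR * (f 1%g - c)^*.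
Proof.
move=> fc; rewrite cfdotE.
rewrite (bigD1 1%g) //= (bigID [in CU]) /= addrA [X in _ + X]big1 ?addr0; last first.
  by move=> x /andP[/andP[Gx ntx] nCx]; rewrite Gam0 // mul0r.
have -> : \sum_(i | (i \in G) && (i != 1%g) && (i \in CU)) Gam i * (f i)^* = - (qR ^+ 2 - 1) * c^*.
  rewrite (eq_bigl [in CU]) => [|x]; last first.
    apply/andP/idP=> [[]//|Cx]; split=> //.
    by have := subsetP sCU x Cx; rewrite !inE andbC.
  rewrite (eq_bigr (fun=> - c^*)) => [|x Cx]; last by rewrite GamU // fc // mulN1r.
  by rewrite sumr_const -mulr_natl cardCU mulrN mulNr.
rewrite Gam1 -/qR cG rmorphB mulNr -mulrBr; field.
by rewrite nzq /= -[qR ^+ 2]/(qR ^+ 2) subr_sqr_1 mulf_neq0.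
Qed.

Section OneTorus.

Variables (X N M : {group gT}) (s : algC).
Hypothesis tX : torus X N M s.

Let sXG := tor_XG tX.
Let sMX := tor_MX tX.
Let s2 : s * s = 1. Proof. by rewrite -expr2 (tor_sq tX). Qed.
Let cX : #|X|%:R = (qR - s) / 2%:R :> algC.
Proof. by rewrite -(tor_card tX) mulrC mulKf // pnatr_eq0. Qed.
Let nzqs : qR - s != 0.
Proof. by rewrite -(tor_card tX) mulf_neq0 ?neq0CG // pnatr_eq0. Qed.
Lemma lin_torus (i : Iirr X) : 'chi_i \is a linear_char.
Proof. exact/char_abelianP/(tor_ab tX). Qed.

Lemma cfInd_torusE (phi : 'CF(X)) x : x \in X -> x != 1%g ->
  'Ind[G] phi x = phi x + phi x^-1%g.
Proof.
move=> Xx ntx; rewrite cfIndE //; apply: (canLR (mulKf (neq0CG X))).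
rewrite (bigID [in N]) /= [X in _ + X]big1 ?addr0 => [|y /andP[Gy nNy]]; last first.
  by rewrite cfun0 // (tor_memJ tX).
rewrite (eq_bigl [in N]) => [|y]; last first.
  by apply/andP/idP=> [[]//|Ny]; rewrite Ny (subsetP (tor_NG tX)).
rewrite (bigID [in X]) /= mulrDr; congr (_ + _).
  rewrite (eq_bigl [in X]) => [|y]; last first.
    by apply/andP/idP=> [[]//|Xy]; rewrite Xy (subsetP (tor_XN tX)).
  rewrite (eq_bigr (fun=> phi x)) => [|y Xy]; first by rewrite sumr_const mulr_natl.
  rewrite (_ : x ^ y = x)%g //; apply/conjg_fixP/commgP.
  exact: (centsP (tor_ab tX)).
rewrite (eq_bigr (fun=> phi x^-1%g)) => [|y /andP[Ny nXy]]; last first.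
  by rewrite (tor_inv tX Xx Ny nXy).
rewrite sumr_const mulr_natl; congr (_ *+ _).
have := tor_cardN tX; rewrite -(cardsID X N) (setIidPr (tor_XN tX)) muln2 -addnn.
by move/addnI <-; apply: eq_card => y; rewrite !inE andbC.
Qed.

Lemma cfInd_torus1 i : 'Ind[G] 'chi[X]_i 1%g = qR * (qR + s).
Proof.
rewrite cfInd1 // (lin_char1 (lin_torus i)) mulr1.
have := Lagrange sXG => /(congr1 (fun n => n%:R : algC)); rewrite natrM cX cG => e.
have nz2 : 2%:R != 0 :> algC by rewrite pnatr_eq0.
apply: (mulfI (mulf_neq0 nzqs (invr_neq0 nz2))); rewrite e.
apply: (mulIf nz2); rewrite mulfVK // mulrAC mulfVK //.
by apply: eq_of_sub_eq (congr1 (fun t => qR * t) s2) _; ring.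
Qed.

(** The Deligne-Lusztig character of the torus, of degree [s (q + s)] and value 1 on [CU]. *)
Definition rho_torus (i : Iirr X) : 'CF(G) := 'Ind 'chi_i - Gam.

Lemma rho_torusZ i : rho_torus i \in 'Z[irr G].
Proof. by rewrite rpredB // char_vchar // cfInd_char ?irr_char. Qed.

Lemma cfInd_torusU (phi : 'CF(X)) x : x \in CU -> 'Ind[G] phi x = 0.
Proof.
move=> Cx; rewrite cfIndE // big1 ?mulr0 // => y Gy.
by rewrite cfun0 // (tor_CUJ tX).
Qed.

Lemma rho_torus1 i : rho_torus i 1%g = s * (qR + s).
Proof.
rewrite !cfunE cfInd_torus1 Gam1 -/qR.
by apply: eq_of_sub_eq (esym s2) _; ring.
Qed.

Lemma rho_torusU i x : x \in CU -> rho_torus i x = 1.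
Proof. by move=> Cx; rewrite !cfunE cfInd_torusU // GamU // opprK add0r. Qed.

Lemma sR : s^* = s.
Proof.
have -> : s = qR - 2%:R * #|X|%:R by rewrite (tor_card tX) subKr.
by rewrite rmorphB rmorphM !rmorph_nat.
Qed.

Lemma Gam_rho_dot i : '[Gam, rho_torus i] = 2%:R * s.
Proof.
rewrite (Gam_dot (@rho_torusU i)) rho_torus1 rmorphB rmorphM rmorphD rmorph1 /= sR.
have -> : qR^* = qR by rewrite rmorph_nat.
have -> : s * (qR + s) - 1 = s * qR by apply: eq_of_sub_eq s2 _; ring.
by field.
Qed.

Lemma Gam_Ind_dot i : '[Gam, 'Ind 'chi[X]_i] = 2%:R * (qR + s).
Proof.
rewrite (Gam_dot (fun x => @cfInd_torusU 'chi[X]_i x)) cfInd_torus1 subr0.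
rewrite rmorphM rmorphD /= sR; have -> : qR^* = qR by rewrite rmorph_nat.
by field.
Qed.

Lemma Gam_norm : '[Gam] = 2%:R * qR.
Proof.
rewrite (Gam_dot GamU) Gam1 -/qR opprK subrK rmorphXn rmorph_nat -/qR.
by field.
Qed.

Lemma Ind_torus_dot i (phi : 'CF(G)) : '['Ind 'chi[X]_i, phi] =
  #|X|%:R^-1 * \sum_(x in X) 'chi_i x * (phi x)^*.
Proof.
rewrite -cfdot_Res_r cfdotE; congr (_ * _); apply: eq_bigr => x Xx.
by rewrite cfResE.
Qed.

Lemma Ind_torus_dot_self i j : '['Ind[G] 'chi[X]_i, 'Ind 'chi_j] =
  (i == j)%:R + (conjC_Iirr i == j)%:R + 2%:R * (qR + 2%:R * s).
Proof.
rewrite Ind_torus_dot.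
have -> : \sum_(x in X) 'chi_i x * ('Ind[G] 'chi_j x)^* =
    \sum_(x in X) ('chi_i x * ('chi_j x)^* + 'chi_i x * 'chi_j x)
    + (qR * (qR + s) - 2%:R).
  rewrite (bigD1 1%g) //= [in RHS](bigD1 1%g) //= cfInd_torus1.
  rewrite !(lin_char1 (lin_torus _)) rmorph1 rmorphM rmorphD /= sR.
  have -> : qR^* = qR by rewrite rmorph_nat.
  rewrite [RHS]addrAC; congr (_ + _); first by ring.
  apply: eq_bigr => x /andP[Xx ntx].
  rewrite cfInd_torusE // rmorphD /= mulrDr; congr (_ + _ * _).
  by rewrite (lin_charV_conj (lin_torus j)) // conjCK.
rewrite big_split /= mulrDr [X in X + _]mulrDr -cfdotE cfdot_irr.
have -> : #|X|%:R^-1 * (\sum_(x in X) 'chi_i x * 'chi_j x) = (conjC_Iirr i == j)%:R.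
  rewrite eq_sym -cfdot_irr cfdotE; congr (_ * _); apply: eq_bigr => x Xx.
  by rewrite conjC_IirrE cfunE conjCK mulrC.
congr (_ + _); rewrite cX; apply: (mulfI nzqs).
have -> : (qR - s) * (((qR - s) / 2%:R)^-1 * (qR * (qR + s) - 2%:R))
  = 2%:R * (qR * (qR + s) - 2%:R) by field.
by apply: eq_of_sub_eq (congr1 (fun t => 4%:R * t) s2) _; ring.
Qed.

(** All terms in q cancel, and the orthogonality relation of Deligne-Lusztig characters remains: its
    two terms come from the two cosets of [X] in [N]. *)
Lemma rho_torus_dot i j : '[rho_torus i, rho_torus j] = (i == j)%:R + (conjC_Iirr i == j)%:R.
Proof.
have IG : '['Ind[G] 'chi[X]_i, Gam] = 2%:R * (qR + s).
  by rewrite cfdotC Gam_Ind_dot rmorphM rmorph_nat rmorphD /= sR rmorph_nat.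
rewrite cfdotBl !cfdotBr Ind_torus_dot_self Gam_Ind_dot Gam_norm IG.
by ring.
Qed.

Definition sing_Iirr : pred (Iirr X) := [pred i | ~~ (M \subset cfker 'chi_i)].

Lemma sing_IirrC i : sing_Iirr i -> sing_Iirr (conjC_Iirr i).
Proof. by rewrite /sing_Iirr /= conjC_IirrE cfker_aut. Qed.

(** A real linear character takes the values 1 and -1 only, hence is trivial on the group [M] of odd
    order. *)
Lemma sing_Iirr_nonreal i : sing_Iirr i -> conjC_Iirr i != i.
Proof.
apply: contra => /eqP eqi; apply/subsetP=> x Mx; have Xx := subsetP sMX x Mx.
have lin := lin_torus i; rewrite cfkerEchar ?irr_char // inE Xx /= (lin_char1 lin).
have xR : ('chi_i x)^* = 'chi_i x by rewrite -{2}eqi conjC_IirrE cfunE.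
have x2 : 'chi_i x ^+ 2 = 1.
  by rewrite expr2 -{2}xR -normCK (normC_lin_char lin Xx) expr1n.
have xM : 'chi_i x ^+ #|M| = 1.
  rewrite -(lin_charX lin _ Xx) (_ : x ^+ #|M| = 1)%g ?(lin_char1 lin) //.
  by apply/eqP; rewrite -order_dvdn order_dvdG.
move: xM; rewrite -(odd_double_half #|M|) (tor_oddM tX) exprD expr1 -muln2 mulnC exprM x2.
by rewrite expr1n mulr1 => ->.
Qed.

Lemma rho_torus_norm i : sing_Iirr i -> '[rho_torus i] = 1.
Proof. by move/sing_Iirr_nonreal => nr; rewrite rho_torus_dot eqxx (negPf nr) addr0. Qed.

(** A character of [X] and its conjugate give the same [rho_torus], so this is twice the sum over
    the distinct ones. *)
Definition Delta_torus : 'CF(G) := \sum_(i | sing_Iirr i) rho_torus i.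

Lemma Delta_rho_dot i : sing_Iirr i -> '[Delta_torus, rho_torus i] = 2%:R.
Proof.
move=> si; have nr := sing_Iirr_nonreal si.
rewrite cfdot_suml (bigD1 i) //= (bigD1 (conjC_Iirr i)) /=; last by rewrite sing_IirrC.
rewrite !rho_torus_dot eqxx (negPf nr) conjC_IirrK eqxx big1 => [|j];
  first by rewrite !(addr0, add0r).
case/andP=> /andP[_ nji] njc; rewrite rho_torus_dot (negPf nji).
rewrite (_ : (conjC_Iirr j == i) = false) ?addr0 //; apply: contraNF njc => /eqP <-.
by rewrite conjC_IirrK.
Qed.

Lemma sum_sing_Iirr : \sum_(i | sing_Iirr i) 'chi_i = cfReg X - 'Ind[X, M] 1.
Proof.
have -> : cfReg X = \sum_i 'chi_i.
  by rewrite cfReg_sum; apply: eq_bigr => i _; rewrite (lin_char1 (lin_torus i)) scale1r.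
suff -> : 'Ind[X, M] 1 = \sum_(i | ~~ sing_Iirr i) 'chi_i.
  by rewrite [in RHS](bigID sing_Iirr) /= addrK.
rewrite ['Ind 1]cfun_sum_cfdot [RHS]big_mkcond; apply: eq_bigr => i _.
rewrite -cfdot_Res_r /sing_Iirr /= negbK.
have linM : 'Res[M] 'chi_i \is a linear_char by rewrite cfRes_lin_char ?lin_torus.
have [|nsM] := boolP (M \subset _) => [sMk|].
  have -> : 'Res[M] 'chi_i = 1.
    apply/cfun_inP=> x Mx; rewrite cfun1E Mx cfResE //.
    by have := subsetP sMk x Mx; rewrite cfkerEchar ?irr_char //
      inE (lin_char1 (lin_torus i)) => /andP[_ /eqP].
  by rewrite cfnorm1 scale1r.
have /irrP[j defj] := lin_char_irr linM.
rewrite defj -irr0 cfdot_irr; case: eqP => [j0|_]; last by rewrite scale0r.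
case/negP: nsM; apply/subsetP=> x Mx; have Xx := subsetP sMX x Mx.
rewrite cfkerEchar ?irr_char // inE Xx (lin_char1 (lin_torus i)) /=.
by rewrite -(cfResE _ sMX Mx) defj -j0 irr0 cfun1E Mx.
Qed.

(** The closed form in permutation characters makes the divisibility of the idempotent's
    coefficients accessible. *)
Lemma Delta_torusE x : x \in G -> Delta_torus x =
  #|G|%:R * (x == 1%g)%:R - 'Ind[G, M] 1 x - (#|X|%:R - #|X : M|%:R) * Gam x.
Proof.
move=> Gx; rewrite /Delta_torus sumrB -linear_sum /= sum_sing_Iirr linearB /= cfIndInd //.
rewrite sumr_const -scaler_nat !cfunE; congr (_ - _ - _ * _).
  rewrite cfIndE //; apply: (canLR (mulKf (neq0CG X))).
  rewrite (eq_bigr (fun=> #|X|%:R * (x == 1%g)%:R)) => [|y Gy]; last first.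
    by rewrite cfRegE conjg_eq1 mulr_natr mulrb.
  by rewrite sumr_const -[LHS]mulr_natl mulrCA.
have := congr1 (fun f : 'CF(X) => f 1%g) sum_sing_Iirr.
rewrite sum_cfunE (eq_bigr (fun=> 1)) => [|i _]; last exact: lin_char1 (lin_torus i).
rewrite sumr_const => e; apply: etrans e _; rewrite cfunE cfRegE eqxx [X in _ + X]cfunE cfInd1 //.
by rewrite cfun11 mulr1.
Qed.

(** Norm 1 leaves an irreducible up to sign, and the factor [s] makes the degree equal to
    [q + s]. *)
Lemma signed_rho_torus_char i : sing_Iirr i -> exists j, s *: rho_torus i = 'chi_j.
Proof.
move=> si; have Z := rho_torusZ i.
have Zs : s *: rho_torus i \in 'Z[irr G].
  have : s = 1 \/ s = -1.
    move/eqP: (tor_sq tX); rewrite sqrf_eq1 => /orP[]/eqP->; by [left | right].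
  by case=> ->; rewrite ?scale1r // scaleN1r rpredN.
have n1 : '[s *: rho_torus i] = 1.
  by rewrite cfdotZl cfdotZr sR mulrA s2 mul1r rho_torus_norm.
have [b [j e]] := vchar_norm1P Zs n1; exists j; rewrite e.
have : (s *: rho_torus i) 1%g = qR + s by rewrite cfunE rho_torus1 mulrA s2 mul1r.
rewrite e cfunE; case: b {e} => [e|_]; last by rewrite expr0 scale1r.
have pos : 0 < 'chi_j 1%g := irr1_gt0 j.
have qs : 0 <= qR + s.
  have -> : qR + s = qR - 1 + (1 + s) by ring.
  rewrite addr_ge0 ?subr_ge0 ?ler1n 1?ltnW //.
  move/eqP: (tor_sq tX); rewrite sqrf_eq1 => /orP[]/eqP->; last by rewrite subrr.
  by rewrite addr_ge0 ?ler01.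
by move: qs; rewrite -e expr1 mulN1r oppr_ge0 => /(lt_le_trans pos); rewrite ltxx.
Qed.

End OneTorus.

Section TwoTori.

Variables (X N M X' N' M' : {group gT}) (s s' : algC).
Hypotheses (tX : torus X N M s) (tX' : torus X' N' M' s').
Hypothesis ss' : s' = - s.
Hypothesis disjXX' : forall x y, x \in X -> x != 1%g -> y \in G -> (x ^ y)%g \notin X'.

(** Conjugates of the two tori meet only in 1, whose contribution cancels against the products with
    [Gam] because [s' = - s]. *)
Lemma rho_torus_dot_cross i j : '[rho_torus (X := X) i, rho_torus (X := X') j] = 0.
Proof.
have s2 : s * s = 1 by rewrite -expr2 (tor_sq tX).
have nzqs : qR - s != 0 by rewrite -(tor_card tX) mulf_neq0 ?neq0CG // pnatr_eq0.
have cX : #|X|%:R = (qR - s) / 2%:R :> algC.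
  by rewrite -(tor_card tX) mulrC mulKf // pnatr_eq0.
have IG : '['Ind[G] 'chi[X]_i, Gam] = 2%:R * (qR + s).
  by rewrite cfdotC (Gam_Ind_dot tX) rmorphM rmorph_nat rmorphD /= (sR tX) rmorph_nat.
rewrite cfdotBl !cfdotBr (Gam_Ind_dot tX') Gam_norm IG (Ind_torus_dot tX).
rewrite (bigD1 1%g) //= big1 ?addr0 => [|x /andP[Xx ntx]]; last first.
  rewrite cfIndE ?(tor_XG tX') // big1 ?mulr0 ?rmorph0 ?mulr0 // => y Gy.
  by rewrite cfun0 // disjXX'.
rewrite (cfInd_torus1 tX') (lin_char1 (lin_torus tX i)) rmorphM rmorphD /= (sR tX').
rewrite rmorph_nat -/qR ss' cX mul1r.
have -> : ((qR - s) / 2%:R)^-1 * (qR * (qR - s)) = 2%:R * qR by field.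
by ring.
Qed.

(* Twice the sum of [chi 1 * chi], and twice the sum of [chi], over the
   irreducible characters [chi = +- rho_torus i]. *)
Definition two_f : 'CF(G) :=
  (s * (qR + s)) *: Delta_torus X M + (s' * (qR + s')) *: Delta_torus X' M'.
Definition two_rest : 'CF(G) := s *: Delta_torus X M + s' *: Delta_torus X' M'.

Lemma Delta_rho_dot_cross j : '[Delta_torus X M, rho_torus (X := X') j] = 0.
Proof. by rewrite cfdot_suml big1 // => i _; rewrite rho_torus_dot_cross. Qed.

Lemma Delta_rho_dot_cross' i : '[Delta_torus X' M', rho_torus (X := X) i] = 0.
Proof. by rewrite cfdot_suml big1 // => j _; rewrite cfdotC rho_torus_dot_cross rmorph0. Qed.

Let nzd (Y L K : {group gT}) t (tY : torus Y L K t) : t * (qR + t) != 0.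
Proof.
have t2 : t * t = 1 by rewrite -expr2 (tor_sq tY).
have nzt : t != 0 by apply: contra_eq_neq t2 => ->; rewrite mul0r eq_sym oner_eq0.
rewrite mulf_neq0 //.
have : (qR - t) * (qR + t) = (qR - 1) * (qR + 1) by apply: eq_of_sub_eq (esym t2) _; ring.
by move=> e; have := mulf_neq0 nzq1 nzq2; rewrite -e mulf_eq0 negb_or => /andP[].
Qed.

Let conv_Delta (Y L K : {group gT}) t (tY : torus Y L K t) (phi : 'CF(G)) c x : x \in G ->
    (forall i : Iirr Y, sing_Iirr K i -> '[phi, rho_torus i] = c) ->
  \sum_(y in G) (t * (qR + t)) * Delta_torus Y K (y * x)%g * phi y^-1%g =
    #|G|%:R * c * Delta_torus Y K x.
Proof.
move=> Gx cE.
transitivity (\sum_(i | sing_Iirr K i) t * (qR + t) *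
    (\sum_(y in G) rho_torus (X := Y) i (y * x)%g * phi y^-1%g)).
  under [RHS]eq_bigr do rewrite mulr_sumr.
  rewrite exchange_big; apply: eq_bigr => y Gy /=.
  by rewrite sum_cfunE mulr_sumr mulr_suml; apply: eq_bigr => i _; rewrite mulrA.
rewrite sum_cfunE mulr_sumr; apply: eq_bigr => i si.
rewrite conv_signed_irr // ?rho_torusZ ?(rho_torus_norm tY) // cE // (rho_torus1 tY).
by rewrite mulrCA; congr (_ * _); rewrite mulrC divfK // (nzd tY).
Qed.

Lemma conv_two_f (phi : 'CF(G)) c c' x : x \in G ->
    (forall i : Iirr X, sing_Iirr M i -> '[phi, rho_torus i] = c) ->
    (forall i : Iirr X', sing_Iirr M' i -> '[phi, rho_torus i] = c') ->
  \sum_(y in G) two_f (y * x)%g * phi y^-1%g =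
    #|G|%:R * (c * Delta_torus X M x + c' * Delta_torus X' M' x).
Proof.
move=> Gx cE c'E; rewrite mulrDr !mulrA -(conv_Delta tX Gx cE) -(conv_Delta tX' Gx c'E).
by rewrite -big_split; apply: eq_bigr => y _ /=; rewrite !cfunE mulrDl.
Qed.

(** Hence [two_f / (2 |G|)] is the central idempotent of the irreducibles in Rest. *)
Lemma two_f_idem x : x \in G ->
  \sum_(y in G) two_f (y * x)%g * two_f y^-1%g = 2%:R * #|G|%:R * two_f x.
Proof.
move=> Gx; rewrite (conv_two_f (c := 2%:R * (s * (qR + s))) (c' := 2%:R * (s' * (qR + s')))) //.
- by rewrite !cfunE; ring.
- move=> i si; rewrite cfdotDl !cfdotZl (Delta_rho_dot tX si) Delta_rho_dot_cross'.
  by rewrite mulr0 addr0 mulrC.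
move=> i si; rewrite cfdotDl !cfdotZl (Delta_rho_dot tX' si) Delta_rho_dot_cross.
by rewrite mulr0 add0r mulrC.
Qed.

(** Each irreducible in Rest has multiplicity 2 in [Gam], so the idempotent cuts [Gam] down to twice
    their sum. *)
Lemma two_f_Gam x : x \in G ->
  \sum_(y in G) two_f (y * x)%g * Gam y^-1%g = 2%:R * #|G|%:R * two_rest x.
Proof.
move=> Gx; rewrite (conv_two_f (c := 2%:R * s) (c' := 2%:R * s')) //.
- by rewrite !cfunE; ring.
- by move=> i _; apply: Gam_rho_dot tX _.
by move=> i _; apply: Gam_rho_dot tX' _.
Qed.

Lemma two_f_orth (h : 'CF(G)) x : x \in G ->
    (forall i : Iirr X, '[h, rho_torus i] = 0) ->
    (forall i : Iirr X', '[h, rho_torus i] = 0) ->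
  \sum_(y in G) two_f (y * x)%g * h y^-1%g = 0.
Proof.
by move=> Gx h0 h0'; rewrite (conv_two_f (c := 0) (c' := 0)) // !mul0r addr0 mulr0.
Qed.

Lemma two_rest_char : exists2 psi, psi \is a character & two_rest = 2%:R *: psi.
Proof.
have nz2 : 2%:R != 0 :> algC by rewrite pnatr_eq0.
exists (2%:R^-1 *: two_rest); last by rewrite scalerA mulfV // scale1r.
rewrite [_ *: _]cfun_sum_cfdot rpred_sum // => j _; rewrite cfdotZl.
suff [->|->] : '[two_rest, 'chi_j] = 0 \/ '[two_rest, 'chi_j] = 2%:R.
- by rewrite mulr0 scale0r rpred0.
- by rewrite mulVf // scale1r irr_char.
have tt (Y L K : {group gT}) t (tY : torus Y L K t) : t * t = 1 by rewrite -expr2 (tor_sq tY).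
have [i /= /andP[si /eqP <-]|noX] := pickP [pred i | sing_Iirr M i && (s *: rho_torus (X := X)
  i == 'chi_j)].
  right; rewrite cfdotZr cfdotDl !cfdotZl (sR tX).
  rewrite (Delta_rho_dot tX si) Delta_rho_dot_cross' mulr0 addr0.
  by rewrite mulrA (tt _ _ _ _ tX) mul1r.
have [i /= /andP[si /eqP <-]|noX'] := pickP [pred i | sing_Iirr M' i && (s' *: rho_torus (X :=
  X') i == 'chi_j)].
  right; rewrite cfdotZr cfdotDl !cfdotZl (sR tX').
  rewrite (Delta_rho_dot tX' si) Delta_rho_dot_cross mulr0 add0r.
  by rewrite mulrA (tt _ _ _ _ tX') mul1r.
left.
have z (Y L K : {group gT}) t (tY : torus Y L K t) :
    (forall i, sing_Iirr K i && (t *: rho_torus (X := Y) i == 'chi_j) = false) ->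
    '[t *: Delta_torus Y K, 'chi_j] = 0.
  move=> noY; rewrite scaler_sumr cfdot_suml big1 // => i si.
  have [j' ej'] := signed_rho_torus_char tY si; rewrite ej' cfdot_irr.
  by have := noY i; rewrite si ej' /= (inj_eq irr_inj) => ->.
by rewrite cfdotDl (z _ _ _ _ tX) ?(z _ _ _ _ tX') ?addr0.
Qed.

End TwoTori.

End TorusCharacters.

Section InducedTrivial.

Variables (gT : finGroupType) (G : {group gT}).

Lemma cfInd1_fix_cosets (H : {group gT}) x : H \subset G -> x \in G ->
  'Ind[G, H] 1 x = (fix_cosets G H x)%:R.
Proof.
move=> sHG Gx; rewrite cfIndE //; apply: (canLR (mulKf (neq0CG H))).
rewrite -natrM mulnC card_fix_cosets // -sum1_card natr_sum big_mkcond [RHS]big_mkcond /=.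
apply: eq_bigr => y _; rewrite inE; case: (y \in G) => //=.
by rewrite cfun1E; case: (_ \in H).
Qed.

End InducedTrivial.

(** * Unipotent elements, Gamma and the trace of the quadratic operator *)

Section Tori.

Variables (k : finFieldType) (gT : finGroupType) (G U B T0 N0 T1 N1 : {group gT}).
Variable u : k -> gT.
Hypothesis ps : psl2_structure G U B T0 N0 T1 N1 u.
Hypothesis k2 : 2%:R != 0 :> k.

Let sBG := ps_sBG ps.
Let sUG : U \subset G := subset_trans (ps_sUB ps) sBG.
Let sT0G : T0 \subset G := subset_trans (ps_sT0B ps) sBG.
Let sT1G : T1 \subset G := subset_trans (ps_sT1N1 ps) (ps_sN1G ps).

Definition unip_class := class_support U^# G.
Local Notation CU := unip_class.

Lemma unip_classP x : reflect (x != 1%g /\ conj_into G U x) (x \in CU).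
Proof. exact: class_supportP. Qed.

Lemma conj_into_expg (X : {group gT}) x : conj_into G X x -> (x ^+ #|X| == 1)%g.
Proof. by case=> g _ Xxg; rewrite -(expg_eq1J _ _ g) (order_dvd Xxg). Qed.

Lemma unip_class_expg x : x \in G -> (x \in CU) = (x != 1%g) && (x ^+ #|k| == 1)%g.
Proof.
move=> Gx; apply/unip_classP/andP=> [[nt /conj_into_expg]|[nt xq]].
  by rewrite (card_U ps).
split=> //; case: (psl2_cover ps Gx nt) => // /conj_into_expg xT; case/eqP: nt.
  exact: coprime_expg_eq1 (coprime_q_T0 ps) (eqP xq) (eqP xT).
exact: coprime_expg_eq1 (coprime_q_T1 ps) (eqP xq) (eqP xT).
Qed.

Lemma unip_class_T0 x g : x \in CU -> g \in G -> (x ^ g)%g \notin T0.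
Proof.
move=> CUx Gg; have [nt [h Gh Uxh]] := unip_classP _ CUx; apply/negP=> Txg.
have /conj_into_expg xT : conj_into G T0 x by exists g.
have Gx : x \in G by rewrite -(groupJr _ Gh) (subsetP sUG).
move: CUx; rewrite unip_class_expg // => /andP[_ /eqP xq]; case/eqP: nt.
exact: coprime_expg_eq1 (coprime_q_T0 ps) xq (eqP xT).
Qed.

Lemma unip_class_T1 x g : x \in CU -> g \in G -> (x ^ g)%g \notin T1.
Proof.
move=> CUx Gg; have [nt [h Gh Uxh]] := unip_classP _ CUx; apply/negP=> Txg.
have /conj_into_expg xT : conj_into G T1 x by exists g.
have Gx : x \in G by rewrite -(groupJr _ Gh) (subsetP sUG).
move: CUx; rewrite unip_class_expg // => /andP[_ /eqP xq]; case/eqP: nt.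
exact: coprime_expg_eq1 (coprime_q_T1 ps) xq (eqP xT).
Qed.

Lemma joing_U_T0 : U <*> T0 = B.
Proof.
apply/eqP; rewrite eqEcard (joing_U_sub ps (subxx T0)) (ps_cardB ps).
by rewrite (card_joing_U ps (subxx T0)) leqnn.
Qed.

Lemma card_psl2 : (2 * #|G| = #|k| * (#|k| ^ 2 - 1))%N.
Proof.
by rewrite (ps_cardG ps) (ps_cardB ps) -[(#|k| ^ 2)%N]/(#|k| * #|k|)%N (card_q ps); nia.
Qed.

Lemma psl2_gt1 : (1 < #|k|)%N.
Proof. exact: finNzRing_gt1. Qed.

Lemma index_borel : #|G : B| = #|k|.+1.
Proof. by rewrite -divgS // (ps_cardG ps) mulKn. Qed.

Lemma card_unip_class : #|CU|%:R = #|k|%:R ^+ 2 - 1 :> algC.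
Proof.
rewrite /CU (card_class_support_TI sBG (memJ_U ps)) (card_U ps).
rewrite index_borel natrM -subn1 natrB ?(ltnW psl2_gt1) // -natr1.
by ring.
Qed.

Definition Gamma_val x : int := (fix_cosets G T0 x)%:Z - (fix_cosets G B x)%:Z.

Definition Gamma : 'CF(G) := 'Ind[G, T0] 1 - 'Ind[G, B] 1.

Lemma GammaE x : x \in G -> Gamma x = (Gamma_val x)%:~R.
Proof.
by move=> Gx; rewrite !cfunE !cfInd1_fix_cosets // rmorphB /= -!pmulrn.
Qed.

Lemma Gamma_char : Gamma \is a character.
Proof.
rewrite /Gamma -(cfIndInd 1 sBG (ps_sT0B ps)) -linearB cfInd_char //=.
have /(constt_charP 0 _)-/(_ (cfInd_char _ (cfun1_char T0)))[psi Cpsi ->] :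
    0 \in irr_constt ('Ind[B, T0] 1).
  rewrite irr_consttE irr0 -cfdot_Res_r cfRes_cfun1 ?(ps_sT0B ps) // cfnorm1.
  exact: oner_neq0.
by rewrite irr0 addrC addKr.
Qed.

Lemma Gamma1 : Gamma 1%g = #|k|%:R ^+ 2 - 1.
Proof.
rewrite GammaE // /Gamma_val !fix_cosets1 //.
have iT : #|B : T0| = #|k| by rewrite -divgS ?(ps_sT0B ps) // (ps_cardB ps) mulnK.
rewrite -(Lagrange_index sBG (ps_sT0B ps)) index_borel iT rmorphB /= -!pmulrn natrM -natr1; ring.
Qed.

Lemma fix_cosets_B x : x \in G -> x != 1%g ->
  fix_cosets G B x = ((x \in CU) + fix_cosets G T0 x)%N.
Proof.
move=> Gx nt; rewrite -[in LHS]joing_U_T0 (fix_cosets_joing_U ps (subxx T0)) //.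
by rewrite indexgg mul1n unip_class_expg // nt.
Qed.

Lemma Gamma_val_ntriv x : x \in G -> x != 1%g -> Gamma_val x = - ((x \in CU) : nat)%:Z.
Proof. by move=> Gx nt; rewrite /Gamma_val fix_cosets_B // PoszD; ring. Qed.

Lemma GammaU x : x \in CU -> Gamma x = -1.
Proof.
move=> CUx; have [nt [g Gg Uxg]] := unip_classP _ CUx.
have Gx : x \in G by rewrite -(groupJr _ Gg) (subsetP sUG).
by rewrite GammaE // Gamma_val_ntriv // CUx.
Qed.

Lemma Gamma0 x : x \in G -> x != 1%g -> x \notin CU -> Gamma x = 0.
Proof. by move=> Gx nt /negPf nCUx; rewrite GammaE // Gamma_val_ntriv // nCUx. Qed.

Lemma torus_T0 (M : {group gT}) : M \subset T0 -> odd #|M| ->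
  torus G #|k| CU T0 N0 M 1.
Proof.
move=> sMT oddM; have T0G g := @unip_class_T0 ^~ g.
split=> //; rewrite ?(ps_sN0G ps) ?(ps_sT0N0 ps) ?(ps_abT0 ps) ?(ps_cardN0 ps) ?expr1n //.
- by move=> x g Tx nt Gg; apply: (memJ_sub_T0 ps (subxx T0)).
- exact: ps_invT0 ps.
- by rewrite (card_q ps) -[(#|T0| * 2).+1%:R]natr1 addrK natrM mulrC.
- by move=> x Tx; apply/negP=> /unip_class_T0/(_ (group1 G)); rewrite conjg1 Tx.
- exact: unip_class_T0.
Qed.

Lemma torus_T1 (M : {group gT}) : M \subset T1 -> odd #|M| ->
  torus G #|k| CU T1 N1 M (-1).
Proof.
move=> sMT oddM.
split=> //; rewrite ?(ps_sN1G ps) ?(ps_sT1N1 ps) ?(ps_abT1 ps) ?(ps_cardN1 ps) ?sqrrN ?expr1n //.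
- by move=> x g Tx nt Gg; apply: (memJ_sub_T1 ps (subxx T1)).
- exact: ps_invT1 ps.
- by rewrite opprK natr1 -(ps_cardT1 ps) natrM mulrC.
- by move=> x Tx; apply/negP=> /unip_class_T1/(_ (group1 G)); rewrite conjg1 Tx.
- exact: unip_class_T1.
Qed.

Lemma disjoint_T0_T1 x y : x \in T0 -> x != 1%g -> y \in G -> (x ^ y)%g \notin T1.
Proof.
move=> Tx nt Gy; apply: contra nt => Txy; apply/eqP.
apply: coprime_expg_eq1 (coprime_T0_T1 ps) (order_dvd Tx) _.
by apply/eqP; rewrite -(expg_eq1J _ _ y) (order_dvd Txy).
Qed.

(* [#|T0|] times the trace on R[G / T0] of the operator sending [T0 x] to
   [\sum_b quad_char b * T0 (u b) x]. *)
Definition unip_gauss (x : gT) : int :=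
  \sum_(c in G) \sum_b quad_char b * (((x ^ c) * (u b)^-1)%g \in T0)%:R.

Lemma unip_gauss_class_fun :
  is_class_fun <<G>> [ffun x => if x \in G then (unip_gauss x)%:~R else 0 : algC].
Proof.
rewrite genGid; apply: intro_class_fun => [x g Gx Gg | x /negPf-> //].
rewrite groupJ // Gx; congr _%:~R; rewrite [RHS](reindex_inj (mulgI g)) /=.
by apply: eq_big => [c|c Gc]; rewrite ?groupMl // conjgM.
Qed.

Definition unip_gauss_cfun : 'CF(G) := Cfun 0 unip_gauss_class_fun.

Lemma unip_gauss_cfunE x : x \in G -> unip_gauss_cfun x = (unip_gauss x)%:~R.
Proof. by move=> Gx; rewrite /unip_gauss_cfun !cfunE ?ffunE Gx. Qed.

(** If [t] acts on [U] by the multiplier [a^2], conjugation by [u c] multiplies [t] by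
    [u ((1 - a^2) c)]; and [a^2] is not 1 because a nontrivial [t] centralizes no nontrivial element
    of [U]. *)
Lemma conj_T0_unip t b : t \in T0 -> t != 1%g -> exists2 g, g \in G & (t ^ g = t * u b)%g.
Proof.
move=> Tt nt; have Bt : t \in B := subsetP (ps_sT0B ps) t Tt.
have [a nza ua] := ps_uJ ps Bt.
have Uu c : u c \in U by rewrite (ps_U ps) imset_f.
have u0 : u 0 = 1%g by apply: (mulgI (u 0)); rewrite -(ps_uD ps) addr0 mulg1.
have uV c : (u c)^-1%g = u (- c).
  by apply: (mulgI (u c)); rewrite mulgV -(ps_uD ps) subrr u0.
have nz : 1 - a ^+ 2 != 0.
  rewrite subr_eq0; apply: contraNneq (oner_neq0 k) => a2.
  rewrite -(inj_eq (ps_u_inj ps)) u0; apply/eqP/(cent_U_T0 ps (Uu 1) Tt nt).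
  by apply/commgP/conjg_fixP; rewrite ua -a2 mul1r.
exists (u (b / (1 - a ^+ 2))); first exact: subsetP sUG _ (Uu _).
rewrite conjgE uV mulgA (conjgC _ t) ua -mulgA -(ps_uD ps); congr (_ * u _)%g.
by apply: (mulIf nz); rewrite mulrN mulrDl mulNr -!mulrA mulVf //; ring.
Qed.

Lemma conv_cfun_conj (rho : 'CF(G)) g : g \in G ->
  \sum_(x in G) (\sum_(c in G) ((x ^ c)%g == g)%:R) * (rho x)^* = #|G|%:R * (rho g)^*.
Proof.
move=> Gg; under eq_bigr do rewrite mulr_suml.
rewrite exchange_big mulr_natl -sumr_const; apply: eq_bigr => c Gc /=.
rewrite (bigD1 (g ^ c^-1)%g) ?groupJ ?groupV //= conjgKV eqxx mul1r.
rewrite big1 ?addr0 ?cfunJ ?groupV // => x /andP[_ neq_x].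
by rewrite (can2_eq (conjgK c) (conjgKV c)) (negPf neq_x) mul0r.
Qed.

(* [t u_b] is conjugate to [t] if [t != 1], and [rho] is constant on [CU]: in
   both cases the sum over [b] is a multiple of the sum of the quadratic
   character. *)
Lemma unip_gauss_orth (rho : 'CF(G)) : (forall x, x \in CU -> rho x = 1) ->
  '[unip_gauss_cfun, rho] = 0.
Proof.
move=> rhoU; rewrite cfdotE; apply/eqP; rewrite mulf_eq0; apply/orP; right; apply/eqP.
have sumq : \sum_(b : k) (quad_char b)%:~R = 0 :> algC by rewrite -rmorph_sum sum_quad_char.
have Uu b : u b \in U by rewrite (ps_U ps) imset_f.
have Gu b : u b \in G := subsetP sUG _ (Uu b).
have u0 : u 0 = 1%g by apply: (mulgI (u 0)); rewrite -(ps_uD ps) addr0 mulg1.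
transitivity (\sum_(t in T0) \sum_b (quad_char b)%:~R * (#|G|%:R * (rho (t * u b)%g)^*)).
  transitivity (\sum_(t in T0) \sum_b (quad_char b)%:~R *
    (\sum_(x in G) (\sum_(c in G) ((x ^ c)%g == (t * u b)%g)%:R) * (rho x)^*)); last first.
    apply: eq_bigr => t Tt; apply: eq_bigr => b _; rewrite conv_cfun_conj //.
    by rewrite groupM // (subsetP sT0G).
  under [RHS]eq_bigr do under eq_bigr do rewrite mulr_sumr.
  under [RHS]eq_bigr do rewrite exchange_big.
  rewrite [RHS]exchange_big /=; apply: eq_bigr => x Gx.
  under [RHS]eq_bigr do under eq_bigr do rewrite mulrA.
  under [RHS]eq_bigr do rewrite -mulr_suml.
  rewrite -mulr_suml unip_gauss_cfunE // /unip_gauss rmorph_sum; congr (_ * _).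
  under [RHS]eq_bigr do under eq_bigr do rewrite mulr_sumr.
  under [RHS]eq_bigr do rewrite exchange_big.
  rewrite [RHS]exchange_big /=; apply: eq_bigr => c Gc.
  rewrite [RHS]exchange_big rmorph_sum; apply: eq_bigr => b _ /=.
  rewrite rmorphM rmorph_nat -mulr_sumr -natr_sum; congr (_ * _%:R).
  have [Tx|nTx] := boolP ((x ^ c * (u b)^-1)%g \in T0).
    rewrite (bigD1 _ Tx) /= mulgKV eqxx big1 // => t /andP[_ neq_t].
    by apply/eqP; rewrite eqb0; apply: contra neq_t => /eqP->; rewrite mulgK.
  rewrite big1 // => t Tt; apply/eqP; rewrite eqb0; apply: contra nTx => /eqP->.
  by rewrite mulgK.
apply: big1 => t Tt; have [->|ntt] := eqVneq t 1%g.
  transitivity ((\sum_(b : k) (quad_char b)%:~R) * #|G|%:R : algC); last by rewrite sumq mul0r.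
  rewrite mulr_suml; apply: eq_bigr => b _.
  have [->|nzb] := eqVneq b 0; first by rewrite quad_char0 !mul0r.
  rewrite mul1g rhoU ?rmorph1 ?mulr1 //; apply/unip_classP; split.
    by rewrite -u0 (inj_eq (ps_u_inj ps)).
  by exists 1%g; rewrite ?conjg1.
transitivity ((\sum_(b : k) (quad_char b)%:~R) * (#|G|%:R * (rho t)^*) : algC);
  last by rewrite sumq mul0r.
rewrite mulr_suml; apply: eq_bigr => b _.
by have [g Gg <-] := conj_T0_unip b Tt ntt; rewrite cfunJ.
Qed.

End Tori.

(** * The case p = 2 with q odd *)

Section TorusFixedPoints.

Variables (gT : finGroupType) (G : {group gT}) (q : nat) (CU : {set gT}).
Variables (X N M : {group gT}) (s : algC).
Hypothesis tX : torus G q CU X N M s.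

Let sXG := tor_XG tX.
Let sNG := tor_NG tX.
Let sMX := tor_MX tX.

Lemma torus_memJ_sub (L : {group gT}) x g : L \subset X -> x \in L -> x != 1%g -> g \in G ->
  ((x ^ g)%g \in L) = (g \in N).
Proof.
move=> sLX Lx nt Gg; have Xx := subsetP sLX x Lx.
apply/idP/idP=> [/(subsetP sLX)|Ng]; first by rewrite (tor_memJ tX).
have [Xg|nXg] := boolP (g \in X).
  by rewrite conjgE (centsP (tor_ab tX) _ Xx _ Xg) mulKg.
by rewrite (tor_inv tX Xx Ng nXg) groupV.
Qed.

Lemma torus_fix_cosets x : x != 1%g -> conj_into G M x ->
  fix_cosets G M x = (#|X : M| * 2)%N.
Proof.
move=> nt Mx; apply/eqP; rewrite -(eqn_pmul2r (cardG_gt0 M)).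
rewrite card_fix_cosets ?(subset_trans sMX) //.
rewrite (card_conj_into_TI sNG (fun y g => @torus_memJ_sub M y g sMX) nt Mx).
by rewrite (tor_cardN tX) mulnAC [(#|X : M| * _)%N]mulnC Lagrange.
Qed.

Lemma torus_index : #|G : M| = (#|G : N| * (#|X : M| * 2))%N.
Proof.
rewrite -(Lagrange_index sXG sMX) -(Lagrange_index sNG (tor_XN tX)).
by rewrite -(divgS (tor_XN tX)) (tor_cardN tX) mulKn // mulnA mulnAC.
Qed.

(** [N / M], of order [2 |X : M|], acts freely on the fixed cosets. These factors supply the powers
    of 2 cancelled in the idempotent. *)
Lemma torus_fix_cosets_dvd x : x \in G -> (#|X : M| * 2 %| fix_cosets G M x)%N.
Proof.
move=> Gx; have sMG := subset_trans sMX sXG.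
have [->|nt] := eqVneq x 1%g; first by rewrite fix_cosets1 // torus_index dvdn_mull.
have [/existsP[g /andP[Gg Mxg]]|/existsPn nM] :=
    boolP [exists g, (g \in G) && ((x ^ g)%g \in M)].
  by rewrite torus_fix_cosets //; exists g.
rewrite fix_cosets_conj_none // => -[g Gg Mxg].
by have := nM g; rewrite Gg Mxg.
Qed.

(** An element of [N] outside [X] inverts [y], so it centralizes [y] only if [y^2 = 1], which the
    odd order excludes. *)
Lemma torus_cent y : y \in X -> y != 1%g -> odd #[y]%g -> 'C_G[y] = X.
Proof.
move=> Xy nt oddy; apply/setP=> c; rewrite inE cent1E.
apply/andP/idP=> [[Gc /eqP cyc]|Xc]; last first.
  by rewrite (subsetP sXG) // (centsP (tor_ab tX) _ Xy _ Xc).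
have yc : (y ^ c = y)%g by rewrite conjgE -cyc mulKg.
apply/negP=> /negP nXc; have Nc : c \in N by rewrite -(tor_memJ tX Xy nt Gc) yc.
have := tor_inv tX Xy Nc nXc; rewrite yc => yV; case/eqP: nt.
have y2 : (y ^+ 2 = 1)%g by rewrite expgS expg1 {1}yV mulVg.
apply: (@coprime_expg_eq1 _ 2 #[y]%g) => //; last exact: expg_order.
by rewrite coprime2n.
Qed.

End TorusFixedPoints.

(** * Psi at the prime 2, through the torus X of even order and the torus X' of odd order *)

Section EvenTorus.

Variables (k : finFieldType) (gT : finGroupType) (G U B T0 N0 T1 N1 : {group gT}).
Variable u : k -> gT.
Hypothesis ps : psl2_structure G U B T0 N0 T1 N1 u.
Hypothesis k2 : 2%:R != 0 :> k.
Local Notation CU := (unip_class G U).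

Variables (X N X' N' M : {group gT}) (s : int).
Hypothesis tX : torus G #|k| CU X N M s%:~R.
Hypothesis tX' : torus G #|k| CU X' N' X' (- s%:~R).
Hypothesis defM : M = 'O_(2%N^')(X)%G.
Hypothesis cover : forall x, x \in G -> x != 1%g ->
  [\/ conj_into G U x, conj_into G X x | conj_into G X' x].

Let sXG := tor_XG tX.
Let sX'G := tor_XG tX'.
Let oddX' := tor_oddM tX'.
Let sUG : U \subset G := subset_trans (ps_sUB ps) (ps_sBG ps).
Let nilX : nilpotent X := abelian_nil (tor_ab tX).
Let P := 'O_(2%N)(X)%G.

Lemma mem_pcore_abelian (pi : nat_pred) x : x \in X -> (x \in 'O_pi(X)) = pi.-elt x.
Proof.
move=> Xx; exact: (mem_normal_Hall (nilpotent_pcore_Hall pi nilX) (pcore_normal pi X)).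
Qed.

Lemma card_pcore2 : #|P| = #|X : M|.
Proof.
rewrite -divgS ?(tor_MX tX) // defM (card_Hall (nilpotent_pcore_Hall 2%N nilX)).
rewrite (card_Hall (nilpotent_pcore_Hall 2%N^' nilX)).
by rewrite -{2}(partnC 2%N (cardG_gt0 X)) mulnK // part_gt0.
Qed.

Lemma Psi_valJ p x g : x \in G -> g \in G -> Psi_val p G (x ^ g)%g = Psi_val p G x.
Proof.
move=> Gx Gg; apply/eqP; rewrite -(eqr_nat algC); apply/eqP.
have := cfunJ (Psi1 p G) x Gg; rewrite /Psi1 !cfunE ?ffunE groupJ // Gx.
exact.
Qed.

Let odd_elt (L : {group gT}) x : odd #|L| -> x \in L -> 2%N.-elt x -> x = 1%g.
Proof.
move=> oddL Lx p2x; apply/eqP; rewrite -order_eq1; apply/eqP.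
by apply: pnat_1 p2x _; rewrite -odd_2'nat; apply: dvdn_odd oddL; rewrite order_dvdG.
Qed.

Lemma Psi_val_unip x : x \in CU -> Psi_val 2 G x = 1%N.
Proof.
case/unip_classP=> nt [g Gg Uy]; have Gy := subsetP sUG _ Uy.
have Gx : x \in G by rewrite -(groupJr _ Gg).
rewrite -(Psi_valJ 2 Gx Gg); move: (x ^ g)%g Uy Gy (conjg_eq1 x g) => y Uy Gy.
rewrite (negPf nt) => /negbT nty; have oddU : odd #|U|.
  by rewrite (card_U ps) odd_card_field.
rewrite /Psi_val; have -> : 2%N^'.-elt y.
  by rewrite /p_elt -odd_2'nat; apply: dvdn_odd oddU; rewrite order_dvdG.
rewrite (_ : [set _ in _ | _] = [set 1%g]) ?cards1 //; apply/setP=> c;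
  rewrite in_set in_setI in_set1.
apply/idP/eqP=> [/andP[/andP[Gc /cent1P cyc] p2c]|->]; last first.
  by rewrite !group1 p_elt1.
by apply: odd_elt oddU _ p2c; apply: (ps_cU ps Uy nty Gc); apply: esym.
Qed.

Lemma Psi_val_odd x : x != 1%g -> conj_into G X' x -> Psi_val 2 G x = 1%N.
Proof.
move=> nt [g Gg Xy]; have Gy := subsetP sX'G _ Xy.
have Gx : x \in G by rewrite -(groupJr _ Gg).
rewrite -(Psi_valJ 2 Gx Gg); move: (x ^ g)%g Xy Gy (conjg_eq1 x g) => y Xy Gy.
rewrite (negPf nt) => /negbT nty.
have oddy : odd #[y]%g by apply: dvdn_odd oddX'; rewrite order_dvdG.
have p2'y : 2%N^'.-elt y by rewrite /p_elt -odd_2'nat.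
rewrite /Psi_val p2'y (torus_cent tX') //.
rewrite (_ : [set _ in _ | _] = [set 1%g]) ?cards1 //; apply/setP=> c; rewrite !inE.
apply/idP/eqP=> [/andP[Xc p2c]|->]; last by rewrite group1 p_elt1.
exact: odd_elt oddX' Xc p2c.
Qed.

Lemma Psi_val_even x : x \in X -> x != 1%g ->
  Psi_val 2 G x = if x \in M then #|X : M| else 0%N.
Proof.
move=> Xx nt; have -> : (x \in M) = 2%N^'.-elt x by rewrite defM mem_pcore_abelian.
rewrite /Psi_val; case: ifP => // p2'x.
rewrite (torus_cent tX) // ?odd_2'nat // -card_pcore2; apply: eq_card => c.
rewrite !inE; have [Xc|nXc] := boolP (c \in X); first by rewrite mem_pcore_abelian.
by apply/esym/negbTE; apply: contra nXc; apply/subsetP/pcore_sub.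
Qed.

(** Since [U] and [X'] have odd order, every nontrivial 2-element is conjugate into the Sylow
    2-subgroup of [X], whose conjugates meet trivially and are indexed by the cosets of [N]. *)
Lemma Psi_val1 : Psi_val 2 G 1%g = ((#|X : M|.-1 * #|G : N|).+1)%N.
Proof.
rewrite /Psi_val p_elt1; have memJ := torus_memJ_sub tX (pcore_sub 2%N X).
rewrite -card_pcore2 -(card_class_support_TI (tor_NG tX) memJ).
rewrite (_ : [set _ in _ | _] = 1%g |: class_support P^# G); last first.
  apply/setP=> x; rewrite in_set in_setI in_setU1; have [->|nt] /= := eqVneq x 1%g.
    by rewrite !group1 p_elt1.
  apply/andP/class_supportP=> [[/andP[Gx _] p2x]|[_ [g Gg Pxg]]]; last first.
    have Xxg := subsetP (pcore_sub 2%N X) _ Pxg; rewrite mem_pcore_abelian // p_eltJ in Pxg.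
    split=> //; rewrite -(groupJr _ Gg) (subsetP sXG) //=.
    by rewrite cent1E mulg1 mul1g.
  split=> //; case: (cover Gx nt) => -[g Gg xg].
  - case/eqP: nt; apply/eqP; rewrite -(conjg_eq1 _ g); apply/eqP.
    apply: odd_elt xg _; rewrite ?p_eltJ // (card_U ps) odd_card_field //.
  - by exists g; rewrite //= mem_pcore_abelian // p_eltJ.
  - case/eqP: nt; apply/eqP; rewrite -(conjg_eq1 _ g); apply/eqP.
    by apply: odd_elt xg _; rewrite ?p_eltJ.
rewrite cardsU1; case: class_supportP => [[/eqP]|_] //.
Qed.

Hypothesis disj : forall x y, x \in X -> x != 1%g -> y \in G -> (x ^ y)%g \notin X'.

Let q : algC := #|k|%:R.
Let sC : algC := s%:~R.
Let A := #|X : M|.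
Local Notation Gam := (Gamma G B T0).

Let cardG_C : 2%:R * #|G|%:R = q * (q ^+ 2 - 1) :> algC.
Proof.
have := congr1 (fun n => n%:R : algC) (card_psl2 ps k2).
by rewrite /= !natrM natrB ?natrX // expn_gt0 (ltnW (psl2_gt1 k)).
Qed.

Let sCU : CU \subset G^#.
Proof.
apply/subsetP=> x /unip_classP[nt [g Gg Uxg]].
by rewrite !inE nt -(groupJr _ Gg) (subsetP sUG).
Qed.

Let GamZ : Gam \in 'Z[irr G]. Proof. exact/char_vchar/(Gamma_char ps). Qed.

Let s2 : sC * sC = 1. Proof. by rewrite -expr2 (tor_sq tX). Qed.

Let cXX' : #|X'|%:R = #|X|%:R + sC.
Proof.
have nz2 : 2%:R != 0 :> algC by rewrite pnatr_eq0.
by apply: (mulfI nz2); rewrite mulrDr (tor_card tX) (tor_card tX') -/sC; ring.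
Qed.

Let qXX' : q = #|X|%:R + #|X'|%:R.
Proof.
have nz2 : 2%:R != 0 :> algC by rewrite pnatr_eq0.
by apply: (mulfI nz2); rewrite mulrDr (tor_card tX) (tor_card tX') -/q; ring.
Qed.

Let cXM : #|X|%:R = A%:R * #|M|%:R :> algC.
Proof. by rewrite -natrM mulnC Lagrange // (tor_MX tX). Qed.

Lemma index_torus_norm : #|G : N| = (#|k| * #|X'|)%N.
Proof.
apply/eqP; rewrite -(eqn_pmul2r (cardG_gt0 N)) mulnC Lagrange ?(tor_NG tX) //.
rewrite (tor_cardN tX) -(eqr_nat algC); apply/eqP.
have nz2 : 2%:R != 0 :> algC by rewrite pnatr_eq0.
apply: (mulfI nz2); rewrite cardG_C !natrM -/q.
have -> : q ^+ 2 - 1 = (2%:R * #|X|%:R) * (2%:R * #|X'|%:R) :> algC.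
  by rewrite (tor_card tX) (tor_card tX') -/sC -/q; apply: eq_of_sub_eq s2 _; ring.
by ring.
Qed.

(** The closed form of [two_rest]: the regular characters in the two [Delta_torus] cancel, and
    [|X'| = |X| + s] contracts the coefficient of Gamma. *)
Definition rest_val x : int :=
  s * ((fix_cosets G X' x)%:Z - (fix_cosets G M x)%:Z)
    + (1 - s + s * #|X : M|%:Z) * Gamma_val G B T0 x.

(** The closed form of [two_f], rewritten with [q + s = 2 |X'|], [q - s = 2 |X|] and
    [|X| = |X : M| |M|] so that the factor [4 |X : M|] can be extracted. *)
Definition cutoff_val x : int :=
  2%:R * #|G|%:Z * (x == 1%g)%:R - 2%:R * s * #|X'|%:Z * (fix_cosets G M x)%:Z
    + 2%:R * s * #|X : M|%:Z * #|M|%:Z * (fix_cosets G X' x)%:Z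
    + 2%:R * s * #|X : M|%:Z * (#|X'|%:Z - #|M|%:Z) * Gamma_val G B T0 x.

Local Notation rest := (two_rest Gam X M X' X' sC (- sC)).
Local Notation cutoff := (two_f #|k| Gam X M X' X' sC (- sC)).

Lemma two_restE x : x \in G -> rest x = (rest_val x)%:~R.
Proof.
move=> Gx; rewrite !cfunE (Delta_torusE Gam tX Gx) (Delta_torusE Gam tX' Gx).
rewrite !cfInd1_fix_cosets ?(subset_trans (tor_MX tX)) // indexgg (GammaE ps Gx).
rewrite /rest_val; move: (Gamma_val G B T0 x) => g;
  rewrite !(rmorphD, rmorphB, rmorphM, rmorphN, rmorph1) /= -!pmulrn -/sC -/A cXX'.
by apply: (eq_of_sub_eq (congr1 ( *%R g%:~R) s2)); ring.
Qed.

Lemma two_fE x : x \in G -> cutoff x = (cutoff_val x)%:~R.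
Proof.
move=> Gx; rewrite !cfunE (Delta_torusE Gam tX Gx) (Delta_torusE Gam tX' Gx).
rewrite !cfInd1_fix_cosets ?(subset_trans (tor_MX tX)) // indexgg (GammaE ps Gx).
rewrite /cutoff_val; move: (Gamma_val G B T0 x) => g;
  rewrite !(rmorphD, rmorphB, rmorphM, rmorphN, rmorph1) /= -!pmulrn -/sC -/A -/q.
rewrite !rmorph_nat qXX' cXX' cXM.
set d := (x == 1%g)%:R.
by apply: (eq_of_sub_eq (congr1 ( *%R (2%:R * #|G|%:R * d)) s2)); ring.
Qed.

Lemma fix_cosets_odd x : x != 1%g -> conj_into G X' x -> fix_cosets G X' x = 2.
Proof. by move=> nt X'x; rewrite (torus_fix_cosets tX') // indexgg. Qed.

Let not_conj_M x : ~ conj_into G X x -> fix_cosets G M x = 0%N.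
Proof.
move=> nX; apply: fix_cosets_conj_none; first exact: subset_trans (tor_MX tX) sXG.
by case=> g Gg Mxg; apply: nX; exists g => //; apply: (subsetP (tor_MX tX)).
Qed.

Let nconj_CU (Y L K : {group gT}) t x : torus G #|k| CU Y L K t -> x \in CU ->
  ~ conj_into G Y x.
Proof. by move=> tY CUx [g Gg Yxg]; have := tor_CUJ tY CUx Gg; rewrite Yxg. Qed.

Let nconj_XX' x : x != 1%g -> x \in G -> conj_into G X x -> conj_into G X' x -> False.
Proof.
move=> nt Gx [g Gg Xxg] [h Gh X'xh].
have ntxg : (x ^ g)%g != 1%g by rewrite conjg_eq1.
have := disj Xxg ntxg (groupM (groupVr Gg) Gh).
by rewrite conjgM conjgK X'xh.
Qed.

(** [J] stands for the permutation character on the cosets of U O_2'(T0). The group O_2'(T0) is [M]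
    when [T0] is the even torus ([s = 1]), and all of [T0 = X'] when it is the odd one
    ([s = -1]). *)
Variable J : gT -> nat.
Hypothesis JE :
  (s = 1 /\ (J 1%g = #|X : M| * #|k|.+1)%N /\ forall x, x \in G -> x != 1%g ->
     J x = (#|X : M| * (x \in CU) + fix_cosets G M x)%N) \/
  (s = -1 /\ J 1%g = #|k|.+1 /\ forall x, x \in G -> x != 1%g ->
     J x = ((x \in CU) + fix_cosets G X' x)%N).

(** Doubled because [rest_val] is twice Rest; both sides are compared at 1 and on the conjugates of
    [U], [X] and [X'], which cover the group. *)
Lemma Psi_val_rest x : x \in G ->
  (Psi_val 2 G x)%:Z * 2%:R = (J x)%:Z * 2%:R
    + (#|X : M|%:Z - 2%:R) * Gamma_val G B T0 x + rest_val x.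
Proof.
move=> Gx; have [->|nt] := eqVneq x 1%g.
  have cX'Z : #|X'|%:Z = #|X|%:Z + s.
    by apply: (intr_inj (R := algC)); rewrite rmorphD /= -!pmulrn cXX'.
  have qZ : #|k|%:Z = #|X|%:Z + #|X'|%:Z.
    by apply: (intr_inj (R := algC)); rewrite rmorphD /= -!pmulrn -qXX'.
  have gE : Gamma_val G B T0 1 = #|k|%:Z ^+ 2 - 1.
    apply: (intr_inj (R := algC)); rewrite -(GammaE ps) // (Gamma1 ps).
    by rewrite rmorphB rmorphXn rmorph1 /= -pmulrn.
  have iX' : #|G : X'| = (#|k| * #|X| * 2)%N.
    apply/eqP; rewrite -(eqn_pmul2r (cardG_gt0 X')) mulnC Lagrange //.
    rewrite -(Lagrange (tor_NG tX)) (tor_cardN tX) index_torus_norm; apply/eqP; lia.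
  rewrite Psi_val1 /rest_val gE !fix_cosets1 ?(subset_trans (tor_MX tX)) //.
  rewrite iX' (torus_index tX) index_torus_norm.
  have A_gt0 : (0 < #|X : M|)%N by rewrite indexg_gt0.
  have pA : (#|X : M|.-1)%:Z = #|X : M|%:Z - 1 by rewrite -{2}(prednK A_gt0) -addn1 PoszD addrK.
  rewrite -[in LHS]addn1 PoszD PoszM pA.
  by case: JE => [] [sE [-> _]]; rewrite -[#|k|.+1]addn1 !PoszM ?PoszD ?qZ cX'Z sE; ring.
have gE := Gamma_val_ntriv ps Gx nt; rewrite /rest_val gE.
have JE' : (J x)%:Z = if s == 1 then #|X : M|%:Z * (x \in CU)%:Z + (fix_cosets G M x)%:Z
    else (x \in CU)%:Z + (fix_cosets G X' x)%:Z.
  by case: JE => [] [-> [_ ->]].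
have s1 : s = 1 \/ s = -1 by case: JE => [] [-> _]; [left | right].
rewrite JE'; case: (cover Gx nt) => [Ux|Xx|X'x].
- have CUx : x \in CU by apply/unip_classP.
  rewrite CUx Psi_val_unip // not_conj_M; last exact: nconj_CU tX CUx.
  rewrite fix_cosets_conj_none //; last exact: nconj_CU tX' CUx.
  by case: s1 => -> /=; ring.
- have nCU : (x \in CU) = false by apply/negP=> /(nconj_CU tX).
  rewrite nCU [fix_cosets G X' x]fix_cosets_conj_none //; last exact: nconj_XX' Xx.
  have [g Gg Xxg] := Xx; have ntxg : (x ^ g)%g != 1%g by rewrite conjg_eq1.
  have -> : Psi_val 2 G x = (if (x ^ g)%g \in M then #|X : M| else 0)%N.
    by rewrite -(Psi_valJ 2 Gx Gg) Psi_val_even.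
  have -> : fix_cosets G M x = (if (x ^ g)%g \in M then #|X : M| * 2 else 0)%N.
    have [Mxg|nMxg] := boolP (_ \in M); first by rewrite (torus_fix_cosets tX) //; exists g.
    apply: fix_cosets_conj_none; first exact: subset_trans (tor_MX tX) sXG.
    case=> h Gh Mxh; case/negP: nMxg.
    have Xxh := subsetP (tor_MX tX) _ Mxh; have ntxh : (x ^ h)%g != 1%g by rewrite conjg_eq1.
    have Nhg : (h^-1 * g)%g \in N.
      by rewrite -(tor_memJ tX Xxh ntxh) ?conjgM ?conjgK // groupM ?groupV.
    have Ghg : (h^-1 * g)%g \in G by rewrite groupM ?groupV.
    by have := torus_memJ_sub tX (tor_MX tX) Mxh ntxh Ghg; rewrite conjgM conjgK Nhg.
  by case: ifP => _; case: s1 => -> /=; rewrite ?PoszM; ring.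
- have nCU : (x \in CU) = false by apply/negP=> /(nconj_CU tX').
  rewrite nCU fix_cosets_odd // Psi_val_odd // not_conj_M; last by move/nconj_XX'; apply.
  by case: s1 => -> /=; ring.
Qed.

Hypothesis evX : ~~ odd #|X|.

Lemma even_index : exists a, #|X : M| = (a * 2)%N.
Proof.
have : ~~ odd (#|M| * #|X : M|) by rewrite Lagrange // (tor_MX tX).
rewrite oddM (tor_oddM tX) /= -dvdn2 => /dvdnP[a ->]; by exists a.
Qed.

(** The fixed points on cosets of [M] contribute [2 |X : M|], those on cosets of [X'] a factor 2,
    the difference of the odd numbers [|X'|] and [|M|] a factor 2, and [|G|] contributes
    [2 |X : M|]. *)
Lemma cutoff_val_dvd x : x \in G -> (4%:Z * #|X : M|%:Z %| cutoff_val x)%Z.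
Proof.
move=> Gx; have /dvdnP[c cE] := torus_fix_cosets_dvd tX Gx.
have /dvdnP[c' c'E] := torus_fix_cosets_dvd tX' Gx.
have [e eE] : exists e : int, #|X'|%:Z - #|M|%:Z = e * 2%:R.
  have h1 := odd_double_half #|X'|; have h2 := odd_double_half #|M|.
  exists (#|X'|./2%:Z - #|M|./2%:Z); rewrite -{1}h1 -{1}h2 oddX' (tor_oddM tX) -!muln2.
  by rewrite !PoszD !PoszM; ring.
have GE : #|G| = (#|G : N| * (#|M| * #|X : M| * 2))%N.
  by rewrite (Lagrange (tor_MX tX)) -(tor_cardN tX) mulnC Lagrange // (tor_NG tX).
apply/dvdzP; exists (#|G : N|%:Z * #|M|%:Z * (x == 1%g)%:R - s * #|X'|%:Z * c%:Z
    + s * #|M|%:Z * c'%:Z + s * e * Gamma_val G B T0 x).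
rewrite /cutoff_val cE c'E indexgg eE GE !PoszM; ring.
Qed.

(** As [2 |G| = 4 |X : M| cutoff_den], the idempotent [two_f / (2 |G|)] has the coefficients
    [cutoff_coef / cutoff_den], with odd denominator. *)
Definition cutoff_coef x : int := (cutoff_val x %/ (4%:Z * #|X : M|%:Z))%Z.
Definition cutoff_den : nat := #|G : N| * #|M|.

Let cutoff_coefE x : x \in G -> cutoff x = (cutoff_coef x)%:~R * (4%:R * A%:R).
Proof.
move=> Gx; rewrite two_fE // -{1}(divzK (cutoff_val_dvd Gx)) rmorphM rmorphM /=.
by rewrite -!pmulrn.
Qed.

Lemma cutoff_denE : #|G| = (cutoff_den * (#|X : M| * 2))%N.
Proof.
rewrite /cutoff_den -mulnA (mulnA #|M|) (Lagrange (tor_MX tX)) -(tor_cardN tX) mulnC.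
by rewrite Lagrange // (tor_NG tX).
Qed.

Lemma odd_cutoff_den : odd cutoff_den.
Proof.
by rewrite /cutoff_den oddM index_torus_norm oddM odd_card_field // oddX' (tor_oddM tX).
Qed.

Let nzA : A%:R != 0 :> algC. Proof. by rewrite pnatr_eq0 -lt0n indexg_gt0. Qed.
Let nz4A : 4%:R * A%:R != 0 :> algC. Proof. by rewrite mulf_neq0 // pnatr_eq0. Qed.

Let cG2 : 2%:R * #|G|%:R = (4%:R * A%:R) * cutoff_den%:R :> algC.
Proof. by rewrite cutoff_denE !natrM -/A; ring. Qed.

Let q_gt1 := psl2_gt1 k.
Let cardCU := card_unip_class ps.
Let Gam1 := Gamma1 ps.
Let GamU := GammaU ps.
Let Gam0 := Gamma0 ps.

Let sum_coef (h : gT -> algC) x : x \in G ->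
  \sum_(z in G) cutoff (z * x)%g * h z =
    (4%:R * A%:R) * \sum_(z in G) (cutoff_coef (z * x)%g)%:~R * h z.
Proof.
move=> Gx; rewrite mulr_sumr; apply: eq_bigr => z Gz.
by rewrite cutoff_coefE ?groupM // mulrAC [LHS]mulrC.
Qed.

Lemma cutoff_coef_idem x : x \in G ->
  \sum_(z in G) cutoff_coef (z * x)%g * cutoff_coef z^-1%g = cutoff_den%:Z * cutoff_coef x.
Proof.
move=> Gx; apply: (intr_inj (R := algC)); apply: (mulfI nz4A); apply: (mulIf nz4A).
have := two_f_idem cardG_C q_gt1 sCU cardCU GamZ Gam1 GamU Gam0 tX tX' erefl disj Gx.
rewrite cG2 (sum_coef (fun z => cutoff z^-1%g)) // cutoff_coefE // => e.
transitivity (4%:R * A%:R * cutoff_den%:R * ((cutoff_coef x)%:~R * (4%:R * A%:R)) : algC).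
  2: by rewrite intrM -pmulrn -!mulrA; congr (_ * (_ * _)); rewrite mulrCA.
rewrite -e -mulrA; congr (_ * _); rewrite rmorph_sum mulr_suml; apply: eq_bigr => z Gz.
by rewrite cutoff_coefE ?groupV // rmorphM mulrA.
Qed.

Lemma cutoff_coef_Gamma x : x \in G ->
  \sum_(z in G) cutoff_coef (z * x)%g * Gamma_val G B T0 z^-1%g = cutoff_den%:Z * rest_val x.
Proof.
move=> Gx; apply: (intr_inj (R := algC)); apply: (mulfI nz4A).
have := two_f_Gam cardG_C q_gt1 sCU cardCU GamZ Gam1 GamU Gam0 tX tX' Gx.
rewrite cG2 (sum_coef (fun z => Gam z^-1%g)) // two_restE // => e.
rewrite intrM -pmulrn [RHS]mulrA -e; congr (_ * _).
rewrite rmorph_sum; apply: eq_bigr => z Gz.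
by rewrite (GammaE ps) ?groupV // rmorphM.
Qed.

Lemma cutoff_coef_gauss x : x \in G ->
  \sum_(z in G) cutoff_coef (z * x)%g * unip_gauss G T0 u z^-1%g = 0.
Proof.
move=> Gx; apply: (intr_inj (R := algC)); apply: (mulfI nz4A).
have orth (Y L K : {group gT}) t (tY : torus G #|k| CU Y L K t) (i : Iirr Y) :
    '[unip_gauss_cfun G T0 u, rho_torus Gam i] = 0.
  by apply: (unip_gauss_orth ps) => // y; apply: (rho_torusU GamU tY).
have := two_f_orth cardG_C q_gt1 sCU cardCU GamZ Gam1 GamU Gam0 tX tX' Gx (orth _ _ _ _ tX)
  (orth _ _ _ _ tX').
rewrite (sum_coef (fun z => unip_gauss_cfun G T0 u z^-1%g)) // => e.
rewrite mulr0 -[RHS]e; congr (_ * _); rewrite rmorph_sum; apply: eq_bigr => z Gz.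
by rewrite unip_gauss_cfunE ?groupV // rmorphM.
Qed.

Lemma cutoff_coefJ x g : x \in G -> g \in G -> cutoff_coef (x ^ g)%g = cutoff_coef x.
Proof.
move=> Gx Gg; apply: (intr_inj (R := algC)); apply: (mulIf nz4A).
by rewrite -!cutoff_coefE ?groupJ // cfunJ.
Qed.

Lemma Psi1_char_even (H : {group gT}) : H \subset G -> J =1 fix_cosets G H ->
  Psi1 2 G \is a character.
Proof.
move=> sHG defJ; have [a aE] := even_index.
have a_gt0 : (0 < a)%N by have := indexg_gt0 X M; rewrite aE muln_gt0; case/andP.
have [psi Cpsi restE] :=
  two_rest_char cardG_C q_gt1 sCU cardCU GamZ Gam1 GamU Gam0 tX tX' erefl disj.
suff -> : Psi1 2 G = 'Ind[G, H] 1 + Gam *+ a.-1 + psi.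
  by rewrite !rpredD ?rpredMn ?cfInd_char ?cfun1_char ?(Gamma_char ps).
apply/cfun_inP=> x Gx; have nz2 : 2%:R != 0 :> algC by rewrite pnatr_eq0.
apply: (mulIf nz2).
have := Psi_val_rest Gx; have := two_restE Gx; have := GammaE ps Gx; rewrite restE.
move: (rest_val x) (Gamma_val G B T0 x) (Gamma G B T0) => r g gam gE rE.
move/(congr1 (fun z : int => z%:~R : algC)).
rewrite !(rmorphD, rmorphM) /= -rE /Psi1 -scaler_nat !cfunE ?ffunE Gx.
rewrite -gE cfInd1_fix_cosets // -defJ -!pmulrn => ->.
have -> : a.-1%:R = a%:R - 1 :> algC by rewrite -{2}(prednK a_gt0) -natr1 addrK.
rewrite aE natrM; ring.
Qed.

Section EvenAfforded.

Variables (R : idomainType) (K F : fieldType).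
Variables (iota : {rmorphism R -> K}) (rho : {rmorphism R -> F}).
Hypothesis sms : splitting_modular_system 2 G iota rho.

Let iota_inj := sms_frac_inj sms.
Let rho_surj := sms_residue_surj sms.
Let rho_ker := sms_residue_ker sms.

Let natK0 n : (n%:R == 0 :> K) = (n == 0)%N.
Proof. by have /pcharf0P := sms_pchar_frac sms. Qed.

Let natR n : (n.+1)%:R != 0 :> R.
Proof. by rewrite -(inj_eq iota_inj) rmorph0 rmorph_nat natK0. Qed.

Let unit_odd n : odd n -> (n%:R : R) \is a GRing.unit.
Proof.
move=> oddn; rewrite (unit_residue rho_ker) rmorph_nat.
by rewrite -(dvdn_pcharf (sms_pchar_residue sms)) dvdn2 oddn.
Qed.

Let uq : (#|k|%:R : R) \is a GRing.unit.
Proof. by rewrite unit_odd // odd_card_field. Qed.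

(** q is 1 or -1 modulo 4 according to whether -1 is a square. Thus (1 + c)/2 is a root of
    [X^2 - X - n], which is integral. *)
Lemma quad_charN1_mod4 : exists n : int, quad_char (-1 : k) * #|k|%:Z = 4%:R * n + 1.
Proof.
rewrite (card_field_half k2); set h := (#|k|.-1)./2.
have -> : quad_char (-1 : k) = (-1) ^+ h.
  rewrite /quad_char oppr_eq0 oner_eq0 -/h -[(-1) ^+ h in X in X = _]signr_odd -[RHS]signr_odd.
  by case: (odd h); rewrite ?expr0 ?expr1 ?eqxx // eq_sym (negPf (neq1N1 k2)).
rewrite -signr_odd -{2}(odd_double_half h); case: (odd h).
  exists (- (h./2)%:Z - 1); rewrite expr1 add1n -!muln2 !(intS, PoszM); ring.
by exists (h./2)%:Z; rewrite expr0 add0n -!muln2 !(intS, PoszM); ring.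
Qed.

Lemma integral_gauss_sum : exists y : R,
  (2%:R * y - 1) ^+ 2 = (quad_char (-1 : k))%:~R * #|k|%:R.
Proof.
have [n nE] := quad_charN1_mod4.
have nE' (L : pzRingType) : (quad_char (-1 : k))%:~R * #|k|%:R = 4%:R * n%:~R + 1 :> L.
  by rewrite -[#|k|%:R]/(#|k|%:Z%:~R) -intrM nE intrD intrM.
have [c] := splitting_gauss_sum ps k2 (sms_split_frac sms) (sms_pchar_frac sms).
rewrite nE' => cE; have nz2 : 2%:R != 0 :> K by rewrite natK0.
have [|y yE _] := @quadratic_integral _ _ iota (sms_complete_dvr sms) iota_inj
    (sms_frac_surj sms) n%:~R ((1 + c) / 2%:R).
  have -> : ((1 + c) / 2%:R) ^+ 2 - (1 + c) / 2%:R = (c ^+ 2 - 1) / 4%:R.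
    by field; rewrite natK0.
  by rewrite cE addrK rmorph_int mulrC mulKf // natK0.
exists y; rewrite nE' -yE; ring.
Qed.

Let D := cutoff_den.
Let uD : (D%:R : R) \is a GRing.unit. Proof. by rewrite unit_odd // odd_cutoff_den. Qed.

(** The hypotheses of [proj_cutoff] are the integer identities for [cutoff_coef] divided by [D],
    which is odd and so a unit of [R]. *)
Lemma rest_afforded : exists m, exists2 rM : mx_representation R G m,
  exists t, mx_trace1 rM t = 1%:M
  & {in G, forall x, 2%:R * \tr (rM x) = (rest_val x)%:~R}.
Proof.
have [y yE] := integral_gauss_sum.
pose a (x : gT) : R := (cutoff_coef x)%:~R / D%:R.
have [|||m [rM sM trM]] := proj_cutoff ps natR uq k2 yE rho_surj rho_ker (a := a).
- by move=> x g Gx Gg; rewrite /a cutoff_coefJ.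
- move=> x Gx; have := congr1 (fun z : int => z%:~R : R) (cutoff_coef_idem Gx).
  rewrite /= rmorph_sum intrM -pmulrn => e.
  transitivity ((\sum_(z in G) (cutoff_coef (z * x)%g * cutoff_coef z^-1%g)%:~R) / D%:R / D%:R : R).
    by rewrite !mulr_suml; apply: eq_bigr => z _; rewrite intrM /a; ring.
  by rewrite e mulrAC -/D [D%:R * _]mulrC mulrK.
- move=> x Gx; have := congr1 (fun z : int => z%:~R : R) (cutoff_coef_gauss Gx).
  rewrite /= rmorph_sum => e.
  transitivity ((\sum_(z in G) (cutoff_coef (z * x)%g * unip_gauss G T0 u z^-1%g)%:~R) / D%:R : R).
    rewrite mulr_suml; apply: eq_bigr => z _; rewrite intrM /a mulrAC; congr (_ * _ / _).
    rewrite rmorph_sum; apply: eq_bigr => c _; rewrite rmorph_sum; apply: eq_bigr => b _.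
    by rewrite rmorphM rmorph_nat.
  by rewrite e mul0r.
exists m, rM => // x Gx; rewrite trM //.
have := congr1 (fun z : int => z%:~R : R) (cutoff_coef_Gamma Gx).
rewrite /= rmorph_sum intrM -pmulrn => e.
transitivity ((\sum_(z in G) (cutoff_coef (z * x)%g * Gamma_val G B T0 z^-1%g)%:~R) / D%:R : R).
  rewrite mulr_suml; apply: eq_bigr => z _; rewrite intrM /a /Gamma_val intrB -!pmulrn.
  by rewrite mulrAC.
by rewrite e -/D [D%:R * _]mulrC mulrK.
Qed.

Lemma Psi_afforded_even (H : {group gT}) : H \subset G -> odd #|H| -> J =1 fix_cosets G H ->
  afforded_by_projective G iota (Psi_val 2 G).
Proof.
move=> sHG oddH defJ; have [a aE] := even_index.
have a_gt0 : (0 < a)%N by have := indexg_gt0 X M; rewrite aE muln_gt0; case/andP.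
have hJ : higman_afforded G iota (fun x => (J x)%:R).
  have [t tE] := coset_ker_trace1 sHG (unit_odd oddH).
  have [|||m [rM sM trM]] := proj_summand rho_surj rho_ker (rG := rset_repr R G)
      (E := kmx (coset_ker R G H)) (t := kmx t).
  - exact: coset_ker_idem.
  - by move=> x Gx; apply: rset_cent => A1 A2; apply: coset_ker_mulr.
  - by rewrite tE coset_ker_idem.
  exists m, rM => // x Gx; rewrite trM //= mxtrace_coset_ker // rmorph_nat.
  by rewrite defJ.
have hG : higman_afforded G iota (fun x => (Gamma_val G B T0 x)%:~R).
  have [t tE] := aug_ker_higman ps uq.
  have uBT : (#|B : T0|%:R : R) \is a GRing.unit.
    by rewrite -divgS ?(ps_sT0B ps) // (ps_cardB ps) mulnK.
  rewrite -(aug_ker_dirac0 ps) // in tE.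
  have gamma_idem := aug_ker_idem (subxx T0) (ps_sT0B ps) (ps_sBG ps) uBT.
  have [|||m [rM sM trM]] := proj_summand rho_surj rho_ker (rG := rset_repr R G)
      (E := kmx (aug_ker R G B T0)) (t := kmx t).
  - exact: gamma_idem.
  - by move=> x Gx; apply: rset_cent => A1 A2; apply: aug_ker_mulr => //; apply: ps.
  - by rewrite tE gamma_idem.
  exists m, rM => // x Gx; rewrite trM //= mxtrace_aug_ker ?(ps_sT0B ps) ?(ps_sBG ps) //.
  by rewrite /Gamma_val rmorphB !rmorph_nat intrB.
have [m [rM sM trM]] := rest_afforded.
have hR : higman_afforded G iota (fun x => iota (\tr (rM x))) by exists m, rM.
(* The summands are [J], [a - 1] copies of Gamma with [a = |X : M| / 2], and Rest; characters are
   compared after doubling, 2 being nonzero in [K]. *)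
apply: higman_afforded_projective; apply: eq_higman_afforded _ (higman_affordedD
  (higman_affordedD hJ (higman_affordedMn a.-1 hG)) hR) => x Gx.
have nz2 : 2%:R != 0 :> K by rewrite natK0.
apply: (mulIf nz2); have := congr1 iota (trM x Gx); rewrite rmorphM rmorph_nat rmorph_int.
have := Psi_val_rest Gx.
move: (rest_val x) (Gamma_val G B T0 x) => r g.
move/(congr1 (fun z : int => z%:~R : K)); rewrite !(intrD, intrM) aE -!pmulrn => -> <-.
have -> : g%:~R *+ a.-1 = (a%:R - 1) * g%:~R :> K.
  by rewrite -[LHS]mulr_natl; congr (_ * _); rewrite -{2}(prednK a_gt0) -natr1 addrK.
rewrite natrM; ring.
Qed.

End EvenAfforded.

End EvenTorus.

Section OddField.

Variables (k : finFieldType) (gT : finGroupType) (G U B T0 N0 T1 N1 : {group gT}).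
Variable u : k -> gT.
Hypothesis ps : psl2_structure G U B T0 N0 T1 N1 u.
Hypothesis k2 : 2%:R != 0 :> k.

Let odd_O2' (X : {group gT}) : odd #|'O_(2%N^')(X)|.
Proof. by rewrite odd_2'nat; apply: pcore_pgroup. Qed.

Lemma Psi2_odd_field : Psi1 2 G \is a character /\
  forall (R : idomainType) (K F : fieldType)
    (iota : {rmorphism R -> K}) (rho : {rmorphism R -> F}),
    splitting_modular_system 2 G iota rho ->
    afforded_by_projective G iota (Psi_val 2 G).
Proof.
have oddq : odd #|k| := odd_card_field k2.
(* The orders of [T0] and [T1] are consecutive integers, so exactly one of the tori is even and
   plays the part of [X]. *)
have [ev0|odd0] := boolP (~~ odd #|T0|).
  pose M := 'O_(2%N^')(T0)%G; have sMT : M \subset T0 := pcore_sub _ _.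
  have odd1 : odd #|T1| by rewrite (card_T1 ps).
  have tX : torus G #|k| (unip_class G U) T0 N0 M 1%:~R := torus_T0 ps sMT (odd_O2' T0).
  have tX' : torus G #|k| (unip_class G U) T1 N1 T1 (- 1%:~R) := torus_T1 ps (subxx T1) odd1.
  have sHG : U <*> M \subset G := subset_trans (joing_U_sub ps sMT) (ps_sBG ps).
  have oddH : odd #|U <*> M| by rewrite (card_joing_U ps sMT) oddM oddq odd_O2'.
  pose J := fix_cosets G (U <*> M).
  have JE : J 1%g = (#|T0 : M| * #|k|.+1)%N /\ forall x, x \in G -> x != 1%g ->
      J x = (#|T0 : M| * (x \in unip_class G U) + fix_cosets G M x)%N.
    split=> [|x Gx nt].
      rewrite /J fix_cosets1 // -divgS // (ps_cardG ps) (ps_cardB ps) (card_joing_U ps sMT).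
      rewrite -(Lagrange sMT) !mulnA -mulnA mulKn ?muln_gt0 ?cardG_gt0 //.
      by rewrite (ltnW (psl2_gt1 k)).
    by rewrite /J (fix_cosets_joing_U ps sMT) // (unip_class_expg ps Gx) nt.
  have disj := disjoint_T0_T1 ps.
  have JE1 P := @or_introl _ P (conj (erefl (1 : int)) JE).
  have cover := psl2_cover ps.
  split=> [|R K F iota rho sms].
    exact: (Psi1_char_even ps k2 tX tX' erefl cover disj (JE1 _) ev0 sHG).
  exact: (Psi_afforded_even ps k2 tX tX' erefl cover disj (JE1 _) ev0 sms sHG oddH).
have ev1 : ~~ odd #|T1| by rewrite (card_T1 ps).
rewrite negbK in odd0.
pose M := 'O_(2%N^')(T1)%G; have sMT : M \subset T1 := pcore_sub _ _.
have tX : torus G #|k| (unip_class G U) T1 N1 M (-1)%:~R := torus_T1 ps sMT (odd_O2' T1).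
have tX' : torus G #|k| (unip_class G U) T0 N0 T0 (- (-1)%:~R).
  by rewrite rmorphN1 opprK; apply: (torus_T0 ps (subxx T0) odd0).
have oddB : odd #|B| by rewrite (ps_cardB ps) oddM oddq.
have disj x y : x \in T1 -> x != 1%g -> y \in G -> (x ^ y)%g \notin T0.
  move=> Tx nt Gy; apply/negP=> Txy.
  have := disjoint_T0_T1 ps Txy; rewrite conjg_eq1 => /(_ y^-1%g nt).
  by rewrite groupV conjgK Tx => /(_ Gy).
have cover x : x \in G -> x != 1%g ->
    [\/ conj_into G U x, conj_into G T1 x | conj_into G T0 x].
  by move=> Gx nt; case: (psl2_cover ps Gx nt) => ?; [apply: Or31 | apply: Or33 | apply: Or32].
(* [T0] has odd order here, so U O_2'(T0) is all of [B]. *)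
pose J := fix_cosets G B.
have JE : J 1%g = #|k|.+1 /\ forall x, x \in G -> x != 1%g ->
    J x = ((x \in unip_class G U) + fix_cosets G T0 x)%N.
  split=> [|x Gx nt]; last exact: (fix_cosets_B ps).
  by rewrite /J fix_cosets1 ?(ps_sBG ps) // (index_borel ps).
have JE1 P := @or_intror P _ (conj (erefl (-1 : int)) JE).
split=> [|R K F iota rho sms].
  exact: (Psi1_char_even ps k2 tX tX' erefl cover disj (JE1 _) ev1 (ps_sBG ps)).
exact: (Psi_afforded_even ps k2 tX tX' erefl cover disj (JE1 _) ev1 sms (ps_sBG ps) oddB).
Qed.

End OddField.

Theorem theorem14p1 (q l e : nat) (l_prime : prime l) (e_gt0 : (0 < e)%N)
    (q_eq : q = (l ^ e)%N) (k : finFieldType) (card_k : #|k| = q)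
    (gT : finGroupType) (G : {group gT}) (isoG : (G \isog PSL2 k)%g)
    (p : nat) (p_prime : prime p) :
  Psi1 p G \is a character /\
  forall (R : idomainType) (K F : fieldType)
    (iota : {rmorphism R -> K}) (rho : {rmorphism R -> F}),
    splitting_modular_system p G iota rho ->
    afforded_by_projective G iota (Psi_val p G).
Proof.
have [phi mphi] := PSL2_model isoG.
have [abC|] := boolP (odd p || (2%:R == 0 :> k)).
  have {}abC : forall x, x \in G -> p.-elt x -> x != 1%g -> abelian 'C_G[x].
    by apply: (abelian_cent1_pelt mphi p_prime); case/orP: abC => [|/eqP]; [left | right].
  split; first exact: Psi1_char_abC.
  by move=> R K F iota rho; apply: Psi_afforded_abC.
rewrite negb_or => /andP[ev_p k2].
have p2 : p = 2 by case: (even_prime p_prime) => // odd_p; rewrite odd_p in ev_p.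
have [D nzD DN1] := exists_nonsquare k2.
rewrite p2; exact: Psi2_odd_field (psl2_structureP mphi k2 DN1) k2.
Qed.
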